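(* Let $n\ge1$, $a>0$, $s>0$. Let $(t_k)_{k=1}^\infty$ be a sequence of real numbers with $1>t_1>t_2>t_3>\dots>0$ and $\lim_{k\to\infty}t_k=0$, and let $E=\{t_k : k=1,2,3,\dots\}$. Assume that $$\sum_{m=0}^\infty N_E(2^{-m})\,2^{-2ms/a}<\infty$$ and that $f\in H_s(\mathbb{R}^n)$. Then $$\lim_{k\to\infty}S_{t_k}f(x)=f(x)$$ for almost every $x\in\mathbb{R}^n$.
   Context: The Fourier transform is $\hat f(\xi)=\int_{\mathbb{R}^n}e^{-i\xi\cdot x}f(x)\,dx$. For $f\in L^2(\mathbb{R}^n)$ and $a>0$, $S_tf(x)=(2\pi)^{-n}\int_{\mathbb{R}^n}e^{i\xi\cdot x}e^{it|\xi|^a}\hat f(\xi)\,d\xi$, i.e. $S_tf$ is the $L^2$ function with Fourier transform $e^{it|\xi|^a}\hat f(\xi)$. The Sobolev space is $H_s=\{f\in\mathscr{S}' : \|f\|_{H_s}<\infty\}$ with $\|f\|_{H_s}=\left(\int_{\mathbb{R}^n}(1+|\xi|^2)^s|\hat f(\xi)|^2\,d\xi\right)^{1/2}$. For a bounded set $E\subset\mathbb{R}$ and $r>0$, $N_E(r)$ denotes the minimal number $N$ of intervals $I_1,\dots,I_N$ of length $r$ such that $E\subset\bigcup_{l=1}^N I_l$. *)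

(* Defs.v *)
From HB Require Import structures.
From mathcomp Require Import all_boot all_order all_algebra.
From mathcomp Require Import all_classical all_reals all_analysis.
From mathcomp Require Import complex.

Set Implicit Arguments.
Unset Strict Implicit.
Unset Printing Implicit Defensive.
Import Order.TTheory GRing.Theory Num.Theory.
Import numFieldNormedType.Exports.
Import Normc.

Local Open Scope classical_set_scope.
Local Open Scope ring_scope.

(* Lebesgue measure on R^(n+1), given the one on R^n: the image of the product
   measure on R * R^n. *)
Section lebesgue_step.
Context (R : realType) (n : nat).
Notation T := (n.-tuple (measurableTypeR R)).
Notation T1 := (n.+1.-tuple (measurableTypeR R)).
Variable mu : {sigma_finite_measure set T -> \bar R}.

Definition cons_pair (p : measurableTypeR R * T) : T1 := [tuple of p.1 :: p.2].

Lemma measurable_cons_pair :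
  measurable_fun [set: measurableTypeR R * T] cons_pair.
Proof. by apply: measurable_cons. Qed.

Definition lebesgue_step : set T1 -> \bar R :=
  pushforward (@lebesgue_measure R \x mu)%E cons_pair.

Let step0 : lebesgue_step set0 = 0%E.
Proof. by rewrite /lebesgue_step /pushforward preimage_set0 measure0. Qed.

Let step_ge0 A : (0 <= lebesgue_step A)%E.
Proof. by rewrite /lebesgue_step /pushforward measure_ge0. Qed.

Let step_sigma_additive : semi_sigma_additive lebesgue_step.
Proof.
move=> F mF tF mUF; rewrite /lebesgue_step /pushforward preimage_bigcup.
have mpre A : measurable A -> measurable (cons_pair @^-1` A).
  by move=> mA; rewrite -[_ @^-1` _]setTI; exact: measurable_cons_pair.
apply: measure_semi_sigma_additive => [k||]; first exact: mpre.
- apply/trivIsetP => i j _ _ ij; rewrite -preimage_setI.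
  by move/trivIsetP : tF => /(_ _ _ _ _ ij) ->//; rewrite preimage_set0.
- by rewrite -preimage_bigcup; exact: mpre.
Qed.

HB.instance Definition _ :=
  isMeasure.Build _ _ _ lebesgue_step step0 step_ge0 step_sigma_additive.

Let step_sigma_finite : sigma_finite setT lebesgue_step.
Proof.
have /sigma_finiteP[F [TF ndF Foo]] := sigma_finiteT (@lebesgue_measure R).
have /sigma_finiteP[G [TG ndG Goo]] := sigma_finiteT mu.
pose g (x : T1) : measurableTypeR R * T := (thead x, [tuple of behead x]).
have mg : measurable_fun setT g.
  apply/measurable_fun_pair => /=; first exact: measurable_tnth.
  exact: measurable_behead.
have gK p : g (cons_pair p) = p.
  by case: p => x t; rewrite /g /cons_pair /= theadE; congr pair; apply/val_inj.
exists (fun k => g @^-1` (F k `*` G k)).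
  apply/seteqP; split => // x _.
  have [i _ Fi] : (\bigcup_k F k) (g x).1 by rewrite -TF.
  have [j _ Gj] : (\bigcup_k G k) (g x).2 by rewrite -TG.
  exists (maxn i j) => //; split => /=.
    by move: Fi; exact/subsetPset/ndF/leq_maxl.
  by move: Gj; exact/subsetPset/ndG/leq_maxr.
move=> k; have [mF Fk] := Foo k; have [mG Gk] := Goo k; split.
  by rewrite -[_ @^-1` _]setTI; apply: mg => //; exact: measurableX.
rewrite /lebesgue_step /pushforward -comp_preimage.
rewrite (_ : g \o cons_pair = id); last by apply/funext => p; exact: gK.
rewrite preimage_id product_measure1E//.
by rewrite lte_mul_pinfty// ge0_fin_numE.
Qed.

HB.instance Definition _ :=
  Measure_isSigmaFinite.Build _ _ _ lebesgue_step step_sigma_finite.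
End lebesgue_step.

(* As for `lebesgue_measure`, the sigma-algebra is the Borel one; `{ae _, _}`
   only asks for a Borel null superset. *)
Fixpoint lebesgueRn (R : realType) (n : nat) :
    {sigma_finite_measure set (n.-tuple (measurableTypeR R)) -> \bar R} :=
  match n with
  | 0 => \d_([tuple] : 0.-tuple (measurableTypeR R))
  | n'.+1 => lebesgue_step (lebesgueRn R n')
  end.

Lemma lebesgueRn_box (R : realType) (n : nat)
    (A : 'I_n -> set (measurableTypeR R)) :
  (forall i, measurable (A i)) ->
  lebesgueRn R n [set x | forall i, A i (tnth x i)] =
  (\prod_(i < n) lebesgue_measure (A i))%E.
Proof.
elim: n A => [|n IH] A mA.
  by rewrite big_ord0 /= diracE mem_set// => -[].
rewrite big_ord_recl -IH// -product_measure1E//; last first.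
  rewrite (_ : [set _ | _] =
    \bigcap_(i in [set: 'I_n]) ((fun x => tnth x i) @^-1` A (lift ord0 i))).
    apply: fin_bigcap_measurable => // i _; rewrite -[_ @^-1` _]setTI.
    exact: measurable_tnth.
  by apply/seteqP; split => [x Ax i _|x Ax i]; exact: Ax.
rewrite /= /lebesgue_step /pushforward; congr (_ _).
apply/seteqP; split => -[x y] /=.
  move=> H; split; first by have := H ord0; rewrite tnth0.
  by move=> i; have := H (lift ord0 i); rewrite tnthS.
move=> [Ax Ay] i; case: (unliftP ord0 i) => [j|] ->; rewrite ?tnthS ?tnth0//.
Qed.

Section covering_number.
Context (R : realType).
Implicit Types (E : set R) (r : R).

Definition covered E r (N : nat) : Prop :=
  exists I : 'I_N -> interval R,
    (forall l, lebesgue_measure [set` I l] = r%:E) /\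
    E `<=` \bigcup_(l in [set: 'I_N]) [set` I l].

(* The infimum is a minimum as soon as a finite covering exists (e.g. E bounded
   and 0 < r); otherwise it is +oo. *)
Definition covering_number E r : \bar R :=
  ereal_inf [set N%:R%:E | N in covered E r].

End covering_number.

Section fourier.
Context (R : realType) (n : nat).
Notation T := (n.-tuple (measurableTypeR R)).
Implicit Types (x xi : T) (f g : T -> R[i]) (u : nat -> T -> R[i]).

Definition dotRn x xi : R := \sum_(i < n) (tnth x i : R) * (tnth xi i : R).

Definition normRn x : R := Num.sqrt (dotRn x x).

Definition ballRn (r : R) : set T := [set x | normRn x <= r].

Definition expi (theta : R) : R[i] := (cos theta +i* sin theta)%C.

Definition integralC (D : set T) f : R[i] :=
  (Rintegral (lebesgueRn R n) D (fun x => complex.Re (f x)) +i*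
   Rintegral (lebesgueRn R n) D (fun x => complex.Im (f x)))%C.

(* The square of the L^2 norm. *)
Definition sqL2norm f : \bar R :=
  (\int[lebesgueRn R n]_x (normc (f x) ^+ 2)%:E)%E.

Definition inL2 f : Prop :=
  [/\ measurable_fun [set: T] (fun x => complex.Re (f x)),
      measurable_fun [set: T] (fun x => complex.Im (f x)) &
      (sqL2norm f < +oo)%E].

Definition cvgL2 u g : Prop :=
  inL2 g /\ sqL2norm (fun x => u k x - g x) @[k --> \oo] --> 0%E.

(* A representative of the L^2 limit, which is unique up to null sets
   (and 0 if there is no limit). *)
Definition limL2 u : T -> R[i] := xget (fun=> 0) [set g | cvgL2 u g].

(* On L^2, the integrals over R^n defining the Fourier transform and its inverse
   converge only in the L^2 sense (Plancherel), as limits of the integrals over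
   the balls of radius k. *)
Definition fourier f : T -> R[i] :=
  limL2 (fun k xi =>
    integralC (ballRn k%:R) (fun x => expi (- dotRn xi x) * f x)).

Definition inv_fourier g : T -> R[i] :=
  limL2 (fun k x =>
    ((2 * pi) ^- n)%:C%C *
    integralC (ballRn k%:R) (fun xi => expi (dotRn xi x) * g xi)).

Definition propagator (a t : R) f : T -> R[i] :=
  inv_fourier (fun xi => expi (t * normRn xi `^ a) * fourier f xi).

Definition sqHnorm (s : R) f : \bar R :=
  (\int[lebesgueRn R n]_xi
    ((1 + normRn xi ^+ 2) `^ s * normc (fourier f xi) ^+ 2)%:E)%E.

(* Meant for 0 <= s, when the tempered distributions in H_s are exactly the
   functions of L^2 with finite H_s norm. *)
Definition inH (s : R) f : Prop := inL2 f /\ (sqHnorm s f < +oo)%E.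

End fourier.

(* Main.v *)
(* Cut the frequencies into the shells [2^m < |xi|^a <= 2^(m+1)]. On the m-th
   shell [S_t f] moves in L^2 at speed at most [2^(m+1)] in [t]; since [t_k] is
   monotone, Cauchy-Schwarz bounds the telescoping sums along the [t_k] lying in
   an interval of length [2^-m], so on that interval the m-th pieces of all
   [S_{t_k} f] are dominated by one function whose squared L^2 norm is of the
   order of the energy of [f] in the shell. Summing over the [N_E(2^-m)] covering
   intervals, and using AM-GM with weights [N_E(2^-m) 2^(-2ms/a)] and the H_s
   norm of [f], the suprema over [k] of the m-th pieces are summable in [m] at
   almost every point. This domination allows letting first [k] and then [m] go
   to infinity.

   The L^2 bounds use only the Plancherel inequality for integrable functions,
   obtained from Schur's test applied to the product Poisson kernel (the Fourier
   transform of [prod_i exp(-e |xi_i|)]). The inversion formula, needed to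
   identify the limit, is tested against the indicators of boxes. *)

Require Import Defs.
From HB Require Import structures.
From mathcomp Require Import all_boot all_order all_algebra.
From mathcomp Require Import all_classical all_reals all_analysis.
From mathcomp Require Import measurable_realfun complex ring lra.

Set Implicit Arguments.
Unset Strict Implicit.
Unset Printing Implicit Defensive.
Import Order.TTheory GRing.Theory Num.Theory.
Import numFieldNormedType.Exports.
Import Normc.

Local Open Scope classical_set_scope.
Local Open Scope ring_scope.
Local Open Scope complex_scope.

(** * Complex-valued functions *)

(** [fourier] and [inv_fourier] select representatives of L^2 limits, so the estimates are made on
    the everywhere defined integrals over the balls [|xi|^a <= 2^m]. Fatou's lemma ties these to the
    propagator along subsequences, off one null set for each of the countably many times [t k].
    Inversion enters at time 0, where the limit in [m] must be recognized as [f]. The Cauchy-Schwarz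
    weights are the gaps [t k - t k.+1]: dividing the squared increments by them leaves, after
    integration, the sum of the gaps, at most the interval length however many [t k] it contains. At
    length [2^-m] this cancels the speed [2^(m+1)] up to a constant. In the AM-GM step the factor
    [N_E(2^-m)] of the weights cancels that of the maximal estimate and leaves the energies times
    [2^(2ms/a)], which the H_s norm controls. The frequencies [|xi| <= 1], below all shells, enter
    only through the limit in [k]. The weight [exp(-e |y|)] is elementary on both sides: its
    transform is rational, with arctangents as antiderivatives. *)

Section complex_modulus.
Context (R : realType).
Implicit Types x y : R[i].

Lemma ReD x y : complex.Re (x + y) = complex.Re x + complex.Re y.
Proof. by case: x; case: y. Qed.

Lemma ImD x y : complex.Im (x + y) = complex.Im x + complex.Im y.
Proof. by case: x; case: y. Qed.

Lemma ReN x : complex.Re (- x) = - complex.Re x.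
Proof. by case: x. Qed.

Lemma ImN x : complex.Im (- x) = - complex.Im x.
Proof. by case: x. Qed.

Lemma ReM x y : complex.Re (x * y) =
  complex.Re x * complex.Re y - complex.Im x * complex.Im y.
Proof. by case: x; case: y. Qed.

Lemma ImM x y : complex.Im (x * y) =
  complex.Re x * complex.Im y + complex.Im x * complex.Re y.
Proof. by case: x; case: y. Qed.

Definition ReImE := (ReD, ImD, ReN, ImN, ReM, ImM).

Lemma normc_ge0 x : 0 <= normc x.
Proof. by case: x => a b; rewrite /= sqrtr_ge0. Qed.

Lemma sqr_normcE x : normc x ^+ 2 = complex.Re x ^+ 2 + complex.Im x ^+ 2.
Proof. by case: x => a b; rewrite /= sqr_sqrtr// addr_ge0// sqr_ge0. Qed.

Lemma normcE_Re_Im x :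
  normc x = Num.sqrt (complex.Re x ^+ 2 + complex.Im x ^+ 2).
Proof. by case: x. Qed.

Lemma normr_Re_le x : `|complex.Re x| <= normc x.
Proof.
rewrite -(@ler_pXn2r _ 2)// ?nnegrE ?normc_ge0// sqr_normcE real_normK ?num_real//.
by rewrite lerDl sqr_ge0.
Qed.

Lemma normr_Im_le x : `|complex.Im x| <= normc x.
Proof.
rewrite -(@ler_pXn2r _ 2)// ?nnegrE ?normc_ge0// sqr_normcE real_normK ?num_real//.
by rewrite lerDr sqr_ge0.
Qed.

Lemma normc_real (r : R) : normc r%:C = `|r|.
Proof. by rewrite /= expr0n /= addr0 sqrtr_sqr. Qed.

Lemma normc_conj x : normc x^*%C = normc x.
Proof. by case: x => a b; rewrite /= sqrrN. Qed.

Lemma normcB x y : normc (x - y) = normc (y - x).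
Proof. by rewrite -normcN opprB. Qed.

Lemma sqr_normcD x y : normc (x + y) ^+ 2 <= 2 * normc x ^+ 2 + 2 * normc y ^+ 2.
Proof.
rewrite !sqr_normcE !ReImE.
have := sqr_ge0 (complex.Re x - complex.Re y).
have := sqr_ge0 (complex.Im x - complex.Im y).
nra.
Qed.

Lemma normc_expi (theta : R) : normc (expi theta) = 1.
Proof. by rewrite /expi /= cos2Dsin2 sqrtr1. Qed.

Lemma expiD (u v : R) : expi (u + v) = expi u * expi v.
Proof.
rewrite /expi cosD sinD; apply/eqP; rewrite eq_complex /= eqxx /=.
by apply/eqP; ring.
Qed.

Lemma expi0 : expi 0 = 1 :> R[i].
Proof. by rewrite /expi cos0 sin0. Qed.

Lemma conj_expi (u : R) : (expi u)^*%C = expi (- u).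
Proof. by rewrite /expi cosN sinN. Qed.

Lemma conjcM x y : (x * y)^*%C = x^*%C * y^*%C.
Proof. exact: rmorphM. Qed.

Lemma mul_conjc x : x * x^*%C = (normc x ^+ 2)%:C.
Proof.
rewrite sqr_normcE; case: x => a b; apply/eqP; rewrite eq_complex /=.
by apply/andP; split; apply/eqP; ring.
Qed.

End complex_modulus.

Section complex_measurable.
Context d (T : measurableType d) (R : realType).
Implicit Types (f g : T -> R[i]).

Definition cmeasurable f :=
  measurable_fun [set: T] (fun x => complex.Re (f x)) /\
  measurable_fun [set: T] (fun x => complex.Im (f x)).

Lemma cmeasurable_cst (c : R[i]) : cmeasurable (fun=> c).
Proof. by split; exact: measurable_cst. Qed.

Lemma cmeasurableD f g : cmeasurable f -> cmeasurable g ->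
  cmeasurable (fun x => f x + g x).
Proof.
move=> [f1 f2] [g1 g2]; split.
  by under eq_fun do rewrite ReD; exact: measurable_funD.
by under eq_fun do rewrite ImD; exact: measurable_funD.
Qed.

Lemma cmeasurableN f : cmeasurable f -> cmeasurable (fun x => - f x).
Proof.
move=> [f1 f2]; split.
  by under eq_fun do rewrite ReN; exact: measurable_funN.
by under eq_fun do rewrite ImN; exact: measurable_funN.
Qed.

Lemma cmeasurableB f g : cmeasurable f -> cmeasurable g ->
  cmeasurable (fun x => f x - g x).
Proof. by move=> mf mg; apply: cmeasurableD => //; exact: cmeasurableN. Qed.

Lemma cmeasurableM f g : cmeasurable f -> cmeasurable g ->
  cmeasurable (fun x => f x * g x).
Proof.
move=> [f1 f2] [g1 g2]; split.
  under eq_fun do rewrite ReM.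
  by apply: measurable_funB; exact: measurable_funM.
under eq_fun do rewrite ImM.
by apply: measurable_funD; exact: measurable_funM.
Qed.

Lemma cmeasurable_conj f : cmeasurable f -> cmeasurable (fun x => (f x)^*%C).
Proof.
move=> [f1 f2]; split.
  by apply: eq_measurable_fun f1 => x _; case: (f x).
apply: (eq_measurable_fun (fun x => - complex.Im (f x))).
  by move=> x _; case: (f x).
exact: measurable_funN.
Qed.

Lemma cmeasurable_real (h : T -> R) : measurable_fun [set: T] h ->
  cmeasurable (fun x => (h x)%:C).
Proof. by split => //; exact: measurable_cst. Qed.

Lemma cmeasurable_expi (h : T -> R) : measurable_fun [set: T] h ->
  cmeasurable (fun x => expi (h x)).
Proof.
move=> mh; split; rewrite /expi /=.
  by apply: measurableT_comp mh; apply: continuous_measurable_fun; exact: continuous_cos.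
by apply: measurableT_comp mh; apply: continuous_measurable_fun; exact: continuous_sin.
Qed.

Lemma measurable_normc f : cmeasurable f ->
  measurable_fun [set: T] (fun x => normc (f x)).
Proof.
move=> [f1 f2]; under eq_fun do rewrite normcE_Re_Im.
apply: measurableT_comp; first by apply: continuous_measurable_fun; exact: sqrt_continuous.
by apply: measurable_funD; exact: measurable_funX.
Qed.

Lemma emeasurable_normc f : cmeasurable f ->
  measurable_fun [set: T] (fun x => (normc (f x))%:E).
Proof. by move=> mf; exact/measurable_EFinP/measurable_normc. Qed.

Lemma emeasurable_sqr_normc f : cmeasurable f ->
  measurable_fun [set: T] (fun x => (normc (f x) ^+ 2)%:E).
Proof.
by move=> mf; apply/measurable_EFinP/measurable_funX; exact: measurable_normc.
Qed.

End complex_measurable.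

Lemma cmeasurable_comp d d' (T : measurableType d) (U : measurableType d')
    (R : realType) (f : U -> R[i]) (h : T -> U) :
  cmeasurable f -> measurable_fun [set: T] h -> cmeasurable (fun x => f (h x)).
Proof.
by move=> [f1 f2] mh; split; [exact: (measurableT_comp f1 mh)|exact: (measurableT_comp f2 mh)].
Qed.

(** * Complex-valued integrals *)

Section complex_integral.
Context d (T : measurableType d) (R : realType).
Variable mu : {measure set T -> \bar R}.
Implicit Types (f g : T -> R[i]) (c : R[i]).

(** The componentwise integral of [integralC], over a whole space and for any measure;
    [integralC_restr] links the two. *)
Definition cint f : R[i] :=
  (\int[mu]_x complex.Re (f x)) +i* (\int[mu]_x complex.Im (f x)).

Definition cintegrable f :=
  cmeasurable f /\ (\int[mu]_x (normc (f x))%:E < +oo)%E.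

Lemma cintegrable_le f (h : T -> R) : cmeasurable f ->
  measurable_fun [set: T] h -> (forall x, normc (f x) <= h x) ->
  (\int[mu]_x (h x)%:E < +oo)%E -> cintegrable f.
Proof.
move=> mf mh fh hoo; split => //; apply: le_lt_trans hoo.
apply: ge0_le_integral => //.
- by move=> x _; rewrite lee_fin normc_ge0.
- exact: emeasurable_normc.
- exact/measurable_EFinP.
- by move=> x _; rewrite lee_fin.
Qed.

Lemma cintegrable_Re f : cintegrable f ->
  mu.-integrable [set: T] (EFin \o (fun x => complex.Re (f x))).
Proof.
move=> [[f1 f2] foo]; apply/integrableP; split; first exact/measurable_EFinP.
apply: le_lt_trans foo; apply: ge0_le_integral => //.
- by apply/measurableT_comp => //; exact/measurable_EFinP.
- exact: emeasurable_normc.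
- by move=> x _; rewrite lee_fin normr_Re_le.
Qed.

Lemma cintegrable_Im f : cintegrable f ->
  mu.-integrable [set: T] (EFin \o (fun x => complex.Im (f x))).
Proof.
move=> [[f1 f2] foo]; apply/integrableP; split; first exact/measurable_EFinP.
apply: le_lt_trans foo; apply: ge0_le_integral => //.
- by apply/measurableT_comp => //; exact/measurable_EFinP.
- exact: emeasurable_normc.
- by move=> x _; rewrite lee_fin normr_Im_le.
Qed.

Lemma cintegrable_normc f : cintegrable f ->
  mu.-integrable [set: T] (EFin \o (fun x => normc (f x))).
Proof.
move=> [mf foo]; apply/integrableP; split; first exact: emeasurable_normc.
by under eq_integral do rewrite /= ger0_norm ?normc_ge0//.
Qed.

Lemma cintegrableD f g : cintegrable f -> cintegrable g ->
  cintegrable (fun x => f x + g x).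
Proof.
move=> [mf foo] [mg goo].
apply: (@cintegrable_le _ (fun x => normc (f x) + normc (g x))).
- exact: cmeasurableD.
- by apply: measurable_funD; exact: measurable_normc.
- by move=> x; exact: le_normcD.
- under eq_integral do rewrite EFinD.
  rewrite ge0_integralD//; first exact: lte_add_pinfty.
  + by move=> x _; rewrite lee_fin normc_ge0.
  + exact: emeasurable_normc.
  + by move=> x _; rewrite lee_fin normc_ge0.
  + exact: emeasurable_normc.
Qed.

Lemma cintegrableM f g (M : R) : cintegrable f -> cmeasurable g ->
  (forall x, normc (g x) <= M) -> cintegrable (fun x => g x * f x).
Proof.
move=> [mf foo] mg gM.
apply: (@cintegrable_le _ (fun x => `|M| * normc (f x))).
- exact: cmeasurableM.
- by apply: measurable_funM; [exact: measurable_cst|exact: measurable_normc].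
- move=> x; rewrite normcM ler_wpM2r ?normc_ge0//.
  by rewrite (le_trans (gM x))// ler_norm.
- under eq_integral do rewrite EFinM.
  rewrite ge0_integralZl_EFin//.
  + by rewrite lte_mul_pinfty.
  + by move=> x _; rewrite lee_fin normc_ge0.
  + exact: emeasurable_normc.
Qed.

Lemma cintegrableZ c f : cintegrable f -> cintegrable (fun x => c * f x).
Proof.
by move=> fi; apply: (cintegrableM (M := normc c)) => //; exact: cmeasurable_cst.
Qed.

Lemma cintegrableN f : cintegrable f -> cintegrable (fun x => - f x).
Proof.
by move=> [mf fo]; split; [exact: cmeasurableN|under eq_integral do rewrite normcN].
Qed.

Lemma cintegrableB f g : cintegrable f -> cintegrable g ->
  cintegrable (fun x => f x - g x).
Proof. by move=> fi gi; apply: cintegrableD => //; exact: cintegrableN. Qed.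

Lemma cintegrable_conj f : cintegrable f -> cintegrable (fun x => (f x)^*%C).
Proof.
move=> [mf fo]; split; first exact: cmeasurable_conj.
by under eq_integral do rewrite normc_conj.
Qed.

Lemma eq_cint f g : f =1 g -> cint f = cint g.
Proof. by move=> /funext ->. Qed.

Lemma cintD f g : cintegrable f -> cintegrable g ->
  cint (fun x => f x + g x) = cint f + cint g.
Proof.
move=> fi gi; rewrite /cint; apply/eqP; rewrite eq_complex /=.
rewrite -!RintegralD//; do ?[exact: cintegrable_Re|exact: cintegrable_Im].
by apply/andP; split; apply/eqP; apply: eq_Rintegral => x _; rewrite ?ReImE.
Qed.

Lemma cintN f : cintegrable f -> cint (fun x => - f x) = - cint f.
Proof.
move=> fi; rewrite /cint; apply/eqP; rewrite eq_complex /=.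
rewrite -(mulN1r (Rintegral _ _ _)) -RintegralZl//; last exact: cintegrable_Re.
rewrite -(mulN1r (Rintegral _ _ (fun x => complex.Im (f x)))).
rewrite -RintegralZl//; last exact: cintegrable_Im.
by apply/andP; split; apply/eqP; apply: eq_Rintegral => x _; rewrite ?ReImE mulN1r.
Qed.

Lemma cintB f g : cintegrable f -> cintegrable g ->
  cint (fun x => f x - g x) = cint f - cint g.
Proof. by move=> fi gi; rewrite cintD ?cintN//; exact: cintegrableN. Qed.

Lemma cintZ c f : cintegrable f -> cint (fun x => c * f x) = c * cint f.
Proof.
move=> fi; rewrite /cint; have fr := cintegrable_Re fi.
have fim := cintegrable_Im fi.
apply/eqP; rewrite eq_complex /= !ReImE /= -!RintegralZl//.
rewrite -RintegralB//; last 2 first.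
  exact: (integrableZl measurableT (complex.Re c) fr).
  exact: (integrableZl measurableT (complex.Im c) fim).
rewrite -RintegralD//; last 2 first.
  exact: (integrableZl measurableT (complex.Re c) fim).
  exact: (integrableZl measurableT (complex.Im c) fr).
by apply/andP; split; apply/eqP; apply: eq_Rintegral => x _; rewrite ?ReImE.
Qed.

Lemma cintZr c f : cintegrable f -> cint (fun x => f x * c) = cint f * c.
Proof.
by move=> fi; rewrite mulrC -cintZ//; apply: eq_cint => x; rewrite mulrC.
Qed.

Lemma cint_conj f : cintegrable f -> cint (fun x => (f x)^*%C) = (cint f)^*%C.
Proof.
move=> fi; rewrite /cint; apply/eqP; rewrite eq_complex /=.
rewrite -(mulN1r (Rintegral _ _ (fun x => complex.Im (f x)))).
rewrite -RintegralZl//; last exact: cintegrable_Im.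
apply/andP; split; apply/eqP; apply: eq_Rintegral => x _; case: (f x) => //= a b.
by rewrite mulN1r.
Qed.

Lemma cint_real (h : T -> R) :
  cint (fun x => (h x)%:C) = (\int[mu]_x h x)%:C.
Proof.
rewrite /cint /=; congr (_ +i* _).
by rewrite /Rintegral integral0.
Qed.

(* Rotate the integral onto the positive real axis. *)
Lemma normc_cint_le f : cintegrable f ->
  ((normc (cint f))%:E <= \int[mu]_x (normc (f x))%:E)%E.
Proof.
move=> fi; have [->|z0] := eqVneq (cint f) 0.
  by rewrite normc0 integral_ge0// => x _; rewrite lee_fin normc_ge0.
set z := cint f.
have nz : normc z != 0 by apply: contra_neq z0; exact: eq0_normc.
have nz0 : 0 < normc z by rewrite lt0r nz normc_ge0.
pose w := z^*%C / (normc z)%:C.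
have nw : normc w = 1.
  by rewrite normcM normcV normc_conj normc_real ger0_norm ?normc_ge0 // divff.
have wz : w * z = (normc z)%:C.
  rewrite /w mulrAC [z^*%C * z]mulrC mul_conjc expr2 rmorphM/= mulfK//.
  by apply/eqP => -[] /eqP; rewrite (negbTE nz).
have -> : (normc z)%:E = (\int[mu]_x (complex.Re (w * f x))%:E)%E.
  have : complex.Re (cint (fun x => w * f x)) = normc z by rewrite cintZ// wz.
  rewrite /cint /= => <-; rewrite /Rintegral fineK//.
  by apply: integrable_fin_num => //; apply: cintegrable_Re; exact: cintegrableZ.
apply: le_integral => //.
- by apply: cintegrable_Re; exact: cintegrableZ.
- exact: cintegrable_normc.
- move=> x _; rewrite lee_fin; apply: le_trans (ler_norm _) _.
  by apply: le_trans (normr_Re_le _) _; rewrite normcM nw mul1r.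
Qed.

Lemma cintegrable_dom f (g : T -> R) : cmeasurable f ->
  mu.-integrable [set: T] (EFin \o g) ->
  (forall x, normc (f x) <= g x) -> cintegrable f.
Proof.
move=> mf /integrableP[/measurable_EFinP mg goo] fg.
apply: (cintegrable_le mf mg fg).
apply: le_lt_trans goo; rewrite le_eqVlt; apply/orP; left; apply/eqP.
apply: eq_integral => x _ /=; rewrite ger0_norm//.
by apply: le_trans (fg x); exact: normc_ge0.
Qed.

(** Real dominated convergence for [normc (f_ k x - f x)], which is at most [2 g], combined with
    [normc_cint_le]. *)
Lemma cint_dominated_cvg (f_ : nat -> T -> R[i]) f (g : T -> R) :
  (forall k, cmeasurable (f_ k)) -> cmeasurable f ->
  {ae mu, forall x, normc (f_ k x - f x) @[k --> \oo] --> (0 : R)} ->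
  mu.-integrable [set: T] (EFin \o g) ->
  (forall k x, normc (f_ k x) <= g x) -> (forall x, normc (f x) <= g x) ->
  normc (cint (f_ k) - cint f) @[k --> \oo] --> (0 : R).
Proof.
move=> mf_ mf ff gi fg1 fg2.
have := @dominated_convergence _ T R mu setT measurableT
  (fun k x => (normc (f_ k x - f x))%:E) (cst 0%E) (EFin \o (fun x => g x + g x))
  (fun k => emeasurable_normc (cmeasurableB (mf_ k) mf)) (measurable_cst _).
have h1 : {ae mu, forall x, [set: T] x ->
    ((normc (f_ k x - f x))%:E @[k --> \oo] --> 0%E)}.
  by apply: filterS ff => x fx _; apply: cvg_EFin => //; exact: nearW.
have h2 : {ae mu, forall x k, [set: T] x ->
    (`|(normc (f_ k x - f x))%:E| <= (g x + g x)%R%:E)%E}.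
  apply/aeW => x k _; rewrite /= lee_fin ger0_norm ?normc_ge0//.
  by rewrite (le_trans (le_normcD _ _))// lerD// normcN.
have gi2 : mu.-integrable [set: T] (EFin \o (fun x => g x + g x)).
  exact: (integrableD measurableT gi gi).
move=> /(_ h1 gi2 h2)[_ _]; rewrite /= integral0 => cv.
suff : (normc (cint (f_ k) - cint f))%:E @[k --> \oo] --> 0%:E.
  by move/fine_cvg.
apply: (squeeze_cvge (f := fun=> 0%E)) cv; last exact: cvg_cst.
apply: nearW => k; rewrite lee_fin normc_ge0 -cintB.
- apply: normc_cint_le; apply: cintegrableB; exact: (cintegrable_dom _ gi).
- exact: (cintegrable_dom _ gi).
- exact: (cintegrable_dom _ gi).
Qed.
End complex_integral.

Section complex_fubini.
Context d1 d2 (T1 : measurableType d1) (T2 : measurableType d2) (R : realType).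
Variable m1 : {sigma_finite_measure set T1 -> \bar R}.
Variable m2 : {sigma_finite_measure set T2 -> \bar R}.
Variable f : T1 * T2 -> R[i].

Lemma cintegrable_prodP : cmeasurable f ->
  (\int[m1]_x \int[m2]_y (normc (f (x, y)))%:E < +oo)%E ->
  cintegrable (m1 \x m2)%E f.
Proof.
move=> mf foo; split => //.
rewrite fubini_tonelli1//; first exact: emeasurable_normc.
by move=> x; rewrite lee_fin normc_ge0.
Qed.

(** [Rintegral] applies [fine] to each inner integral. By integrability the inner integrals are
    finite almost everywhere, so this changes nothing in the outer one. *)
Let Rintegral_fubini (h : T1 * T2 -> R) :
  (m1 \x m2)%E.-integrable setT (EFin \o h) ->
  (\int[m1]_x \int[m2]_y (h (x, y)) = \int[(m1 \x m2)%E]_z h z) /\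
  (\int[m2]_y \int[m1]_x (h (x, y)) = \int[(m1 \x m2)%E]_z h z).
Proof.
move=> hi; split; rewrite /Rintegral; congr fine.
  rewrite -(integral12_prod_meas1 hi) /fubini_F.
  have mF := measurable_fubini_F hi.
  apply: ae_eq_integral => //.
  - apply/measurable_EFinP; apply: (measurableT_comp _ mF).
    exact: fine_measurable.
  - have := integrable_ae measurableT (integrable_fubini_F hi).
    by apply: filterS => x h0 _; rewrite fineK//; exact: h0.
rewrite -(integral21_prod_meas1 hi) /fubini_G.
have mF := measurable_fubini_G hi.
apply: ae_eq_integral => //.
- apply/measurable_EFinP; apply: (measurableT_comp _ mF).
  exact: fine_measurable.
- have := ae_integrable2 hi.
  by apply: filterS => x h0 _; rewrite fineK//; exact: integrable_fin_num h0.
Qed.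

Lemma cfubini : cintegrable (m1 \x m2)%E f ->
  cint m1 (fun x => cint m2 (fun y => f (x, y))) = cint (m1 \x m2)%E f /\
  cint m2 (fun y => cint m1 (fun x => f (x, y))) = cint (m1 \x m2)%E f.
Proof.
move=> fi.
have [r1 r2] := Rintegral_fubini (cintegrable_Re fi).
have [i1 i2] := Rintegral_fubini (cintegrable_Im fi).
by rewrite /cint /= r1 r2 i1 i2.
Qed.

End complex_fubini.

(** * Square-integrable functions *)

Section square_integrable.
Context d (T : measurableType d) (R : realType).
Variable mu : {measure set T -> \bar R}.
Implicit Types (f g : T -> R[i]) (c : R[i]).

Definition sq2 f : \bar R := (\int[mu]_x (normc (f x) ^+ 2)%:E)%E.

Definition L2 f := cmeasurable f /\ (sq2 f < +oo)%E.

Lemma sq2_ge0 f : (0 <= sq2 f)%E.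
Proof. by apply: integral_ge0 => x _; rewrite lee_fin sqr_ge0. Qed.

Lemma le_sq2 f g : cmeasurable f -> cmeasurable g ->
  (forall x, normc (f x) <= normc (g x)) -> (sq2 f <= sq2 g)%E.
Proof.
move=> mf mg fg; apply: ge0_le_integral => //.
- by move=> x _; rewrite lee_fin sqr_ge0.
- exact: emeasurable_sqr_normc.
- exact: emeasurable_sqr_normc.
- by move=> x _; rewrite lee_fin ler_pXn2r ?nnegrE ?normc_ge0.
Qed.

(** Squared norms satisfy the triangle inequality up to a factor 2. Repeated use of it is the origin
    of the fractions [e / 4] and [e / 12] in later limit arguments. *)
Lemma sq2D f g : cmeasurable f -> cmeasurable g ->
  (sq2 (fun x => f x + g x)%R <= 2%:E * sq2 f + 2%:E * sq2 g)%E.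
Proof.
move=> mf mg; rewrite /sq2 -!ge0_integralZl_EFin//; last 4 first.
- by move=> x _; rewrite lee_fin sqr_ge0.
- exact: emeasurable_sqr_normc.
- by move=> x _; rewrite lee_fin sqr_ge0.
- exact: emeasurable_sqr_normc.
have m2 h : cmeasurable h ->
    measurable_fun [set: T] (fun x => (2%:E * (normc (h x) ^+ 2)%:E)%E).
  by move=> mh; apply: measurable_funeM; exact: emeasurable_sqr_normc.
have p2 h x : (0 <= (2%:E * (normc (h x) ^+ 2)%:E : \bar R))%E.
  by rewrite -EFinM lee_fin mulr_ge0 ?sqr_ge0.
rewrite -ge0_integralD//; last 2 first.
- exact: m2.
- exact: m2.
apply: ge0_le_integral => //.
- by move=> x _; rewrite lee_fin sqr_ge0.
- by apply: emeasurable_sqr_normc; exact: cmeasurableD.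
- by apply: emeasurable_funD; exact: m2.
- by move=> x _; rewrite -!EFinM -EFinD lee_fin sqr_normcD.
Qed.

Lemma sq2N f : sq2 (fun x => - f x) = sq2 f.
Proof. by apply: eq_integral => x _; rewrite normcN. Qed.

Lemma sq2Bsym f g : sq2 (fun x => f x - g x) = sq2 (fun x => g x - f x).
Proof. by apply: eq_integral => x _; rewrite normcB. Qed.

Lemma sq2Z c f : cmeasurable f ->
  sq2 (fun x => c * f x) = ((normc c ^+ 2)%:E * sq2 f)%E.
Proof.
move=> mf; rewrite /sq2 -ge0_integralZl_EFin//; last 3 first.
- by move=> x _; rewrite lee_fin sqr_ge0.
- exact: emeasurable_sqr_normc.
- exact: sqr_ge0.
by apply: eq_integral => x _; rewrite normcM exprMn EFinM.
Qed.

Lemma L2_le f g : cmeasurable f -> L2 g ->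
  (forall x, normc (f x) <= normc (g x)) -> L2 f.
Proof. by move=> mf [mg goo] fg; split => //; apply: le_lt_trans goo; exact: le_sq2. Qed.

Lemma L2D f g : L2 f -> L2 g -> L2 (fun x => f x + g x).
Proof.
move=> [mf foo] [mg goo]; split; first exact: cmeasurableD.
apply: le_lt_trans (sq2D mf mg) _.
by apply: lte_add_pinfty; rewrite lte_mul_pinfty// lee_fin.
Qed.

Lemma L2B f g : L2 f -> L2 g -> L2 (fun x => f x - g x).
Proof.
move=> fi [mg goo]; apply: L2D => //; split; first exact: cmeasurableN.
by rewrite sq2N.
Qed.

Lemma L2Z c f : L2 f -> L2 (fun x => c * f x).
Proof.
move=> [mf foo]; split.
  by apply: cmeasurableM => //; exact: cmeasurable_cst.
by rewrite sq2Z// lte_mul_pinfty// lee_fin sqr_ge0.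
Qed.

Lemma L2_fin f : L2 f -> exists2 A : R, 0 <= A & sq2 f = A%:E.
Proof.
move=> [_ foo]; exists (fine (sq2 f)); first by rewrite fine_ge0// sq2_ge0.
by rewrite fineK// ge0_fin_numE// sq2_ge0.
Qed.

(** Young's inequality with a free parameter, in the role of Cauchy-Schwarz: a large [l] makes the
    pairing small when [f] is small and [g] is fixed. *)
Lemma L2_cint_mul f g (l : R) : 0 < l -> L2 f -> L2 g ->
  cintegrable mu (fun x => f x * g x) /\
  ((normc (cint mu (fun x => f x * g x)))%:E <= l%:E * sq2 f + l^-1%:E * sq2 g)%E.
Proof.
move=> l0 [mf foo] [mg goo].
pose h x := l * normc (f x) ^+ 2 + l^-1 * normc (g x) ^+ 2.
have hE : (\int[mu]_x (h x)%:E = l%:E * sq2 f + l^-1%:E * sq2 g)%E.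
  rewrite /sq2 -!ge0_integralZl_EFin//; last 6 first.
  - by move=> x _; rewrite lee_fin sqr_ge0.
  - exact: emeasurable_sqr_normc.
  - by rewrite invr_ge0 ltW.
  - by move=> x _; rewrite lee_fin sqr_ge0.
  - exact: emeasurable_sqr_normc.
  - exact: ltW.
  rewrite -ge0_integralD//.
  - by move=> x _; rewrite mule_ge0 ?lee_fin ?sqr_ge0 ?ltW.
  - by apply: measurable_funeM; exact: emeasurable_sqr_normc.
  - by move=> x _; rewrite mule_ge0 ?lee_fin ?sqr_ge0 ?invr_ge0 ?ltW.
  - by apply: measurable_funeM; exact: emeasurable_sqr_normc.
have hoo : (\int[mu]_x (h x)%:E < +oo)%E.
  rewrite hE; apply: lte_add_pinfty; rewrite lte_mul_pinfty// lee_fin.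
    exact: ltW.
  by rewrite invr_ge0 ltW.
have mh : measurable_fun [set: T] h.
  apply: measurable_funD; apply: measurable_funM => //;
    by apply: measurable_funX; exact: measurable_normc.
have amgm (u v : R) : 0 <= u -> 0 <= v -> l * (u * v) <= (l * u) ^+ 2 + v ^+ 2.
  move=> u0 v0; have uv0 : 0 <= l * u * v by rewrite !mulr_ge0// ltW.
  have := sqr_ge0 (l * u - v); rewrite sqrrB mulr2n; lra.
have fgh x : normc (f x * g x) <= h x.
  rewrite normcM /h.
  have -> : l * normc (f x) ^+ 2 + l^-1 * normc (g x) ^+ 2 =
      l^-1 * ((l * normc (f x)) ^+ 2 + normc (g x) ^+ 2).
    by rewrite exprMn mulrDr expr2 !mulrA mulVf ?mul1r// gt_eqF.
  by rewrite ler_pdivlMl//; apply: amgm; exact: normc_ge0.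
have mfg := cmeasurableM mf mg.
have fgi := cintegrable_le mfg mh fgh hoo.
split => //; rewrite -hE; apply: le_trans (normc_cint_le fgi) _.
apply: ge0_le_integral => //.
- by move=> x _; rewrite lee_fin normc_ge0.
- exact: emeasurable_normc.
- exact/measurable_EFinP.
- by move=> x _; rewrite lee_fin fgh.
Qed.

Lemma L2_cintegrable_mul f g : L2 f -> L2 g -> cintegrable mu (fun x => f x * g x).
Proof. by move=> fi gi; have [] := L2_cint_mul ltr01 fi gi. Qed.

Lemma measurable_limn_einf (u : nat -> T -> \bar R) :
  (forall k, measurable_fun [set: T] (u k)) ->
  measurable_fun [set: T] (fun x => limn_einf (fun k => u k x)).
Proof.
move=> mu_; rewrite /limn_einf; apply: measurableT_comp => //.
by apply: (@measurable_fun_limn_esup _ _ _ _ (fun k => \- u k)%E) => k;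
  exact: measurableT_comp.
Qed.

Lemma limn_einf_le (u : nat -> \bar R) (M : \bar R) :
  (\forall k \near \oo, (u k <= M)%E) -> (limn_einf u <= M)%E.
Proof.
move=> [N _ NM]; rewrite limn_einf_lim; apply: lime_le; first exact: is_cvg_einfs.
apply: nearW => k; apply: le_trans (NM (maxn k N) (leq_maxr _ _)).
by apply: ereal_inf_lbound; exists (maxn k N) => //=; exact: leq_maxl.
Qed.

(** Fatou's lemma in the form that serves both completeness (the bound holds from some index on) and
    the removal of the weight in Plancherel's inequality. *)
Lemma sq2_fatou (w_ : nat -> T -> R[i]) w (M : \bar R) :
  (forall k, cmeasurable (w_ k)) -> cmeasurable w ->
  {ae mu, forall x, normc (w_ k x) @[k --> \oo] --> normc (w x)} ->
  (\forall k \near \oo, (sq2 (w_ k) <= M)%E) -> (sq2 w <= M)%E.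
Proof.
move=> mw_ mw ww wM.
have -> : sq2 w = (\int[mu]_x limn_einf (fun k => (normc (w_ k x) ^+ 2)%:E))%E.
  apply: ae_eq_integral => //.
  - exact: emeasurable_sqr_normc.
  - by apply: measurable_limn_einf => k; exact: emeasurable_sqr_normc.
  - apply: filterS ww => x wx _; apply/esym.
    have cv : (normc (w_ k x) ^+ 2)%:E @[k --> \oo] --> (normc (w x) ^+ 2)%:E.
      by apply: cvg_EFin; [exact: nearW|exact: (cvgM wx wx)].
    rewrite is_cvg_limn_einfE; first exact/cvg_lim.
    by apply/cvg_ex; eexists; exact: cv.
apply: le_trans.
  apply: (fatou mu measurableT) => k; first exact: emeasurable_sqr_normc.
  by move=> x _; rewrite lee_fin sqr_ge0.
exact: limn_einf_le.
Qed.

(** By Fatou the lower limit of [normc (w_ k x) ^+ 2] has integral 0, hence vanishes almost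
    everywhere. This takes the place of extracting an almost everywhere convergent subsequence. *)
Lemma sq2_cvg0_frequently (w_ : nat -> T -> R[i]) :
  (forall k, cmeasurable (w_ k)) -> sq2 (w_ k) @[k --> \oo] --> 0%E ->
  {ae mu, forall x, forall (e : R) (N : nat), 0 < e ->
    exists2 k, (N <= k)%N & normc (w_ k x) < e}.
Proof.
move=> mw w0.
pose l x := limn_einf (fun k => (normc (w_ k x) ^+ 2)%:E).
have ml : measurable_fun [set: T] l.
  by apply: measurable_limn_einf => k; exact: emeasurable_sqr_normc.
have le0 x : (0 <= l x)%E.
  rewrite /l limn_einf_lim; apply: lime_ge; first exact: is_cvg_einfs.
  apply: nearW => k; apply: le_ereal_inf_tmp => _ [j _ <-].
  by rewrite lee_fin sqr_ge0.
have : (\int[mu]_x l x = 0)%E.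
  apply/eqP; rewrite eq_le integral_ge0// andbT.
  have /le_trans -> // : (\int[mu]_x l x <=
      limn_einf (fun k => sq2 (w_ k)))%E.
    apply: (fatou mu measurableT) => k; first exact: emeasurable_sqr_normc.
    by move=> x _; rewrite lee_fin sqr_ge0.
  by rewrite (cvg_limn_einf_sup w0).1.
have -> : (\int[mu]_x l x = \int[mu]_x `|l x|)%E.
  by apply: eq_integral => x _; rewrite gee0_abs.
move/(ae_eq_integral_abs mu measurableT ml).
apply: filterS => x /(_ Logic.I) lx0 e N e0; apply: contrapT => nk.
have ek k : (N <= k)%N -> e <= normc (w_ k x).
  by move=> Nk; rewrite leNgt; apply/negP => ?; apply: nk; exists k.
have : ((e ^+ 2)%:E <= l x)%E.
  rewrite /l limn_einf_lim; apply: lime_ge; first exact: is_cvg_einfs.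
  exists N => // k /= Nk; apply: le_ereal_inf_tmp => _ [j /= kj <-].
  rewrite lee_fin ler_pXn2r ?nnegrE ?normc_ge0 ?(ltW e0)//.
  by apply: ek; exact: leq_trans kj.
by rewrite lx0 lee_fin leNgt exprn_gt0.
Qed.

End square_integrable.

Lemma nneseries_partial_le (R : realType) (c : nat -> R) :
  (forall j, 0 <= c j) -> (\sum_(0 <= j <oo) (c j)%:E < +oo)%E ->
  exists M, forall n, \sum_(0 <= j < n) c j <= M.
Proof.
move=> c0 coo; exists (fine (\sum_(0 <= j <oo) (c j)%:E)) => n.
rewrite -lee_fin fineK; last first.
  by rewrite ge0_fin_numE//; apply: nneseries_ge0 => j _ _; rewrite lee_fin.
by rewrite -sumEFin; apply: nneseries_lim_ge => j _; rewrite lee_fin.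
Qed.

Lemma nneseries_half_lty (R : realType) :
  (\sum_(0 <= j <oo) ((2^-1 : R) ^+ j)%:E < +oo)%E.
Proof.
apply: (@le_lt_trans _ _ 2%:E); last exact: ltry.
apply: lime_le; first by apply: is_cvg_nneseries => j _ _; rewrite lee_fin exprn_ge0.
apply: nearW => n; rewrite sumEFin lee_fin.
have := @geometric_le_lim R n 1 2^-1 ler01.
rewrite invr_gt0 ger0_norm ?invr_ge0// invf_lt1 ?ltr1n//= => /(_ (ltr0n _ _) isT).
rewrite mul1r (_ : (1 - 2^-1 : R)^-1 = 2); last by field.
by rewrite /series /geometric /=; under eq_bigr do rewrite mul1r.
Qed.

Lemma bounded_series_cvg (R : realType) (a b : nat -> R) (M : R) :
  (forall j, `|a j| <= b j) -> (forall n, \sum_(0 <= j < n) b j <= M) ->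
  cvgn (series a).
Proof.
move=> ab bM; apply: normed_cvg; apply: nondecreasing_is_cvgn.
  by apply: nondecreasing_series => *; exact: normr_ge0.
exists M => _ [n _ <-]; rewrite /series /=.
by apply: le_trans (bM n); apply: ler_sum.
Qed.

Lemma cvge0_le (R : realType) (v : nat -> \bar R) : v k @[k --> \oo] --> 0%E ->
  forall e : R, 0 < e -> \forall k \near \oo, (v k <= e%:E)%E.
Proof.
move=> /fine_cvgP[fin cv] e e0; near=> k.
rewrite -(@fineK _ (v k)); last by near: k.
by rewrite lee_fin; near: k; exact: (cvgr_le _ cv).
Unshelve. all: by end_near. Qed.

Lemma le_cvge0 (R : realType) (v : nat -> \bar R) : (forall k, (0 <= v k)%E) ->
  (forall e : R, 0 < e -> \forall k \near \oo, (v k <= e%:E)%E) ->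
  v k @[k --> \oo] --> 0%E.
Proof.
move=> v0 ve.
have fin : \forall k \near \oo, v k \is a fin_num.
  apply: filterS (ve 1 ltr01) => k h1.
  by rewrite ge0_fin_numE// (le_lt_trans h1)// ltry.
apply/fine_cvgP; split => //; apply/cvgrPdist_le => e /ve; apply: filterS2 fin => k kf ke.
by rewrite sub0r normrN ger0_norm ?fine_ge0// -lee_fin fineK.
Qed.

Section almost_everywhere_summability.
Context d (T : measurableType d) (R : realType).
Variable mu : {measure set T -> \bar R}.

(* AM-GM: [a <= c + a^2 / c] turns summability of the squares, weighted by a
   summable sequence, into plain summability. *)
Lemma ae_weighted_summable (c : nat -> R) (W : nat -> T -> \bar R) :
  (forall j, 0 < c j) -> (\sum_(0 <= j <oo) (c j)%:E < +oo)%E ->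
  (forall j, measurable_fun [set: T] (W j)) -> (forall j x, (0 <= W j x)%E) ->
  (\sum_(0 <= j <oo) (c j)^-1%:E * \int[mu]_x W j x < +oo)%E ->
  {ae mu, forall x, exists (b : nat -> R) (M : R),
    [/\ forall j, 0 <= b j, forall n, \sum_(0 <= j < n) b j <= M &
        forall j (a : R), ((a ^+ 2)%:E <= W j x)%E -> a <= b j]}.
Proof.
move=> c0 coo mW W0 Woo.
have ci0 j : 0 <= (c j)^-1 by rewrite invr_ge0 ltW.
have mcW j : measurable_fun [set: T] (fun x => ((c j)^-1%:E * W j x)%E).
  exact: measurable_funeM.
have cW0 j x : (0 <= (c j)^-1%:E * W j x)%E by rewrite mule_ge0 ?lee_fin.
have iH : mu.-integrable [set: T] (fun x => \sum_(0 <= j <oo) (c j)^-1%:E * W j x)%E.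
  apply/integrableP; split.
    by apply: ge0_emeasurable_sum => // j x _ _; exact: cW0.
  rewrite (eq_integral (fun x => \sum_(0 <= j <oo) (c j)^-1%:E * W j x)%E); last first.
    by move=> x _; rewrite gee0_abs// nneseries_ge0.
  rewrite integral_nneseries//.
  under eq_eseriesr do rewrite ge0_integralZl_EFin//.
  exact: Woo.
have := integrable_ae measurableT iH; apply: filterS => x /(_ Logic.I) Hfin.
have [M1 cM] := nneseries_partial_le (fun j => ltW (c0 j)) coo.
have Hoo : (\sum_(0 <= j <oo) (c j)^-1%:E * W j x < +oo)%E.
  by rewrite -ge0_fin_numE// nneseries_ge0.
have Wfin j : W j x \is a fin_num.
  rewrite ge0_fin_numE//; rewrite ltNge leye_eq; apply/negP => /eqP Wy.
  have : ((c j)^-1%:E * W j x <= \sum_(0 <= j <oo) (c j)^-1%:E * W j x)%E.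
    apply: le_trans (nneseries_lim_ge j.+1 _); last by [].
    by rewrite big_nat_recr//= leeDr// sume_ge0.
  by rewrite Wy gt0_muley ?lte_fin ?invr_gt0// leNgt Hoo.
have cWE j : ((c j)^-1%:E * W j x)%E = ((c j)^-1 * fine (W j x))%:E.
  by rewrite EFinM fineK.
have fW0 j : 0 <= fine (W j x) by rewrite fine_ge0.
have [M2 WM] : exists M, forall n, \sum_(0 <= j < n) ((c j)^-1 * fine (W j x)) <= M.
  apply: nneseries_partial_le => [j|]; first by rewrite mulr_ge0.
  by move: Hoo; under eq_eseriesr do rewrite cWE.
exists (fun j => c j + (c j)^-1 * fine (W j x)), (M1 + M2); split.
- by move=> j; rewrite addr_ge0 ?mulr_ge0// ltW.
- by move=> n; rewrite big_split/= lerD.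
- move=> j a aW0; have aW : a ^+ 2 <= fine (W j x) by rewrite -lee_fin fineK.
  have [a0|a0] := leP a 0.
    by apply: le_trans a0 _; rewrite addr_ge0 ?mulr_ge0// ltW.
  apply: (@le_trans _ _ (c j + (c j)^-1 * a ^+ 2)); last first.
    by rewrite lerD2l ler_wpM2l.
  rewrite -(ler_pM2l (c0 j)) mulrDr mulrA divff ?gt_eqF// mul1r.
  have := sqr_ge0 (c j - a); rewrite sqrrB mulr2n -expr2.
  have := mulr_gt0 (c0 j) a0; lra.
Qed.

End almost_everywhere_summability.

(** * Completeness of L^2 and continuity of the pairing *)

Section L2_limits.
Context d (T : measurableType d) (R : realType).
Variable mu : {measure set T -> \bar R}.
Implicit Types (u : nat -> T -> R[i]) (f g : T -> R[i]).

Local Notation sq2 := (sq2 mu).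
Local Notation L2 := (L2 mu).

(** Riesz-Fischer. Along a subsequence the squared norms of the increments are at most [4^-j]; AM-GM
    with weights [2^-j] turns this into almost everywhere summability, because [4^-j / 2^-j] is
    still summable. *)
Lemma L2_complete u : (forall k, L2 (u k)) ->
  (forall e : R, 0 < e -> exists N : nat, forall p q, (N <= p)%N -> (N <= q)%N ->
    (sq2 (fun x => u p x - u q x)%R <= e%:E)%E) ->
  exists2 g, L2 g & sq2 (fun x => u k x - g x) @[k --> \oo] --> 0%E.
Proof.
move=> uL2 ucauchy; have mu_ k : cmeasurable (u k) by case: (uL2 k).
have h0 j : 0 < ((2^-1 : R) ^+ j) by rewrite exprn_gt0.
have /choice[N NP] j : exists N : nat, forall p q, (N <= p)%N -> (N <= q)%N ->
    (sq2 (fun x => u p x - u q x)%R <= ((2^-1) ^+ j * (2^-1) ^+ j)%:E)%E.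
  by apply: ucauchy; rewrite mulr_gt0.
(* Summing the [(N i).+1] makes [phi] nondecreasing and at least [N i] for all [i <= j]; the
   successors also give [j <= phi j]. *)
pose phi j := (\sum_(0 <= i < j.+1) (N i).+1)%N.
have Nphi j : (N j <= phi j)%N by rewrite /phi big_nat_recr//= addnS ltnW// ltnS leq_addl.
have phiS j : (phi j <= phi j.+1)%N.
  by rewrite /phi [X in (_ <= X)%N]big_nat_recr//= leq_addr.
have phi_ge i j : (i <= j)%N -> (N i <= phi j)%N.
  move=> /subnKC <-; elim: (j - i)%N => [|k IH]; first by rewrite addn0 Nphi.
  by rewrite addnS (leq_trans IH)// phiS.
pose v j := u (phi j).
pose del j x := v j.+1 x - v j x.
have mv j : cmeasurable (v j) by exact: mu_.
have mdel j : cmeasurable (del j) by exact: (cmeasurableB (mv j.+1) (mv j)).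
pose W j x := (normc (del j x) ^+ 2)%:E.
have mW j : measurable_fun [set: T] (W j) by exact: emeasurable_sqr_normc.
have W0 j x : (0 <= W j x)%E by rewrite lee_fin sqr_ge0.
have Woo : (\sum_(0 <= j <oo) ((2^-1 : R) ^+ j)^-1%:E * \int[mu]_x W j x < +oo)%E.
  apply: le_lt_trans (nneseries_half_lty R); apply: lee_nneseries => [j _ _|j _].
    by apply: mule_ge0; [rewrite lee_fin invr_ge0 ltW|exact: integral_ge0].
  apply: (@le_trans _ _ (((2^-1) ^+ j)^-1%:E * ((2^-1) ^+ j * (2^-1) ^+ j)%:E)%E).
    apply: lee_wpmul2l; first by rewrite lee_fin invr_ge0 ltW.
    by apply: NP => //; exact: phi_ge.
  by rewrite -EFinM mulrA mulVf ?gt_eqF// mul1r.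
have [N0 [mN0 muN0 N0P]] := ae_weighted_summable h0 (nneseries_half_lty R) mW W0 Woo.
have vcvg x : ~ N0 x -> cvgn (fun j => complex.Re (v j x)) /\
    cvgn (fun j => complex.Im (v j x)).
  move=> N0x; have [b [M [b0 bM Wb]]] : exists (b : nat -> R) (M : R),
      [/\ forall j, 0 <= b j, forall n, \sum_(0 <= j < n) b j <= M &
        forall j (a : R), ((a ^+ 2)%:E <= W j x)%E -> a <= b j].
    by apply: contrapT => nP; apply: N0x; exact: N0P.
  have dP j : normc (del j x) <= b j by apply: Wb.
  (* [P] is the real or imaginary part; the telescoping series of increments is dominated by [b]. *)
  have tel (P : R[i] -> R) : (forall y z, P y - P z = P (y - z)) ->
      (forall y, `|P y| <= normc y) -> cvgn (fun j => P (v j x)).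
    move=> PB Pn.
    have -> : (fun j => P (v j x)) = (fun j => P (v 0%N x) +
        series (fun j => P (del j x)) j).
      apply/funext => j; rewrite /series /=.
      rewrite (eq_bigr (fun j => P (v j.+1 x) - P (v j x))); last first.
        by move=> i _; rewrite PB.
      by rewrite telescope_sumr// addrC subrK.
    apply: is_cvgD; first exact: is_cvg_cst.
    apply: (bounded_series_cvg (b := b) (M := M)) => // j.
    exact: le_trans (Pn _) (dP j).
  split; apply: tel; [|exact: normr_Re_le| |exact: normr_Im_le].
    by move=> y z; rewrite !ReImE.
  by move=> y z; rewrite !ReImE.
(* With the value 0 on the measurable null set [N0], [g] is an everywhere limit of measurable
   functions. *)
pose g x := if x \in N0 then 0 else
  (limn (fun j => complex.Re (v j x)) +i* limn (fun j => complex.Im (v j x))).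
have mlim (P : R[i] -> R) : (forall x, ~ N0 x -> cvgn (fun j => P (v j x))) ->
    (forall j, measurable_fun [set: T] (fun x => P (v j x))) ->
    measurable_fun [set: T]
      (fun x => if x \in N0 then 0 else limn (fun j => P (v j x))).
  move=> Pc mP.
  apply: (@measurable_fun_cvg _ _ _ _
    (fun j x => (\1_(~` N0) x : R) * P (v j x))) => [j|x _].
    apply: measurable_funM => //; apply: measurable_indic.
    exact: measurableC.
  rewrite indicE in_setC; case: ifPn => xN0 /=.
    by under eq_fun do rewrite mul0r; exact: cvg_cst.
  under eq_fun do rewrite mul1r.
  by apply: Pc => /mem_set; rewrite (negbTE xN0).
have mg : cmeasurable g.
  split.
    apply: eq_measurable_fun (mlim (@complex.Re R) _ _).
    - by move=> x _; rewrite /g; case: ifP.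
    - by move=> x /vcvg[].
    - by move=> j; case: (mu_ (phi j)).
  apply: eq_measurable_fun (mlim (@complex.Im R) _ _).
  - by move=> x _; rewrite /g; case: ifP.
  - by move=> x /vcvg[].
  - by move=> j; case: (mu_ (phi j)).
have ug e : 0 < e -> exists N1 : nat, forall p, (N1 <= p)%N ->
    (sq2 (fun x => u p x - g x)%R <= e%:E)%E.
  move=> /ucauchy[N1 N1P]; exists N1 => p N1p.
  have phi_j j : (j <= phi j)%N.
    elim: j => // j IH; rewrite /phi big_nat_recr//= addnS ltnS.
    by apply: leq_trans IH _; exact: leq_addr.
  (* With [p] fixed, letting [j] grow in the Cauchy bound for [u p - u (phi j)] bounds [u p - g], so
     the full sequence converges. *)
  apply: (@sq2_fatou _ _ _ _ (fun j x => u p x - v j x)).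
  - by move=> j; exact: cmeasurableB.
  - exact: cmeasurableB.
  - exists N0; split=> // x /=; apply: contra_notP => N0x.
    have [cr ci] := vcvg _ N0x.
    have gR : complex.Re (g x) = limn (fun j => complex.Re (v j x)).
      by rewrite /g; case: ifPn => //; rewrite inE.
    have gI : complex.Im (g x) = limn (fun j => complex.Im (v j x)).
      by rewrite /g; case: ifPn => //; rewrite inE.
    have cvR : complex.Re (u p x - v j x) @[j --> \oo] --> complex.Re (u p x - g x).
      rewrite !ReImE gR; under eq_fun do rewrite !ReImE.
      by apply: cvgB => //; exact: cvg_cst.
    have cvI : complex.Im (u p x - v j x) @[j --> \oo] --> complex.Im (u p x - g x).
      rewrite !ReImE gI; under eq_fun do rewrite !ReImE.
      by apply: cvgB => //; exact: cvg_cst.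
    under eq_fun do rewrite normcE_Re_Im; rewrite normcE_Re_Im.
    have h : (fun j => complex.Re (u p x - v j x) ^+ 2 +
        complex.Im (u p x - v j x) ^+ 2) @ \oo -->
      complex.Re (u p x - g x) ^+ 2 + complex.Im (u p x - g x) ^+ 2.
      by apply: cvgD; [exact: (cvgM cvR cvR)|exact: (cvgM cvI cvI)].
    exact: (cvg_comp _ _ h (@sqrt_continuous R _)).
  - by exists N1 => // j /= N1j; apply: N1P => //; exact: leq_trans (phi_j j).
exists g.
  have [N1 N1P] := ug 1 ltr01; split => //.
  rewrite (_ : sq2 g = sq2 (fun x => u N1 x - (u N1 x - g x))); last first.
    by congr sq2; apply/funext => x; rewrite subKr.
  have [] // : L2 (fun x => u N1 x - (u N1 x - g x)).
  apply: L2B => //; split; first exact: cmeasurableB.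
  by apply: le_lt_trans (N1P _ (leqnn _)) _; exact: ltry.
apply/fine_cvgP; split.
  have [N1 N1P] := ug 1 ltr01; exists N1 => // p /= /N1P h1.
  by rewrite ge0_fin_numE ?sq2_ge0// (le_lt_trans h1)// ltry.
apply/cvgrPdist_le => e e0; have [N1 N1P] := ug e e0.
exists N1 => // p /= /N1P h1; rewrite sub0r normrN ger0_norm ?fine_ge0 ?sq2_ge0//.
rewrite -lee_fin fineK// ge0_fin_numE ?sq2_ge0//.
by rewrite (le_lt_trans h1)// ltry.
Qed.

Lemma cvg_L2_cint_mul u g b : (forall k, L2 (u k)) -> L2 g -> L2 b ->
  sq2 (fun x => u k x - g x) @[k --> \oo] --> 0%E ->
  normc (cint mu (fun x => u k x * b x) - cint mu (fun x => g x * b x)) @[k --> \oo]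
    --> (0 : R).
Proof.
move=> uL gL bL ug; have [B B0 BE] := L2_fin bL.
apply/cvgrPdist_le => e e0.
(* Chosen so that both terms of [L2_cint_mul] are at most [e / 2]; [B + 1] stays positive when [b]
   vanishes almost everywhere. *)
pose l := 2 * (B + 1) / e.
have B1 : 0 < B + 1 by rewrite ltr_wpDl.
have l0 : 0 < l by apply: divr_gt0 => //; exact: mulr_gt0.
have el0 : 0 < e / (2 * l) by apply: divr_gt0 => //; exact: mulr_gt0.
have := cvge0_le ug el0; apply: filterS => k ke.
rewrite sub0r normrN ger0_norm ?normc_ge0// -lee_fin.
rewrite -cintB; [|exact: L2_cintegrable_mul|exact: L2_cintegrable_mul].
rewrite (@eq_cint _ _ _ _ _ (fun x => (u k x - g x) * b x)); last first.
  by move=> x; rewrite mulrBl.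
have [_ /le_trans] := L2_cint_mul l0 (L2B (uL k) gL) bL; apply.
rewrite BE; apply: (@le_trans _ _ (l%:E * (e / (2 * l))%:E + l^-1%:E * B%:E)%E).
  by rewrite leeD2r// lee_wpmul2l// lee_fin ltW.
rewrite -!EFinM -EFinD lee_fin /l.
have -> : 2 * (B + 1) / e * (e / (2 * (2 * (B + 1) / e))) + (2 * (B + 1) / e)^-1 * B
  = e / 2 + e / 2 * (B / (B + 1)).
  by field; rewrite !gt_eqF.
have : B / (B + 1) <= 1 by rewrite ler_pdivrMr// mul1r lerDl.
move: (B / (B + 1)) => z z1; nra.
Qed.

End L2_limits.

(** * Integration of product functions over R^n *)

Section product_integrals.
Context (R : realType).
Local Notation leb := (@lebesgue_measure R).
Local Notation T n := (n.-tuple (measurableTypeR R)).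

Lemma ge0_integral_lebesgueRnS n (f : T n.+1 -> \bar R) :
  measurable_fun [set: T n.+1] f -> (forall x, (0 <= f x)%E) ->
  (\int[lebesgueRn R n.+1]_x f x =
   \int[leb \x lebesgueRn R n]_p f (cons_pair p))%E.
Proof.
move=> mf f0.
rewrite -[RHS](ge0_integral_pushforward (@measurable_cons_pair R n) _ measurableT mf) //.
Qed.

Lemma cint_lebesgueRnS n (f : T n.+1 -> R[i]) :
  cintegrable (lebesgueRn R n.+1) f ->
  cint (lebesgueRn R n.+1) f =
  cint (leb \x lebesgueRn R n)%E (fun p => f (cons_pair p)).
Proof.
move=> fi; have [[m1 m2] _] := fi.
have fi' : cintegrable (leb \x lebesgueRn R n)%E (fun p => f (cons_pair p)).
  case: fi => mf foo; split.
    by apply: cmeasurable_comp mf _; exact: measurable_cons_pair.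
  rewrite -(ge0_integral_lebesgueRnS (f := fun x => (normc (f x))%:E))//.
    exact: emeasurable_normc.
  by move=> x; rewrite lee_fin normc_ge0.
rewrite /cint /Rintegral; congr (fine _ +i* fine _).
  exact: (integral_pushforward (@measurable_cons_pair R n)
    ((measurable_EFinP _ _).2 m1) (cintegrable_Re fi') measurableT).
exact: (integral_pushforward (@measurable_cons_pair R n)
  ((measurable_EFinP _ _).2 m2) (cintegrable_Im fi') measurableT).
Qed.

Lemma measurable_tnthR n (i : 'I_n) :
  measurable_fun [set: T n] (fun x : T n => tnth x i : R).
Proof. exact: measurable_tnth. Qed.

Lemma measurable_prod_tnth n (h : 'I_n -> R -> R) :
  (forall i, measurable_fun [set: R] (h i)) ->
  measurable_fun [set: T n] (fun x : T n => \prod_(i < n) h i (tnth x i)).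
Proof.
move=> mh; apply: measurable_prod => i _.
by apply: (measurableT_comp (mh i)); exact: measurable_tnthR.
Qed.

Lemma ge0_integral_prod n (h : 'I_n -> R -> R) :
  (forall i, measurable_fun [set: R] (h i)) -> (forall i y, 0 <= h i y) ->
  (\int[lebesgueRn R n]_x (\prod_(i < n) h i (tnth x i))%:E =
   \prod_(i < n) \int[leb]_y (h i y)%:E)%E.
Proof.
elim: n h => [|n IH] h mh h0.
  rewrite big_ord0 /= integral_dirac//; last first.
    by under eq_fun do rewrite big_ord0; exact: measurable_cst.
  by rewrite diracE mem_set// mul1e big_ord0.
rewrite ge0_integral_lebesgueRnS; last 2 first.
- by apply/measurable_EFinP; exact: measurable_prod_tnth.
- by move=> x; rewrite lee_fin prodr_ge0.
under eq_integral => p _.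
  rewrite big_ord_recl tnth0 /=.
  under eq_bigr do rewrite tnthS.
  over.
rewrite big_ord_recl -IH//.
rewrite fubini_tonelli1; last 2 first.
- apply/measurable_EFinP; apply: measurable_funM.
    exact: (measurableT_comp (mh ord0) measurable_fst).
  exact: (measurableT_comp (measurable_prod_tnth (fun i => mh (lift ord0 i)))
    measurable_snd).
- by move=> p; rewrite lee_fin mulr_ge0// prodr_ge0.
rewrite /fubini_F /=.
under eq_integral => y _.
  under eq_integral do rewrite EFinM.
  rewrite ge0_integralZl_EFin//; last 2 first.
  - by move=> x _; rewrite lee_fin prodr_ge0.
  - apply/measurable_EFinP. 
    exact: (measurable_prod_tnth (fun i => mh (lift ord0 i))).
  over.
rewrite ge0_integralZr//.
- by apply/measurable_EFinP; exact: mh.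
- by move=> y _; rewrite lee_fin.
- by apply: integral_ge0 => x _; rewrite lee_fin prodr_ge0.
Qed.
End product_integrals.

Section complex_product_integral.
Context (R : realType).
Local Notation leb := (@lebesgue_measure R).
Local Notation T n := (n.-tuple (measurableTypeR R)).

Lemma normc_prod (n : nat) (z : 'I_n -> R[i]) :
  normc (\prod_(i < n) z i) = \prod_(i < n) normc (z i).
Proof. exact: (big_morph _ (@normcM R) (@normc1 R)). Qed.

Lemma cmeasurable_prod_tnth n (h : 'I_n -> measurableTypeR R -> R[i]) :
  (forall i, cmeasurable (h i)) ->
  cmeasurable (fun x : T n => \prod_(i < n) h i (tnth x i)).
Proof.
elim: n h => [|n IH] h mh.
  by under eq_fun do rewrite big_ord0; exact: cmeasurable_cst.
under eq_fun do rewrite big_ord_recl.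
apply: cmeasurableM; first exact: cmeasurable_comp (mh _) (measurable_tnth _).
have := cmeasurable_comp (IH _ (fun i => mh (lift ord0 i))) (@measurable_behead _ _ _).
congr cmeasurable; apply/funext => x; apply: eq_bigr => i _.
by rewrite [in RHS](tuple_eta x) tnthS.
Qed.

Lemma cintegrable_prod n (h : 'I_n -> measurableTypeR R -> R[i]) :
  (forall i, cintegrable leb (h i)) ->
  cintegrable (lebesgueRn R n) (fun x : T n => \prod_(i < n) h i (tnth x i)).
Proof.
move=> hi; split; first by apply: cmeasurable_prod_tnth => i; case: (hi i).
under eq_integral do rewrite normc_prod.
rewrite (ge0_integral_prod (h := fun i y => normc (h i y))).
- have : forall i, (\int[leb]_y (normc (h i y))%:E \is a fin_num)%E.
    move=> i; rewrite ge0_fin_numE; first by case: (hi i).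
    by apply: integral_ge0 => y _; rewrite lee_fin normc_ge0.
  move=> fin; rewrite -ge0_fin_numE; first exact: prode_fin_num.
  by apply: prode_ge0 => i _; apply: integral_ge0 => y _; rewrite lee_fin normc_ge0.
- by move=> i; apply: measurable_normc; case: (hi i).
- by move=> i y; exact: normc_ge0.
Qed.

Lemma cint_prod n (h : 'I_n -> measurableTypeR R -> R[i]) :
  (forall i, cintegrable leb (h i)) ->
  cint (lebesgueRn R n) (fun x : T n => \prod_(i < n) h i (tnth x i)) =
  \prod_(i < n) cint leb (h i).
Proof.
elim: n h => [|n IH] h hi.
  rewrite big_ord0 /cint /Rintegral !integral_dirac//; last 2 first.
  - by under eq_fun do rewrite big_ord0; exact: measurable_cst.
  - by under eq_fun do rewrite big_ord0; exact: measurable_cst.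
  by rewrite !diracE !mem_set// !mul1e !big_ord0.
have pi' := cintegrable_prod hi.
rewrite cint_lebesgueRnS//.
have pi2 := cintegrable_prod (fun i => hi (lift ord0 i)).
have [m0 o0] := hi ord0.
have [mp op] := pi2.
pose F (p : measurableTypeR R * T n) :=
  h ord0 p.1 * \prod_(i < n) h (lift ord0 i) (tnth p.2 i).
rewrite (eq_cint _ (g := F)); last first.
  move=> p; rewrite /F big_ord_recl tnth0; congr (_ * _).
  by apply: eq_bigr => i _; rewrite tnthS.
have mF : cmeasurable F.
  by apply: cmeasurableM; [exact: cmeasurable_comp m0 _|exact: cmeasurable_comp mp _].
have iF : cintegrable (leb \x lebesgueRn R n)%E F.
  apply: cintegrable_prodP => //.
  under eq_integral => y _.
    under eq_integral do rewrite /F /= normcM EFinM.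
    rewrite ge0_integralZl_EFin ?normc_ge0//; last 2 first.
    - by move=> x _; rewrite lee_fin normc_ge0.
    - exact: emeasurable_normc.
    over.
  rewrite ge0_integralZr//.
  - rewrite lte_mul_pinfty//.
    + by apply: integral_ge0 => y _; rewrite lee_fin normc_ge0.
    + rewrite ge0_fin_numE//.
      by apply: integral_ge0 => y _; rewrite lee_fin normc_ge0.
  - exact: emeasurable_normc.
  - by move=> y _; rewrite lee_fin normc_ge0.
  - by apply: integral_ge0 => y _; rewrite lee_fin normc_ge0.
have [<- _] := cfubini iF.
rewrite (eq_cint _ (g := fun y => h ord0 y *
    \prod_(i < n) cint leb (h (lift ord0 i)))); last first.
  by move=> y; rewrite /F /= cintZ// (IH (fun i => h (lift ord0 i))).
by rewrite cintZr// big_ord_recl.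
Qed.
End complex_product_integral.

(** * The Poisson kernel *)

Section poisson_kernel.
Context (R : realType).
Local Notation leb := (@lebesgue_measure R).
Implicit Types (e y z : R).

Definition expabs e y := expR (- (e * `|y|)).

(** The Fourier transform of [expabs e], normalized to have total mass [2 pi]. *)
Definition poisson e z := 2 * e / (e ^+ 2 + z ^+ 2).

Lemma continuous_expabs e : continuous (expabs e).
Proof.
move=> y; apply: (@continuous_comp _ _ _ (fun y => - (e * `|y|)) expR).
  apply: cvgN; apply: cvgM; first exact: cvg_cst.
  exact: norm_continuous.
exact: continuous_expR.
Qed.

(** Adding 1 to the cosine makes the integrand nonnegative, so that the fundamental theorem on a
    half-line for nonnegative functions applies. The added part is subtracted again in
    [cint_expabs_expi]. *)
Lemma integral0y_expabs_cos e z : 0 < e ->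
  (\int[leb]_(y in `[0%R, +oo[) (expabs e y * (1 + cos (y * z)))%:E =
   (e^-1 + e / (e ^+ 2 + z ^+ 2))%:E)%E.
Proof.
move=> e0.
have D0 : 0 < e ^+ 2 + z ^+ 2 by rewrite ltr_wpDr ?sqr_ge0// exprn_gt0.
have Di : 0 <= (e ^+ 2 + z ^+ 2)^-1 by rewrite invr_ge0 ltW.
(* A bound for the bounded factor of [G] below; with [expR (- (e * y)) <= (e * y)^-1] it gives the
   decay of [G] at infinity. *)
pose K := (`|z| + e) / (e ^+ 2 + z ^+ 2) + e^-1.
have continuous_dexp : continuous (fun y => expR (- (e * y)) * (1 + cos (y * z))).
  move=> y; apply: differentiable_continuous.
  by apply/derivable1_diffP.
(* The antiderivative obtained by integrating the cosine part by parts twice. *)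
pose G y : R := expR (- (e * y)) *
  ((z * sin (y * z) - e * cos (y * z)) / (e ^+ 2 + z ^+ 2) - e^-1).
have dG y : is_derive y 1 G (expR (- (e * y)) * (1 + cos (y * z))).
  rewrite /G; apply: is_derive_eq.
  rewrite /GRing.scale /=; field.
  by rewrite !gt_eqF.
have G0 : G 0 = - (e^-1 + e / (e ^+ 2 + z ^+ 2)).
  rewrite /G mulr0 oppr0 expR0 !mul0r sin0 cos0; field.
  by rewrite !gt_eqF.
rewrite (_ : (_ + _)%:E = 0%:E - (G 0)%:E)%E; last by rewrite G0 sub0e -EFinN opprK.
rewrite -(@ge0_continuous_FTC2y R (fun y => expR (- (e * y)) * (1 + cos (y * z))) G 0 0).
- apply: eq_integral => y; rewrite inE /= in_itv /= andbT => y0.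
  by rewrite /expabs ger0_norm.
- by move=> y _; rewrite mulr_ge0 ?expR_ge0// -lerBlDl sub0r cos_geN1.
- by apply: continuous_subspaceT => y; exact: continuous_dexp.
- apply/cvgrPdist_le => r r0; near=> y.
  have y0 : 0 < y by near: y; exact: nbhs_pinfty_gt.
  rewrite sub0r normrN /G normrM (ger0_norm (expR_ge0 _)).
  have ey : expR (- (e * y)) <= (e * y)^-1.
    rewrite expRN lef_pV2 ?posrE ?expR_gt0 ?mulr_gt0//.
    by apply: le_trans (expR_ge1Dx _); rewrite lerDr.
  have Gb : `|(z * sin (y * z) - e * cos (y * z)) / (e ^+ 2 + z ^+ 2) - e^-1| <= K.
    rewrite /K (le_trans (ler_normB _ _))// lerD//; last first.
      by rewrite ger0_norm// invr_ge0 ltW.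
    rewrite normrM (ger0_norm Di) ler_wpM2r//.
    rewrite (le_trans (ler_normB _ _))// !normrM lerD//.
      by rewrite ler_piMr// sin_max.
    by rewrite (ger0_norm (ltW e0)) ler_piMr ?(ltW e0)// cos_max.
  apply: (@le_trans _ _ ((e * y)^-1 * K)).
    by apply: ler_pM => //; exact: expR_ge0.
  rewrite ler_pdivrMl ?mulr_gt0// mulrAC -ler_pdivrMl; last exact: mulr_gt0.
  by near: y; apply: nbhs_pinfty_ge; exact: num_real.
- by move=> y _; case: (dG y).
- apply: cvg_at_right_filter; apply: differentiable_continuous.
  by apply/derivable1_diffP; case: (dG 0).
- by move=> y _; rewrite derive1E; case: (dG y).
Unshelve. all: by end_near. Qed.
End poisson_kernel.

Section poisson_fourier.
Context (R : realType).
Local Notation leb := (@lebesgue_measure R).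
Implicit Types (e y z : R).

Lemma poisson_ge0 e z : 0 < e -> 0 <= poisson e z.
Proof.
move=> e0; rewrite /poisson divr_ge0// ?mulr_ge0 ?(ltW e0)//.
by rewrite addr_ge0 ?sqr_ge0.
Qed.

Lemma poissonN e z : poisson e (- z) = poisson e z.
Proof. by rewrite /poisson sqrrN. Qed.

Lemma poissonB e (x y : R) : poisson e (x - y) = poisson e (y - x).
Proof. by rewrite -poissonN opprB. Qed.

Lemma expabs_ge0 e y : 0 <= expabs e y.
Proof. exact: expR_ge0. Qed.

Lemma expabs_le1 e y : 0 < e -> expabs e y <= 1.
Proof. by move=> e0; rewrite /expabs -expR0 ler_expR oppr_le0 mulr_ge0// ltW. Qed.

Lemma integral_expabs_cos e z : 0 < e ->
  (\int[leb]_y (expabs e y * (1 + cos (y * z)))%:E =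
   (2 * (e^-1 + e / (e ^+ 2 + z ^+ 2)))%:E)%E.
Proof.
move=> e0; rewrite ge0_symfun_integralT.
- rewrite (_ : [set x | _] = `[0, +oo[%classic); last first.
    by apply/seteqP; split => x/=; rewrite in_itv/= andbT.
  by rewrite integral0y_expabs_cos// -EFinM.
- by move=> y; rewrite mulr_ge0 ?expabs_ge0// -lerBlDl sub0r cos_geN1.
- move=> y; apply: cvgM; first exact: continuous_expabs.
  apply: cvgD; first exact: cvg_cst.
  apply: (@continuous_comp _ _ _ (fun y => y * z) cos); first exact: mulrr_continuous.
  exact: continuous_cos.
- by move=> y /=; rewrite /expabs normrN mulNr cosN.
Qed.

Lemma measurable_expabs e : measurable_fun [set: R] (expabs e).
Proof. by apply: continuous_measurable_fun; exact: continuous_expabs. Qed.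

Lemma integral_expabs e : 0 < e -> (\int[leb]_y (expabs e y)%:E = (2 / e)%:E)%E.
Proof.
move=> e0; have := integral_expabs_cos 0 e0.
under eq_integral do rewrite mulr0 cos0 mulrC EFinM.
rewrite ge0_integralZl_EFin//; last 2 first.
- by move=> y _; rewrite lee_fin expabs_ge0.
- by apply/measurable_EFinP; exact: measurable_expabs.
have -> : 2 * (e^-1 + e / (e ^+ 2 + 0 ^+ 2)) = 2 * (2 / e).
  by rewrite expr0n addr0; field; rewrite gt_eqF.
case: (integral _ _ _) => [r||].
- by rewrite -EFinM => -[h]; congr EFin; lra.
- by rewrite gt0_muley// lte_fin.
- by rewrite gt0_muleNy// lte_fin.
Qed.

Lemma cintegrable_expabs e : 0 < e ->
  cintegrable leb (fun y : measurableTypeR R => (expabs e y)%:C).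
Proof.
move=> e0; split; first by apply: cmeasurable_real; exact: measurable_expabs.
under eq_integral do rewrite normc_real ger0_norm ?expabs_ge0//.
by rewrite integral_expabs// ltry.
Qed.

(** Lebesgue measure is invariant under reflection. This removes the sine part of the transform of
    [expabs]. *)
Lemma Rintegral_odd (f : R -> R) : leb.-integrable [set: R] (EFin \o f) ->
  (forall y, f (- y) = - f y) -> \int[leb]_y f y = 0.
Proof.
move=> fi fodd.
have NmR : measurable_fun [set: measurableTypeR R] (-%R : _ -> measurableTypeR R).
  exact: oppr_measurable.
have fNE : f \o -%R = \- f by apply/funext => y; exact: fodd.
have fi' : leb.-integrable [set: R] ((EFin \o f) \o -%R).
  rewrite (_ : _ \o _ = -%E \o (EFin \o f)); first exact: integrableN.
  by apply/funext => y /=; rewrite fodd.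
have fE : (\int[leb]_y (f y)%:E = \int[leb]_y (f (- y))%:E)%E.
  rewrite -(integral_pushforward NmR (measurable_int _ fi) fi' measurableT).
  by apply: eq_measure_integral => A mA _; exact/esym/lebesgue_measureN.
have : \int[leb]_y f y = - \int[leb]_y f y.
  rewrite -mulN1r -RintegralZl// /Rintegral fE; congr fine.
  by apply: eq_integral => y _; rewrite fodd mulN1r.
by lra.
Qed.

Lemma cint_expabs_expi e z : 0 < e ->
  cint leb (fun y : measurableTypeR R => (expabs e y)%:C * expi (y * z)) =
  (poisson e z)%:C.
Proof.
move=> e0.
have D0 : 0 < e ^+ 2 + z ^+ 2 by rewrite ltr_wpDr ?sqr_ge0// exprn_gt0.
have i1 := cintegrable_expabs e0.
have i2 : cintegrable leb
    (fun y : measurableTypeR R => (expabs e y)%:C * expi (y * z)).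
  under eq_fun do rewrite mulrC.
  apply: (cintegrableM (M := 1)) => //.
    by apply: cmeasurable_expi; exact: mulrr_measurable.
  by move=> y; rewrite normc_expi.
rewrite /cint; congr (_ +i* _).
  (* Subtracting the mass [2 / e] of [expabs e] undoes the shift in [1 + cos]. *)
  transitivity (\int[leb]_y (expabs e y * (1 + cos (y * z)) - expabs e y)).
    by apply: eq_Rintegral => y _; rewrite !ReImE /= mul0r subr0; ring.
  rewrite RintegralB//; last 2 first.
  - have := cintegrable_Re (cintegrableD i1 i2); congr (integrable _ _ _).
    by apply/funext => y; congr EFin; rewrite !ReImE /=; ring.
  - exact: cintegrable_Re i1.
  rewrite /Rintegral integral_expabs_cos// integral_expabs//= /poisson.
  by field; rewrite !gt_eqF.
apply: Rintegral_odd; first exact: cintegrable_Im i2.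
by move=> y; rewrite !ReImE /= /expabs normrN mulNr sinN; ring.
Qed.

End poisson_fourier.

(** * Mass of the Poisson kernel on intervals *)

Section poisson_mass.
Context (R : realType).
Local Notation leb := (@lebesgue_measure R).
Local Notation T n := (n.-tuple (measurableTypeR R)).
Implicit Types (a b e x y z : R).

(** The mass on [[a, b]] of the Poisson kernel centred at [x]. *)
Definition poisson_itv e a b x := 2 * (atan ((b - x) / e) - atan ((a - x) / e)).

Lemma continuous_poisson e x : 0 < e -> continuous (fun y => poisson e (y - x)).
Proof.
move=> e0 y; rewrite /poisson; apply: cvgM; first exact: cvg_cst.
apply: cvgV; first by rewrite gt_eqF// ltr_wpDr ?sqr_ge0// exprn_gt0.
apply: cvgD; first exact: cvg_cst.
have h : y0 - x @[y0 --> y] --> y - x by apply: cvgB => //; exact: cvg_cst.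
exact: (cvgM h h).
Qed.

Lemma measurable_poisson e x : 0 < e ->
  measurable_fun [set: R] (fun y => poisson e (y - x)).
Proof. by move=> e0; apply: continuous_measurable_fun; exact: continuous_poisson. Qed.

Lemma integral_poisson_cc e x a b : 0 < e -> a < b ->
  (\int[leb]_(y in `[a, b]) (poisson e (y - x))%:E = (poisson_itv e a b x)%:E)%E.
Proof.
move=> e0 ab.
have D0 y : 0 < e ^+ 2 + (y - x) ^+ 2 by rewrite ltr_wpDr ?sqr_ge0// exprn_gt0.
pose F y : R := 2 * atan ((y - x) / e).
have dF y : is_derive y 1 F (poisson e (y - x)).
  rewrite /F; apply: is_derive_eq.
  rewrite /GRing.scale /= /poisson; field.
  by rewrite !gt_eqF.
have cF : continuous F.
  move=> y; apply: differentiable_continuous.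
  by apply/derivable1_diffP; case: (dF y).
rewrite (@continuous_FTC2 R (fun y => poisson e (y - x)) F a b)//.
- by rewrite -EFinB /F /poisson_itv mulrBr.
- exact/continuous_subspaceT/continuous_poisson.
- split => //.
  + apply: cvg_at_right_filter; exact: cF.
  + apply: cvg_at_left_filter; exact: cF.
- by move=> y _; rewrite derive1E; case: (dF y).
Qed.

Lemma poisson_itv_ge0 e a b x : 0 < e -> a <= b -> 0 <= poisson_itv e a b x.
Proof.
move=> e0 ab; rewrite mulr_ge0// subr_ge0 le_atan// ler_pM2r ?invr_gt0//.
by rewrite lerD2r.
Qed.

Lemma poisson_itv_le e a b x : poisson_itv e a b x <= 2 * pi.
Proof.
rewrite ler_pM2l//.
have := atan_ltpi2 ((b - x) / e); have := atan_gtNpi2 ((a - x) / e); lra.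
Qed.

(** Each arctangent tends to [pi / 2] with the sign of its argument, so their difference tends to 0
    or [pi]. At an endpoint one of them vanishes and the limit is half the mass, whence the two
    exclusions. *)
Lemma poisson_itv_cvg a b x : a < b -> x != a -> x != b ->
  poisson_itv (k.+1%:R^-1) a b x @[k --> \oo] --> (2 * pi * \1_(`]a, b]%classic) x : R).
Proof.
move=> ab xa xb.
have atan_cvg c : 0 < c -> atan (c / (k.+1%:R^-1)) @[k --> \oo] --> (pi / 2 : R).
  move=> c0; apply: (cvg_comp _ _ _ (@cvgy_atan R)).
  apply/cvgryPge => A; near=> k.
  rewrite invrK mulrC -ler_pdivrMr//.
  apply: (@le_trans _ _ k%:R); last by rewrite ler_nat.
  by near: k; exact: nbhs_infty_ger.
have atan_cvgN c : c < 0 -> atan (c / (k.+1%:R^-1)) @[k --> \oo] --> - (pi / 2 : R).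
  move=> c0; under eq_fun => k do rewrite -[atan _]opprK -atanN -mulNr.
  by apply: cvgN; apply: atan_cvg; rewrite oppr_gt0.
rewrite /poisson_itv; have [ltxa|ltax|/eqP] := ltgtP x a; last by rewrite (negbTE xa).
  rewrite indicE memNset; last by rewrite /= in_itv/= ltNge (ltW ltxa).
  rewrite mulr0 -(mulr0 2) -(subrr (pi / 2)); apply: cvgM; first exact: cvg_cst.
  by apply: cvgB; apply: atan_cvg; rewrite subr_gt0// (lt_trans ltxa).
have [ltxb|ltbx|/eqP] := ltgtP x b; last by rewrite (negbTE xb).
  rewrite indicE mem_set/=; last by rewrite /= in_itv/= ltax ltW.
  rewrite mulr1 (_ : pi = pi / 2 - - (pi / 2)); last by lra.
  apply: cvgM; first exact: cvg_cst.
  by apply: cvgB; [apply: atan_cvg; rewrite subr_gt0|apply: atan_cvgN; rewrite subr_lt0].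
rewrite indicE memNset; last by rewrite /= in_itv/= ltax/= leNgt ltbx.
rewrite mulr0 -(mulr0 2) -(subrr (- (pi / 2))); apply: cvgM; first exact: cvg_cst.
by apply: cvgB; apply: atan_cvgN; rewrite subr_lt0// (lt_trans ltax).
Unshelve. all: by end_near. Qed.

Lemma integral_poisson_le e x : 0 < e ->
  (\int[leb]_y (poisson e (y - x))%:E <= (2 * pi)%:E)%E.
Proof.
move=> e0.
have := @ge0_nondecreasing_set_cvg_integral _ _ R
  (fun n : nat => `[- n.+1%:R, n.+1%:R]%classic : set (measurableTypeR R))
  (fun y => (poisson e (y - x))%:E) leb.
rewrite (_ : \bigcup_n _ = setT); last first.
  apply/seteqP; split => // y _; exists (Num.truncn `|y|) => //=.
  by rewrite in_itv/= -ler_norml ltW// Num.Theory.truncnS_gt.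
move=> cv; have {cv} : (\int[leb]_(y in `[(- n.+1%:R)%R, n.+1%:R]) (poisson e (y - x))%:E)%E
    @[n --> \oo] --> (\int[leb]_y (poisson e (y - x))%:E)%E.
  apply: cv.
  - apply/nondecreasing_seqP => n; rewrite subsetEset => y /=; rewrite !in_itv/=.
    move=> /andP[y1 y2]; apply/andP; split.
      by apply: le_trans y1; rewrite lerN2 ler_nat.
    by apply: (le_trans y2); rewrite ler_nat.
  - by move=> i; exact: measurable_itv.
  - move=> i; apply: measurable_funTS.
    by apply/measurable_EFinP; exact: measurable_poisson e0.
  - by move=> i y _; rewrite lee_fin poisson_ge0.
move=> cv; rewrite -(cvg_lim _ cv)//; apply: lime_le; first by apply/cvg_ex; eexists; exact: cv.
apply: nearW => n; rewrite integral_poisson_cc ?lee_fin ?poisson_itv_le//.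
by rewrite (@lt_trans _ _ 0)// oppr_lt0.
Qed.
End poisson_mass.

(** * The product weight and the product Poisson kernel *)

Section product_poisson_kernel.
Context (R : realType) (n : nat).
Local Notation leb := (@lebesgue_measure R).
Local Notation T := (n.-tuple (measurableTypeR R)).
Local Notation mu := (lebesgueRn R n).
Implicit Types (x y xi : T) (e : R).

Definition weight e xi : R := \prod_(i < n) expabs e (tnth xi i).

(** The Fourier transform of [weight e] at [y - x]: [(2 pi)^n] times an approximate identity as [e]
    tends to 0. *)
Definition kernel e x y : R := \prod_(i < n) poisson e (tnth y i - tnth x i).

Lemma dotRnC x y : dotRn x y = dotRn y x.
Proof. by apply: eq_bigr => i _; rewrite mulrC. Qed.

Lemma weight_ge0 e xi : 0 <= weight e xi.
Proof. by apply: prodr_ge0 => i _; exact: expabs_ge0. Qed.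

Lemma weight_le1 e xi : 0 < e -> weight e xi <= 1.
Proof. by move=> e0; apply: prodr_ile1 => i _; rewrite expabs_ge0 expabs_le1. Qed.

Lemma measurable_weight e : measurable_fun [set: T] (weight e).
Proof. exact: (measurable_prod_tnth (fun i : 'I_n => measurable_expabs e)). Qed.

Lemma kernel_ge0 e x y : 0 < e -> 0 <= kernel e x y.
Proof. by move=> e0; apply: prodr_ge0 => i _; exact: poisson_ge0. Qed.

Lemma kernelC e x y : kernel e x y = kernel e y x.
Proof. by apply: eq_bigr => i _; rewrite poissonB. Qed.

Lemma measurable_kernel e : 0 < e ->
  measurable_fun [set: T * T] (fun p => kernel e p.1 p.2).
Proof.
move=> e0; rewrite /kernel; apply: (@measurable_prod _ _ _ _ _ _
  (fun i (p : T * T) => poisson e (tnth p.2 i - tnth p.1 i))) => i _.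
have mp : measurable_fun [set: R] (poisson e).
  by have := measurable_poisson 0 e0; under eq_fun do rewrite subr0.
apply: (measurableT_comp mp); apply: measurable_funB.
  exact: (measurableT_comp (measurable_tnthR i) measurable_snd).
exact: (measurableT_comp (measurable_tnthR i) measurable_fst).
Qed.

Lemma measurable_kernelr e x : 0 < e -> measurable_fun [set: T] (kernel e x).
Proof.
move=> e0; exact: (@measurable_prod_tnth R n (fun i (r : R) => poisson e (r - tnth x i))
  (fun i => measurable_poisson _ e0)).
Qed.

Lemma integral_kernel_le e x : 0 < e ->
  (\int[mu]_y (kernel e x y)%:E <= ((2 * pi) ^+ n)%:E)%E.
Proof.
move=> e0; rewrite (ge0_integral_prod (h := fun i (r : R) => poisson e (r - tnth x i))).
- pose r i := fine (\int[leb]_y (poisson e (y - tnth x i))%:E)%E.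
  have rE i : (\int[leb]_y (poisson e (y - tnth x i))%:E = (r i)%:E)%E.
    rewrite fineK// ge0_fin_numE.
      by apply: (le_lt_trans (integral_poisson_le _ e0)); exact: ltry.
    by apply: integral_ge0 => y _; rewrite lee_fin poisson_ge0.
  under eq_bigr do rewrite rE.
  rewrite prodEFin lee_fin -[n in leRHS]card_ord -prodr_const.
  apply: ler_prod => i _; rewrite -!lee_fin -rE integral_poisson_le// andbT.
  by apply: integral_ge0 => y _; rewrite lee_fin poisson_ge0.
- by move=> i; exact: measurable_poisson.
- by move=> i y; exact: poisson_ge0.
Qed.

(** The sides have the shape of the generators [ocitv] of the Borel sets of the line, and these
    boxes are stable under intersection. *)
Definition box (a b : 'I_n -> R) : set T :=
  [set x | forall i, (`]a i, b i]%classic : set R) (tnth x i)].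

Lemma indic_box a b x :
  \1_(box a b) x = \prod_(i < n) \1_(`]a i, b i]%classic) (tnth x i) :> R.
Proof.
rewrite indicE; case: (boolP (x \in box a b)) => [/set_mem xB|xB].
  rewrite big1// => i _; rewrite indicE mem_set//; exact: xB.
have /existsNP[i Hi] : ~ box a b x by move/mem_set; rewrite (negbTE xB).
by rewrite (bigD1 i)//= indicE memNset// mul0r.
Qed.

Lemma measurable_box a b : measurable (box a b).
Proof.
rewrite (_ : box a b = \bigcap_(i in [set: 'I_n])
    ((fun x => tnth x i) @^-1` `]a i, b i]%classic)).
  apply: fin_bigcap_measurable => // i _; rewrite -[_ @^-1` _]setTI.
  by apply: measurable_tnth => //; exact: measurable_itv.
by apply/seteqP; split => [x Bx i _|x Bx i]; exact: Bx.
Qed.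

Lemma integral_kernel_box e a b x : 0 < e -> (forall i, a i < b i) ->
  (\int[mu]_y (kernel e x y * \1_(box a b) y)%:E =
   (\prod_(i < n) poisson_itv e (a i) (b i) (tnth x i))%:E)%E.
Proof.
move=> e0 ab.
under eq_integral do rewrite indic_box -big_split /=.
rewrite (ge0_integral_prod (h := fun i (r : R) =>
  poisson e (r - tnth x i) * \1_(`]a i, b i]%classic) r)).
- rewrite -prodEFin; apply: eq_bigr => i _.
  rewrite -integral_poisson_cc//.
  rewrite -(@integral_itv_obnd_cbnd _ _ (BRight (b i))); last first.
    by apply: measurable_funTS; apply/measurable_EFinP; exact: measurable_poisson.
  rewrite [RHS]integral_mkcond; apply: eq_integral => y _.
  rewrite patchE indicE; case: ifPn => _ /=; first by rewrite mulr1.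
  by rewrite mulr0.
- move=> i; apply: measurable_funM; first exact: measurable_poisson.
  by apply: measurable_indic; exact: measurable_itv.
- by move=> i y; rewrite mulr_ge0// ?poisson_ge0.
Qed.

Lemma cintegrable_weight e : 0 < e -> cintegrable mu (fun xi => (weight e xi)%:C).
Proof.
move=> e0; have := @cintegrable_prod R n (fun _ (r : R) => (expabs e r)%:C)
  (fun _ => cintegrable_expabs e0).
by congr cintegrable; apply/funext => xi; rewrite /weight rmorph_prod.
Qed.

Lemma expi_sum (m : nat) (h : 'I_m -> R) :
  expi (\sum_(i < m) h i) = \prod_(i < m) expi (h i).
Proof. exact: (big_morph _ (@expiD R) (@expi0 R)). Qed.

(** The integrand factors over the coordinates. The Poisson kernel is even, so the sign [s]
    disappears and the forward and inverse transforms share one formula. The left side has the form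
    of [FT s] at [y] of the weight modulated by [x]. *)
Lemma cint_weight_expi (s e : R) x y : s ^+ 2 = 1 -> 0 < e ->
  cint mu (fun xi => expi (s * dotRn y xi) * ((weight e xi)%:C * expi (- s * dotRn x xi)))
  = (kernel e x y)%:C.
Proof.
move=> s2 e0; pose z i := s * (tnth y i - tnth x i).
rewrite (eq_cint _ (g := fun xi => \prod_(i < n)
    ((expabs e (tnth xi i))%:C * expi (tnth xi i * z i)))); last first.
  move=> xi; rewrite big_split /= -expi_sum mulrCA -expiD; congr (_ * expi _).
    by rewrite /weight rmorph_prod.
  rewrite /dotRn !mulr_sumr -big_split /=; apply: eq_bigr => i _.
  by rewrite /z; ring.
rewrite (cint_prod (h := fun i (r : R) => (expabs e r)%:C * expi (r * z i))).
  rewrite /kernel rmorph_prod; apply: eq_bigr => i _.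
  rewrite cint_expabs_expi// /z; congr (_%:C).
  by rewrite /poisson exprMn s2 mul1r.
move=> i; rewrite (_ : (fun _ => _) = fun r : R => expi (r * z i) * (expabs e r)%:C).
  apply: (cintegrableM (M := 1)) => //; first exact: cintegrable_expabs.
    by apply: cmeasurable_expi; exact: mulrr_measurable.
  by move=> t; rewrite normc_expi.
by apply/funext => t; rewrite mulrC.
Qed.
End product_poisson_kernel.

(** * Plancherel and Fourier inversion *)

Section parametric_integral.
Context d1 d2 (T1 : measurableType d1) (T2 : measurableType d2) (R : realType).
Variable m2 : {sigma_finite_measure set T2 -> \bar R}.

(** The integrals of the positive and negative parts are measurable in the parameter by Tonelli,
    whether or not they are finite. *)
Lemma cmeasurable_cint (f : T1 * T2 -> R[i]) : cmeasurable f ->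
  cmeasurable (fun x => cint m2 (fun y => f (x, y))).
Proof.
have main (h : T1 * T2 -> R) : measurable_fun [set: T1 * T2] h ->
    measurable_fun [set: T1] (fun x => \int[m2]_y h (x, y)).
  move=> mh; have mEh : measurable_fun [set: T1 * T2] (EFin \o h).
    exact/measurable_EFinP.
  rewrite /Rintegral.
  have mF : measurable_fun [set: T1] (fun x => (\int[m2]_y (h (x, y))%:E)%E).
    rewrite (_ : (fun x => _) = (fun x => \int[m2]_y ((EFin \o h)^\+ (x, y)) -
        \int[m2]_y ((EFin \o h)^\- (x, y)))%E); last first.
      apply/funext => x; rewrite [LHS]integralE.
      by congr (_ - _)%E; apply: eq_integral => y _; [rewrite !funeposE|rewrite !funenegE].
    apply: emeasurable_funB.
      by apply: measurable_fun_fubini_tonelli_F => //; exact: measurable_funepos.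
    by apply: measurable_fun_fubini_tonelli_F => //; exact: measurable_funeneg.
  by apply: (measurableT_comp _ mF); exact: fine_measurable.
by move=> [f1 f2]; split; [exact: (main _ f1)|exact: (main _ f2)].
Qed.

End parametric_integral.

Section fourier_integral.
Context (R : realType) (n : nat).
Local Notation T := (n.-tuple (measurableTypeR R)).
Local Notation mu := (lebesgueRn R n).
Local Notation sq2 := (sq2 mu).
Local Notation L2 := (L2 mu).
Local Notation cint := (cint mu).
Implicit Types (x y xi : T) (s e : R) (f g u v : T -> R[i]).

(** The literal Fourier integral: [s = -1] gives the forward transform, [s = 1] the inverse one
    without its factor [(2 pi)^-n]. *)
Definition FT s g xi := cint (fun x => expi (s * dotRn xi x) * g x).

Lemma measurable_dotRn : measurable_fun [set: T * T] (fun p => dotRn p.1 p.2).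
Proof.
rewrite /dotRn; apply: (@measurable_sum _ _ _ _ _ _
  (fun i (p : T * T) => (tnth p.1 i : R) * (tnth p.2 i : R))) => i.
apply: measurable_funM.
  exact: (measurableT_comp (measurable_tnthR i) measurable_fst).
exact: (measurableT_comp (measurable_tnthR i) measurable_snd).
Qed.

Lemma measurable_dotRnr xi : measurable_fun [set: T] (dotRn xi).
Proof. exact: (measurableT_comp measurable_dotRn (measurable_pair1 xi)). Qed.

Lemma cmeasurable_osc s xi : cmeasurable (fun x => expi (s * dotRn xi x)).
Proof.
apply: cmeasurable_expi; apply: measurable_funM; first exact: measurable_cst.
exact: measurable_dotRnr.
Qed.

Lemma cintegrable_osc s g xi : cintegrable mu g ->
  cintegrable mu (fun x => expi (s * dotRn xi x) * g x).
Proof.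
move=> gi; apply: (cintegrableM (M := 1)) => //; first exact: cmeasurable_osc.
by move=> x; rewrite normc_expi.
Qed.

Lemma FT_le s g xi : cintegrable mu g ->
  ((normc (FT s g xi))%:E <= \int[mu]_x (normc (g x))%:E)%E.
Proof.
move=> gi; apply: le_trans (normc_cint_le (cintegrable_osc s xi gi)) _.
by rewrite le_eqVlt; apply/orP; left; apply/eqP; apply: eq_integral => x _;
  rewrite normcM normc_expi mul1r.
Qed.

Lemma FT_bounded s g : cintegrable mu g ->
  exists M : R, forall xi, normc (FT s g xi) <= M.
Proof.
move=> gi; exists (fine (\int[mu]_x (normc (g x))%:E)) => xi.
rewrite -lee_fin fineK ?FT_le// ge0_fin_numE; first by case: gi.
by apply: integral_ge0 => x _; rewrite lee_fin normc_ge0.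
Qed.

Lemma cmeasurable_FT s g : cmeasurable g -> cmeasurable (FT s g).
Proof.
move=> mg.
apply: (cmeasurable_cint mu (f := fun p : T * T => expi (s * dotRn p.1 p.2) * g p.2)).
apply: cmeasurableM; last exact: (cmeasurable_comp mg measurable_snd).
apply: cmeasurable_expi; apply: measurable_funM; first exact: measurable_cst.
exact: measurable_dotRn.
Qed.

Lemma cintegrableM_FT s g v : cintegrable mu g -> cintegrable mu v ->
  cintegrable mu (fun xi => FT s g xi * v xi).
Proof.
move=> gi vi; have [M gM] := FT_bounded s gi.
by apply: (cintegrableM (M := M)) => //; apply: cmeasurable_FT; case: gi.
Qed.

Lemma FTB s f g xi : cintegrable mu f -> cintegrable mu g ->
  FT s (fun x => f x - g x) xi = FT s f xi - FT s g xi.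
Proof.
move=> fi gi; rewrite /FT -cintB; [|exact: cintegrable_osc|exact: cintegrable_osc].
by apply: eq_cint => x; rewrite mulrBr.
Qed.

Lemma FT_conj s g xi : cintegrable mu g ->
  (FT s g xi)^*%C = FT (- s) (fun x => (g x)^*%C) xi.
Proof.
move=> gi; rewrite /FT -cint_conj; last exact: cintegrable_osc.
by apply: eq_cint => x; rewrite conjcM conj_expi mulNr.
Qed.

(** The multiplication formula: Fubini for a phase symmetric in its two variables, the integrand
    having modulus [|u(xi)| |v(x)|]. *)
Lemma FT_mul s u v : cintegrable mu u -> cintegrable mu v ->
  cint (fun xi => u xi * FT s v xi) = cint (fun x => FT s u x * v x).
Proof.
move=> ui vi.
pose F (p : T * T) := u p.1 * (expi (s * dotRn p.1 p.2) * v p.2).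
have [mu_ uoo] := ui; have [mv voo] := vi.
have mF : cmeasurable F.
  apply: cmeasurableM; first exact: (cmeasurable_comp mu_ measurable_fst).
  apply: cmeasurableM; last exact: (cmeasurable_comp mv measurable_snd).
  apply: cmeasurable_expi; apply: measurable_funM; first exact: measurable_cst.
  exact: measurable_dotRn.
have iF : cintegrable (mu \x mu)%E F.
  apply: cintegrable_prodP => //.
  under eq_integral => y _.
    under eq_integral do rewrite /F /= normcM EFinM normcM normc_expi mul1r.
    rewrite ge0_integralZl_EFin ?normc_ge0//; last 2 first.
    - by move=> x _; rewrite lee_fin normc_ge0.
    - exact: emeasurable_normc.
    over.
  rewrite ge0_integralZr//.
  - rewrite lte_mul_pinfty//.
    + by apply: integral_ge0 => y _; rewrite lee_fin normc_ge0.
    + rewrite ge0_fin_numE//.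
      by apply: integral_ge0 => y _; rewrite lee_fin normc_ge0.
  - exact: emeasurable_normc.
  - by move=> y _; rewrite lee_fin normc_ge0.
  - by apply: integral_ge0 => y _; rewrite lee_fin normc_ge0.
have [h1 h2] := cfubini iF.
transitivity (cint (fun xi => cint (fun x => F (xi, x)))).
  by apply: eq_cint => xi; rewrite /F /= cintZ//; exact: cintegrable_osc.
rewrite h1 -h2; apply: eq_cint => x; rewrite /FT -cintZr; last exact: cintegrable_osc.
by apply: eq_cint => xi; rewrite /F /= dotRnC; ring.
Qed.

(** Inversion regularized by the weight: the multiplication formula moves the transform from [h] to
    the modulated weight, whose transform is the kernel. *)
Lemma FT_weight_FT s e h x : s ^+ 2 = 1 -> 0 < e -> cintegrable mu h ->
  FT s (fun xi => (weight e xi)%:C * FT (- s) h xi) x =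
  cint (fun y => (kernel e x y)%:C * h y).
Proof.
move=> s2 e0 hi; have wi := @cintegrable_weight R n e e0.
rewrite {1}/FT.
transitivity (cint (fun xi => (expi (s * dotRn x xi) * (weight e xi)%:C) * FT (- s) h xi)).
  by apply: eq_cint => xi; rewrite mulrA.
rewrite FT_mul//; last exact: cintegrable_osc.
apply: eq_cint => y; congr (_ * _).
rewrite -(@cint_weight_expi R n (- s)) ?sqrrN//; apply: eq_cint => xi.
by rewrite opprK; congr (_ * _); rewrite mulrC.
Qed.

End fourier_integral.

(** * The Plancherel inequality with a weight *)

Section plancherel_inequality.
Context (R : realType) (n : nat).
Local Notation T := (n.-tuple (measurableTypeR R)).
Local Notation mu := (lebesgueRn R n).
Implicit Types (x y xi : T) (s e : R) (f g u v : T -> R[i]).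

Let C : R := (2 * pi) ^+ n.

Let C_ge0 : 0 <= C.
Proof. by rewrite exprn_ge0// mulr_ge0// pi_ge0. Qed.

(* Schur's test for the symmetric kernel of mass at most [(2 pi)^n]. *)
Lemma kernel_schur e g : 0 < e -> cmeasurable g ->
  (\int[mu]_x \int[mu]_y (kernel e x y * (normc (g x) * normc (g y)))%:E <=
   C%:E * sq2 mu g)%E.
Proof.
move=> e0 mg; have mn := measurable_normc mg.
have mK := @measurable_kernel R n e e0.
have mF1 : measurable_fun [set: T * T]
    (fun p : T * T => (kernel e p.1 p.2 * normc (g p.1) ^+ 2)%:E).
  apply/measurable_EFinP/measurable_funM => //; apply: measurable_funX.
  exact: (measurableT_comp mn measurable_fst).
have mF2 : measurable_fun [set: T * T]
    (fun p : T * T => (kernel e p.1 p.2 * normc (g p.2) ^+ 2)%:E).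
  apply/measurable_EFinP/measurable_funM => //; apply: measurable_funX.
  exact: (measurableT_comp mn measurable_snd).
have hk1 (p : T * T) : (0 <= (kernel e p.1 p.2 * normc (g p.1) ^+ 2)%:E)%E.
  by rewrite lee_fin mulr_ge0 ?sqr_ge0// kernel_ge0.
have hk2 (p : T * T) : (0 <= (kernel e p.1 p.2 * normc (g p.2) ^+ 2)%:E)%E.
  by rewrite lee_fin mulr_ge0 ?sqr_ge0// kernel_ge0.
have hk0 (p : T * T) : (0 <= (kernel e p.1 p.2 * (normc (g p.1) * normc (g p.2)))%:E)%E.
  by rewrite lee_fin !mulr_ge0 ?normc_ge0// kernel_ge0.
(* Since [u v <= (u^2 + v^2) / 2], half of this bound and half of its mirror image [h2] suffice. *)
have h1 : (\int[mu]_x \int[mu]_y (kernel e x y * normc (g x) ^+ 2)%:E <= C%:E * sq2 mu g)%E.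
  rewrite /sq2 -ge0_integralZl_EFin//; last 2 first.
  - by move=> x _; rewrite lee_fin sqr_ge0.
  - exact: emeasurable_sqr_normc.
  apply: ge0_le_integral => //.
  - by move=> x _; apply: integral_ge0 => y _; rewrite lee_fin mulr_ge0 ?sqr_ge0// kernel_ge0.
  - exact: (measurable_fun_fubini_tonelli_F _ mF1 hk1).
  - by apply: measurable_funeM; exact: emeasurable_sqr_normc.
  - move=> x _; under eq_integral do rewrite EFinM.
    rewrite ge0_integralZr//; last 3 first.
    + by apply/measurable_EFinP; exact: measurable_kernelr.
    + by move=> y _; rewrite lee_fin kernel_ge0.
    + by rewrite lee_fin sqr_ge0.
    by apply: lee_wpmul2r; [rewrite lee_fin sqr_ge0|exact: integral_kernel_le].
have h2 : (\int[mu]_x \int[mu]_y (kernel e x y * normc (g y) ^+ 2)%:E <= C%:E * sq2 mu g)%E.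
  apply: le_trans h1; rewrite le_eqVlt; apply/orP; left; apply/eqP.
  apply: etrans (fubini_tonelli _ mF2 hk2) _.
  by apply: eq_integral => y _; apply: eq_integral => x _ /=; rewrite kernelC.
have mF0 : measurable_fun [set: T * T]
    (fun p : T * T => (kernel e p.1 p.2 * (normc (g p.1) * normc (g p.2)))%:E).
  apply/measurable_EFinP/measurable_funM => //; apply: measurable_funM.
    exact: (measurableT_comp mn measurable_fst).
  exact: (measurableT_comp mn measurable_snd).
rewrite -(fubini_tonelli1 _ mF1 hk1) in h1.
rewrite -(fubini_tonelli1 _ mF2 hk2) in h2.
rewrite -(fubini_tonelli1 _ mF0 hk0).
have -> : (C%:E * sq2 mu g = 2^-1%:E * (C%:E * sq2 mu g) + 2^-1%:E * (C%:E * sq2 mu g))%E.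
  rewrite -ge0_muleDl ?lee_fin ?invr_ge0// -EFinD.
  by rewrite (_ : (2^-1 + 2^-1 : R) = 1) ?mul1e//; lra.
have half0 : (0 <= (2^-1 : R)%:E)%E by rewrite lee_fin invr_ge0.
apply: le_trans (leeD (lee_wpmul2l half0 h1) (lee_wpmul2l half0 h2)).
rewrite -!ge0_integralZl_EFin// -ge0_integralD//; last 4 first.
- by move=> p _; exact: mule_ge0.
- exact: measurable_funeM.
- by move=> p _; exact: mule_ge0.
- exact: measurable_funeM.
apply: ge0_le_integral => //.
  by apply: emeasurable_funD; exact: measurable_funeM.
move=> p _; rewrite -!EFinM -EFinD lee_fin.
have := kernel_ge0 p.1 p.2 e0; move: (kernel e p.1 p.2) => K K0.
have := sqr_ge0 (normc (g p.1) - normc (g p.2)); rewrite sqrrB mulr2n => h.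
have := mulr_ge0 K0 h; lra.
Qed.

(** Writing the squared modulus as the transform of [g] times its conjugate, the multiplication
    formula turns the left side into the quadratic form of the kernel at [g], to which
    [kernel_schur] applies. The weight makes the integral absolutely convergent. *)
Lemma plancherel_weighted s e g : s ^+ 2 = 1 -> 0 < e ->
  cintegrable mu g -> cmeasurable g ->
  (\int[mu]_xi (weight e xi * normc (FT s g xi) ^+ 2)%:E <= C%:E * sq2 mu g)%E.
Proof.
move=> s2 e0 gi mg.
have gci := cintegrable_conj gi.
pose u xi := (weight e xi)%:C * FT (- s) (fun x => (g x)^*%C) xi.
have ui : cintegrable mu u.
  have := cintegrableM_FT (- s) gci (@cintegrable_weight R n e e0).
  by congr cintegrable; apply/funext => xi; rewrite mulrC.
have uE xi : FT s g xi * u xi = (weight e xi * normc (FT s g xi) ^+ 2)%:C.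
  by rewrite /u -FT_conj// mulrCA mul_conjc [RHS]rmorphM.
have ugi : cintegrable mu (fun xi => FT s g xi * u xi) by exact: cintegrableM_FT.
have intE : (\int[mu]_xi (weight e xi * normc (FT s g xi) ^+ 2)%:E =
    (normc (cint mu (fun xi => u xi * FT s g xi)))%:E)%E.
  rewrite (eq_cint _ (g := fun xi => (weight e xi * normc (FT s g xi) ^+ 2)%:C)); last first.
    by move=> xi; rewrite -uE mulrC.
  rewrite cint_real normc_real ger0_norm; last first.
    by apply: Rintegral_ge0 => xi _; rewrite mulr_ge0 ?weight_ge0 ?sqr_ge0.
  rewrite /Rintegral fineK//.
  have ER : (fun xi => (weight e xi * normc (FT s g xi) ^+ 2)%:E) =
      EFin \o (fun xi => complex.Re (FT s g xi * u xi)).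
    by apply/funext => xi; rewrite /comp uE.
  by rewrite ER; apply: integrable_fin_num => //; exact: cintegrable_Re ugi.
rewrite intE FT_mul//.
have mn := measurable_normc mg.
have mF0 : measurable_fun [set: T * T]
    (fun p : T * T => (kernel e p.1 p.2 * (normc (g p.1) * normc (g p.2)))%:E).
  apply/measurable_EFinP/measurable_funM; first exact: measurable_kernel.
  apply: measurable_funM.
    exact: (measurableT_comp mn measurable_fst).
  exact: (measurableT_comp mn measurable_snd).
have hk0 (p : T * T) : (0 <= (kernel e p.1 p.2 * (normc (g p.1) * normc (g p.2)))%:E)%E.
  by rewrite lee_fin !mulr_ge0 ?normc_ge0// kernel_ge0.
apply: le_trans (kernel_schur e0 mg).
apply: le_trans (normc_cint_le _) _; first exact: cintegrableM_FT.
apply: ge0_le_integral => //.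
- by move=> x _; rewrite lee_fin normc_ge0.
- by apply: emeasurable_normc; case: (cintegrableM_FT s ui gi).
- exact: (measurable_fun_fubini_tonelli_F _ mF0 hk0).
- move=> x _; rewrite normcM FT_weight_FT//.
  have mk := @measurable_kernelr R n e x e0.
  have ki : cintegrable mu (fun y => (kernel e x y)%:C * (g y)^*%C).
    have wi := cintegrable_osc s x (@cintegrable_weight R n e e0).
    have := cintegrableM_FT (- s) wi gci; congr cintegrable; apply/funext => y.
    congr (_ * _); rewrite -(@cint_weight_expi R n (- s)) ?sqrrN//.
    by apply: eq_cint => xi; rewrite opprK; congr (_ * _); rewrite mulrC.
  rewrite [X in (_ <= X)%E](_ : _ = (\int[mu]_y (normc ((kernel e x y)%:C * (g y)^*%C))%:E
      * (normc (g x))%:E))%E.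
    by rewrite EFinM; apply: lee_wpmul2r; [rewrite lee_fin normc_ge0|exact: normc_cint_le].
  rewrite -ge0_integralZr//; last 2 first.
  + by move=> y _; rewrite lee_fin normc_ge0.
  + by rewrite lee_fin normc_ge0.
  apply: eq_integral => y _; rewrite -EFinM normcM normc_real normc_conj.
  by rewrite ger0_norm ?kernel_ge0// -mulrA [normc (g y) * _]mulrC.
  by apply: emeasurable_normc; case: ki.
Qed.

End plancherel_inequality.

(** * Truncation to sets of finite measure *)

Section truncation.
Context (R : realType) (n : nat).
Local Notation T := (n.-tuple (measurableTypeR R)).
Local Notation mu := (lebesgueRn R n).
Implicit Types (x y xi : T) (s e r : R) (f g u v : T -> R[i]) (D : set T).

(** A product with the indicator, so that the results on products, [L2_cintegrable_mul] above all,
    apply to truncations. *)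
Definition restr D g : T -> R[i] := fun x => (\1_D x : R)%:C * g x.

Lemma normc_restr D g x : normc (restr D g x) = \1_D x * normc (g x).
Proof. by rewrite /restr normcM normc_real ger0_norm. Qed.

Lemma cmeasurable_restr D g : measurable D -> cmeasurable g -> cmeasurable (restr D g).
Proof.
move=> mD mg; apply: cmeasurableM => //; apply: cmeasurable_real.
exact: measurable_indic.
Qed.

Lemma normc_restr_le D g x : normc (restr D g x) <= normc (g x).
Proof. by rewrite normc_restr ler_piMl ?normc_ge0// indicE lern1 leq_b1. Qed.

Lemma L2_restr D g : measurable D -> L2 mu g -> L2 mu (restr D g).
Proof.
move=> mD gL; apply: (L2_le _ gL (normc_restr_le D g)).
by apply: cmeasurable_restr => //; case: gL.
Qed.

Lemma measurable_dotRn_diag : measurable_fun [set: T] (fun x => dotRn x x).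
Proof.
rewrite /dotRn; apply: (@measurable_sum _ _ _ _ _ _
  (fun i x => (tnth x i : R) * (tnth x i : R))) => i.
by apply: measurable_funM; exact: measurable_tnthR.
Qed.

Lemma measurable_normRn : measurable_fun [set: T] (@normRn R n).
Proof.
apply: measurableT_comp measurable_dotRn_diag.
by apply: continuous_measurable_fun; exact: sqrt_continuous.
Qed.

Lemma normRn_ge0 x : 0 <= normRn x.
Proof. exact: sqrtr_ge0. Qed.

Lemma measurable_ballRn r : measurable (@ballRn R n r).
Proof.
rewrite (_ : ballRn r = [set: T] `&` @normRn R n @^-1` `]-oo, r]%classic).
  by apply: measurable_normRn => //; exact: measurable_itv.
by apply/seteqP; split => x /=; rewrite in_itv/=; tauto.
Qed.

Lemma normr_tnth_le x i : `|(tnth x i : R)| <= normRn x.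
Proof.
rewrite -sqrtr_sqr ler_wsqrtr// /dotRn (bigD1 i)//= -expr2 lerDl.
by apply: sumr_ge0 => j _; rewrite -expr2 sqr_ge0.
Qed.

Lemma ballRn_lty r : (mu (@ballRn R n r) < +oo)%E.
Proof.
(* The additional [- 1] is due to the left ends of a box being open. *)
apply: (@le_lt_trans _ _ (mu (box (fun=> - r - 1) (fun=> r)))).
  apply: le_measure; rewrite ?inE; [exact: measurable_ballRn|exact: measurable_box|].
  move=> x /= xr i; rewrite /= in_itv/=.
  have := le_trans (normr_tnth_le x i) xr; rewrite ler_norml => /andP[? ?].
  by apply/andP; split => //; lra.
rewrite (@lebesgueRn_box R n (fun=> `](- r - 1)%R, r]%classic)); last first.
  by move=> i; exact: measurable_itv.
under eq_bigr do rewrite lebesgue_measure_itv /=.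
case: ifPn => _; last first.
  rewrite -ge0_fin_numE; first by apply: prode_fin_num.
  by apply: prode_ge0.
by rewrite prodEFin ltry.
Qed.

Lemma L2_indic D : measurable D -> (mu D < +oo)%E ->
  L2 mu (fun x => (\1_D x : R)%:C).
Proof.
move=> mD Doo; split; first by apply: cmeasurable_real; exact: measurable_indic.
rewrite /sq2 (eq_integral (fun x => (\1_D x)%:E)).
  by rewrite integral_indic// setIT.
by move=> x _; rewrite normc_real ger0_norm// indicE; case: (x \in D); rewrite ?expr1n ?expr0n.
Qed.

Lemma cintegrable_restr D g : measurable D -> (mu D < +oo)%E -> L2 mu g ->
  cintegrable mu (restr D g).
Proof. by move=> mD Doo gL; apply: L2_cintegrable_mul => //; exact: L2_indic. Qed.

Lemma cintegrable_restr_ball r g : L2 mu g -> cintegrable mu (restr (ballRn r) g).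
Proof.
by apply: cintegrable_restr; [exact: measurable_ballRn|exact: ballRn_lty].
Qed.

Lemma integralC_restr D (osc : T -> R[i]) g :
  integralC D (fun x => osc x * g x) = cint mu (fun x => osc x * restr D g x).
Proof.
rewrite /integralC /cint; congr (_ +i* _); rewrite [LHS]Rintegral_mkcond;
  apply: eq_Rintegral => x _; rewrite patchE /restr indicE; case: ifPn => _;
  by rewrite ?mul1r // mul0r mulr0.
Qed.

(** Dominated convergence along integer radii, then monotonicity in the radius. *)
Lemma sq2_tail g : L2 mu g -> forall e, 0 < e ->
  exists r0, forall r, r0 <= r -> (sq2 mu (restr (~` ballRn r) g) <= e%:E)%E.
Proof.
move=> [mg goo] e e0.
have mB k : measurable (~` @ballRn R n k) by apply: measurableC; exact: measurable_ballRn.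
have cv : sq2 mu (restr (~` ballRn k%:R) g) @[k --> \oo] --> 0%E.
  have mk k : measurable_fun [set: T]
      (fun x => (normc (restr (~` ballRn k%:R) g x) ^+ 2)%:E).
    by apply: emeasurable_sqr_normc; exact: cmeasurable_restr.
  have lim0 : {ae mu, forall x, [set: T] x ->
      ((normc (restr (~` ballRn k%:R) g x) ^+ 2)%:E @[k --> \oo] --> 0%E)}.
    apply: aeW => x _; apply: cvg_near_cst.
    near=> k; rewrite normc_restr indicE memNset ?mul0r ?expr0n//=.
    by apply; rewrite /ballRn /=; near: k; exact: nbhs_infty_ger.
  have gi : mu.-integrable [set: T] (fun x => (normc (g x) ^+ 2)%:E).
    apply/integrableP; split; first exact: emeasurable_sqr_normc.
    by under eq_integral do rewrite /= ger0_norm ?sqr_ge0//.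
  have dom : {ae mu, forall x k, [set: T] x ->
      (`|(normc (restr (~` ballRn k%:R) g x) ^+ 2)%:E| <= (normc (g x) ^+ 2)%:E)%E}.
    apply: aeW => x k _; rewrite /= lee_fin ger0_norm ?sqr_ge0//.
    by rewrite ler_pXn2r ?nnegrE ?normc_ge0// normc_restr_le.
  have [_ _] := dominated_convergence measurableT mk (measurable_cst _) lim0 gi dom.
  by rewrite integral0.
have [N _ NP] : \forall k \near \oo, (sq2 mu (restr (~` ballRn k%:R) g) <= e%:E)%E.
  exact: cvge0_le cv _ e0.
exists N%:R => r Nr; apply: le_trans (NP N (leqnn _)).
apply: le_sq2; [exact: cmeasurable_restr|exact: cmeasurable_restr|] => x.
rewrite !normc_restr ler_wpM2r ?normc_ge0// !indicE ler_nat.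
case: (boolP (x \in ~` ballRn r)) => // /set_mem /= xr.
by rewrite mem_set//= => /le_trans /(_ Nr).
Unshelve. all: by end_near. Qed.

End truncation.

(** * The Fourier transform on L^2 *)

Section L2_fourier.
Context (R : realType) (n : nat).
Local Notation T := (n.-tuple (measurableTypeR R)).
Local Notation mu := (lebesgueRn R n).
Local Notation sq2 := (sq2 mu).
Local Notation L2 := (L2 mu).
Implicit Types (x y xi : T) (s e r : R) (f g u v : T -> R[i]) (D : set T).

Let C : R := (2 * pi) ^+ n.

Let C_gt0 : 0 < C.
Proof. by rewrite exprn_gt0// mulr_gt0// pi_gt0. Qed.

Lemma exists_nat_ge (r : R) : exists N : nat, r <= N%:R.
Proof.
exists (Num.truncn `|r|).+1.
by rewrite (le_trans (ler_norm _))// ltW// Num.Theory.truncnS_gt.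
Qed.

Lemma weightE e xi : weight e xi = expR (- (e * \sum_(i < n) `|tnth xi i : R|)).
Proof.
rewrite /weight /expabs -expR_sum sumrN; congr (expR (- _)).
by rewrite mulr_sumr.
Qed.

Lemma weight_cvg1 xi : weight (k.+1%:R^-1) xi @[k --> \oo] --> (1 : R).
Proof.
under eq_fun do rewrite weightE.
suff main (c : R) : expR (- (k.+1%:R^-1 * c)) @[k --> \oo] --> (1 : R) by exact: main.
have h : - (k.+1%:R^-1 * c) @[k --> \oo] --> - (0 * c).
  by apply: cvgN; apply: cvgM; [exact: cvg_harmonic|exact: cvg_cst].
have := cvg_comp _ expR h (@continuous_expR R _).
by rewrite mul0r oppr0 expR0.
Qed.

(** The bound of [plancherel_weighted] does not depend on the parameter of the weight, so Fatou's
    lemma lets that parameter tend to 0. *)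
Lemma plancherel_le s g : s ^+ 2 = 1 -> cintegrable mu g ->
  (sq2 (FT s g) <= C%:E * sq2 g)%E.
Proof.
move=> s2 gi; have [mg _] := gi; have mF := cmeasurable_FT s mg.
apply: (@sq2_fatou _ _ _ _ (fun k xi => (weight k.+1%:R^-1 xi)%:C * FT s g xi)) => //.
- move=> k; apply: cmeasurableM => //; apply: cmeasurable_real.
  exact: measurable_weight.
- apply: aeW => xi; under eq_fun do rewrite normcM normc_real ger0_norm ?weight_ge0//.
  suff : weight k.+1%:R^-1 xi * normc (FT s g xi) @[k --> \oo] --> 1 * normc (FT s g xi).
    by rewrite mul1r.
  by apply: cvgM; [exact: weight_cvg1|exact: cvg_cst].
- apply: nearW => k.
  (* The square of the weight with parameter [e] is the weight with parameter [2 e]. *)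
  have e0 : 0 < 2 * (k.+1%:R^-1 : R) by rewrite mulr_gt0.
  apply: le_trans (plancherel_weighted s2 e0 gi mg).
  rewrite le_eqVlt; apply/orP; left; apply/eqP; apply: eq_integral => xi _.
  rewrite normcM normc_real ger0_norm ?weight_ge0// exprMn; congr (_ * _)%:E.
  rewrite !weightE expr2 -expRD; congr expR; ring.
Qed.

Lemma L2_FT s g : s ^+ 2 = 1 -> cintegrable mu g -> L2 g -> L2 (FT s g).
Proof.
move=> s2 gi [mg goo]; split; first exact: cmeasurable_FT.
apply: le_lt_trans (plancherel_le s2 gi) _.
by rewrite lte_mul_pinfty// lee_fin ltW.
Qed.

Lemma sq2_truncB s g r0 r r' : s ^+ 2 = 1 -> L2 g -> r0 <= r -> r0 <= r' ->
  (sq2 (fun xi => FT s (restr (ballRn r) g) xi - FT s (restr (ballRn r') g) xi)%R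
   <= C%:E * sq2 (restr (~` ballRn r0) g))%E.
Proof.
move=> s2 gL rr rr'; have [mg goo] := gL.
have bi t := cintegrable_restr_ball t gL.
rewrite (_ : (fun xi => _) =
    FT s (fun x => restr (ballRn r) g x - restr (ballRn r') g x)); last first.
  by apply/funext => xi; rewrite FTB.
apply: le_trans (plancherel_le s2 (cintegrableB (bi r) (bi r'))) _.
apply: lee_wpmul2l; first by rewrite lee_fin ltW.
have mB t : measurable (@ballRn R n t) by exact: measurable_ballRn.
apply: le_sq2.
- by apply: cmeasurableB; exact: cmeasurable_restr.
- by apply: cmeasurable_restr => //; exact: measurableC.
move=> x; rewrite /restr -mulrBl !normcM ler_wpM2r ?normc_ge0//.
rewrite -rmorphB !normc_real !indicE in_setC.
case: (boolP (x \in ballRn r0)) => /= [/set_mem /= xr0|xr0].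
  rewrite !mem_set ?subrr ?normr0//=; [exact: le_trans rr'|exact: le_trans rr].
by rewrite normr1; do 2 case: (_ \in _); rewrite ?subrr ?subr0 ?sub0r ?normrN ?normr1 ?normr0.
Qed.

(** Existence comes from completeness along integer radii; the limit is then extended to all real
    radii, because the frequency balls used later have radius [rad a m]. *)
Lemma FT_limit s g : s ^+ 2 = 1 -> L2 g ->
  exists2 h, L2 h & forall e, 0 < e -> exists r0, forall r, r0 <= r ->
    (sq2 (fun xi => FT s (restr (ballRn r) g) xi - h xi)%R <= e%:E)%E.
Proof.
move=> s2 gL; have bi t := cintegrable_restr_ball t gL.
have bL t : L2 (restr (ballRn t) g) by apply: L2_restr => //; exact: measurable_ballRn.
have small e : 0 < e -> exists r0, forall r r', r0 <= r -> r0 <= r' ->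
   (sq2 (fun xi => FT s (restr (ballRn r) g) xi - FT s (restr (ballRn r') g) xi)%R
   <= e%:E)%E.
  move=> e0; have eC : 0 < e / C by rewrite divr_gt0.
  have [r0 r0P] := sq2_tail gL eC; exists r0 => r r' rr rr'.
  apply: le_trans (sq2_truncB s2 gL rr rr') _.
  rewrite (_ : e = C * (e / C)); last by rewrite mulrC divfK// gt_eqF.
  by rewrite EFinM; apply: lee_wpmul2l; [rewrite lee_fin ltW|exact: r0P].
have uL k : L2 (FT s (restr (ballRn k%:R) g)) by exact: L2_FT.
have [h hL hcv] : exists2 h, L2 h &
    sq2 (fun xi => FT s (restr (ballRn k%:R) g) xi - h xi) @[k --> \oo] --> 0%E.
  apply: (L2_complete uL) => e /small[r0 r0P].
  have [N rN] : exists N : nat, r0 <= N%:R.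
    exact: exists_nat_ge.
  by exists N => p q Np Nq; apply: r0P; rewrite (le_trans rN)// ler_nat.
exists h => // e e0; have e4 : 0 < e / 4 by rewrite divr_gt0.
have [r0 r0P] := small _ e4.
have [N _ NP] := cvge0_le hcv e4.
have [m rm] : exists m : nat, r0 <= m%:R.
  exact: exists_nat_ge.
exists r0 => r rr; pose k := maxn N m.
rewrite (_ : (fun xi => _) = (fun xi =>
   (FT s (restr (ballRn r) g) xi - FT s (restr (ballRn k%:R) g) xi) +
   (FT s (restr (ballRn k%:R) g) xi - h xi))); last first.
  by apply/funext => xi; rewrite subrKA.
apply: le_trans.
  apply: sq2D.
    by apply: cmeasurableB; apply: (proj1 (L2_FT _ _ _)).
  by apply: cmeasurableB; [case: (uL k)|case: hL].
have -> : (e%:E = 2%:E * (e / 4)%:E + 2%:E * (e / 4)%:E)%E.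
  by rewrite -!EFinM -EFinD; congr EFin; lra.
apply: leeD; apply: lee_wpmul2l; rewrite ?lee_fin//.
  by apply: r0P => //; rewrite (le_trans rm)// ler_nat leq_maxr.
by apply: NP; rewrite /= leq_maxl.
Qed.

Lemma limL2P (u : nat -> T -> R[i]) : (exists g, cvgL2 u g) -> cvgL2 u (limL2 u).
Proof. by move=> [g ug]; rewrite /limL2; apply: (xgetPex (fun=> 0)); exists g. Qed.

(** [limL2] selects one limit among many. Comparing it with [c * h] at a common integer radius
    transfers to it the convergence over real radii. *)
Lemma limL2_FTP (c : R[i]) s g (u : nat -> T -> R[i]) : s ^+ 2 = 1 -> L2 g ->
  (forall k, u k = fun xi => c * FT s (restr (ballRn k%:R) g) xi) ->
  L2 (limL2 u) /\ forall e, 0 < e -> exists r0, forall r, r0 <= r ->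
    (sq2 (fun xi => c * FT s (restr (ballRn r) g) xi - limL2 u xi)%R <= e%:E)%E.
Proof.
move=> s2 gL uE; have [h hL hP] := FT_limit s2 gL.
have mh : cmeasurable h by case: hL.
have mF r : cmeasurable (FT s (restr (ballRn r) g)).
  by apply: cmeasurable_FT; apply: cmeasurable_restr; [exact: measurable_ballRn|case: gL].
have chL : L2 (fun xi => c * h xi) by exact: L2Z.
have mcF r : cmeasurable (fun xi => c * FT s (restr (ballRn r) g) xi).
  by apply: cmeasurableM => //; exact: cmeasurable_cst.
have chP e : 0 < e -> exists r0, forall r, r0 <= r ->
    (sq2 (fun xi => c * FT s (restr (ballRn r) g) xi - c * h xi)%R <= e%:E)%E.
  move=> e0; have K0 : 0 < normc c ^+ 2 + 1 by rewrite ltr_wpDl ?sqr_ge0.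
  have eK : 0 < e / (normc c ^+ 2 + 1) by rewrite divr_gt0.
  have [r0 r0P] := hP _ eK; exists r0 => r /r0P H.
  rewrite (_ : (fun xi => _) = (fun xi => c * (FT s (restr (ballRn r) g) xi - h xi))).
    rewrite sq2Z; last exact: cmeasurableB.
    apply: (@le_trans _ _ ((normc c ^+ 2)%:E * (e / (normc c ^+ 2 + 1))%:E)%E).
      by apply: lee_wpmul2l => //; rewrite lee_fin sqr_ge0.
    rewrite -EFinM lee_fin mulrA ler_pdivrMr// mulrC ler_pM2l//.
    by rewrite lerDl.
  by apply/funext => xi; rewrite mulrBr.
have [lL lcv] : cvgL2 u (limL2 u).
  apply: limL2P; exists (fun xi => c * h xi); split; first by case: chL => -[].
  apply: le_cvge0 => [k|e e0]; first exact: sq2_ge0.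
  have [r0 r0P] := chP e e0; have [N rN] := exists_nat_ge r0.
  exists N => // k /= Nk; rewrite uE; apply: r0P.
  by rewrite (le_trans rN)// ler_nat.
have ml : cmeasurable (limL2 u) by case: lL.
split => [|e e0]; first by case: lL => m1 m2 oo; split.
(* Two nested uses of [sq2D] give [2 (e/12) + 2 (4 e/12)], which is at most [e]. *)
have e12 : 0 < e / 12 by rewrite divr_gt0.
have [r0 r0P] := chP _ e12.
have [N1 _ N1P] := cvge0_le lcv e12.
have [N2 rN2] := exists_nat_ge r0.
exists r0 => r rr; pose k := maxn N1 N2.
rewrite (_ : (fun xi => _) = (fun xi =>
   (c * FT s (restr (ballRn r) g) xi - c * h xi) +
   ((c * h xi - c * FT s (restr (ballRn k%:R) g) xi) +
    (c * FT s (restr (ballRn k%:R) g) xi - limL2 u xi)))); last first.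
  by apply/funext => xi; rewrite subrKA subrKA.
have mch : cmeasurable (fun xi => c * h xi) by case: chL.
have h1 := sq2D mu (cmeasurableB mch (mcF k%:R)) (cmeasurableB (mcF k%:R) ml).
have h0 := sq2D mu (cmeasurableB (mcF r) mch)
  (cmeasurableD (cmeasurableB mch (mcF k%:R)) (cmeasurableB (mcF k%:R) ml)).
apply: (le_trans h0).
have h2 : (sq2 (fun xi => (c * h xi - c * FT s (restr (ballRn k%:R) g) xi) +
    (c * FT s (restr (ballRn k%:R) g) xi - limL2 u xi))%R <= (e / 3)%:E)%E.
  apply: (le_trans h1).
  have -> : ((e / 3)%:E = 2%:E * (e / 12)%:E + 2%:E * (e / 12)%:E)%E.
    by rewrite -!EFinM -EFinD; congr EFin; lra.
  apply: leeD; apply: lee_wpmul2l; rewrite ?lee_fin//.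
    by rewrite sq2Bsym; apply: r0P; rewrite (le_trans rN2)// ler_nat leq_maxr.
  by have := N1P k (leq_maxl _ _); rewrite uE.
apply: (@le_trans _ _ (2%:E * (e / 12)%:E + 2%:E * (e / 3)%:E)%E).
  by apply: leeD; apply: lee_wpmul2l; rewrite ?lee_fin//; exact: r0P.
by rewrite -!EFinM -EFinD lee_fin; lra.
Qed.

Lemma fourierP f : L2 f -> L2 (fourier f) /\
  forall e, 0 < e -> exists r0, forall r, r0 <= r ->
    (sq2 (fun xi => FT (-1) (restr (ballRn r) f) xi - fourier f xi)%R <= e%:E)%E.
Proof.
move=> fL; have s2 : (-1 : R) ^+ 2 = 1 by rewrite sqrrN expr1n.
have [//|? H] := @limL2_FTP 1 _ _ (fun k xi =>
    integralC (ballRn k%:R) (fun x => expi (- dotRn xi x) * f x)) s2 fL.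
  move=> k; apply/funext => xi; rewrite mul1r integralC_restr; apply: eq_cint => x.
  by rewrite mulN1r.
split => // e /H[r0 r0P]; exists r0 => r /r0P.
by under [X in sq2 X]eq_fun do rewrite mul1r.
Qed.

Lemma inv_fourierP g : L2 g -> L2 (inv_fourier g) /\
  forall e, 0 < e -> exists r0, forall r, r0 <= r ->
    (sq2 (fun x => C^-1%:C * FT 1 (restr (ballRn r) g) x - inv_fourier g x)%R <= e%:E)%E.
Proof.
move=> gL; apply: limL2_FTP => //; first by rewrite expr1n.
move=> k; apply/funext => x; congr (_ * _); rewrite integralC_restr; apply: eq_cint => xi.
by rewrite mul1r dotRnC.
Qed.

End L2_fourier.

(** * Boxes determine an integrable function *)

Section boxes_determine.
Context (R : realType) (n : nat).
Local Notation T := (n.-tuple (measurableTypeR R)).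
Local Notation mu := (lebesgueRn R n).
Implicit Types (a b : 'I_n -> R).

Definition boxes : set (set T) := [set A | exists a b, A = box a b].

Lemma setI_closed_boxes : setI_closed boxes.
Proof.
move=> _ _ [a [b ->]] [c [d ->]].
exists (fun i => Num.max (a i) (c i)), (fun i => Num.min (b i) (d i)).
apply/seteqP; split => x /=.
  move=> [abx cdx] i; have := abx i; have := cdx i; rewrite /= !in_itv/=.
  move=> /andP[h1 h2] /andP[h3 h4].
  by rewrite gt_max le_min h1 h2 h3 h4.
move=> H; split => i; have := H i; rewrite /= !in_itv/= gt_max le_min;
  by move=> /andP[/andP[h1 h2] /andP[h3 h4]]; apply/andP.
Qed.

Lemma measurable_sub_boxes : @measurable _ T `<=` <<s boxes >>.
Proof.
pose T' := g_sigma_algebraType boxes.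
have mid : measurable_fun [set: T'] (fun x : T' => x : T).
  apply/measurable_fun_tnthP => i.
  apply: (@measurability _ _ T' (measurableTypeR R) _ _ (@ocitv R)) => //.
  move=> _ [_ [[c d] _ <-] <-]; rewrite setTI /=.
  (* A slab in the [i]-th coordinate is the union of boxes whose other sides grow to the whole
     line. *)
  rewrite (_ : _ @^-1` _ = \bigcup_k box
    (fun j => if j == i then c else - k%:R) (fun j => if j == i then d else k%:R)).
    apply: bigcupT_measurable => k; apply: sub_sigma_algebra.
    by do 2 eexists.
  apply/seteqP; split => [x /= xi|x [k _ /(_ i)]]; last by rewrite eqxx.
  have [N HN] : exists N : nat, \sum_(j < n) `|tnth x j : R| < N%:R.
    exists (Num.truncn (\sum_(j < n) `|tnth x j : R|)).+1.
    by rewrite Num.Theory.truncnS_gt.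
  exists N => // j; case: eqP => [->//|_]; rewrite /= in_itv/=.
  have : `|tnth x j : R| < N%:R.
    apply: le_lt_trans HN; rewrite (bigD1 j)//= lerDl.
    by apply: sumr_ge0.
  by rewrite ltr_norml => /andP[-> /ltW ->].
move=> A mA; have := mid measurableT A mA; rewrite setTI.
by [].
Qed.

(** The measurable sets on which [r] has integral 0 form a lambda-system, by additivity and
    dominated convergence, and the boxes are an intersection-stable generator. The hypothesis on the
    total integral puts the whole space in that system. *)
Lemma boxes_ae_eq0 (r : T -> R) : mu.-integrable [set: T] (EFin \o r) ->
  (forall a b, (forall i, a i < b i) -> \int[mu]_(x in box a b) r x = 0) ->
  \int[mu]_x r x = 0 ->
  {ae mu, forall x, r x = 0}.
Proof.
move=> ri r0 rT.
have rA A : measurable A -> mu.-integrable A (EFin \o r).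
  by move=> mA; apply: integrableS ri.
have main A : measurable A -> \int[mu]_(x in A) r x = 0.
  move=> mA; suff : [set A | measurable A /\ \int[mu]_(x in A) r x = 0] A by case.
  apply: (lambda_system_subset setI_closed_boxes (D := setT)); last first.
  - exact: measurable_sub_boxes.
  - by [].
  - move=> _ [a [b ->]]; split; first exact: measurable_box.
    have [ab|/existsNP[i /negP]] := pselect (forall i, a i < b i); first exact: r0.
    rewrite -leNgt => ba.
    rewrite (_ : box a b = set0) ?Rintegral_set0//.
    apply/seteqP; split => // x /(_ i); rewrite /= in_itv/= => /andP[ax xb].
    by have := lt_le_trans ax (le_trans xb ba); rewrite ltxx.
  - split => //.
    + move=> B C CB [mB rB] [mC rC]; split; first exact: measurableD.
      have := @Rintegral_setU _ _ _ mu (B `\` C) C r (measurableD mB mC) mC.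
      rewrite setDKU// => /(_ (rA _ mB)).
      rewrite rB rC addr0 => <- //; apply/disj_setPS => x [[_ nC] Cx].
      exact: nC Cx.
    + move=> F ndF HF; have mF k : measurable (F k) by case: (HF k).
      split; first exact: bigcupT_measurable.
      rewrite Rintegral_mkcond /Rintegral.
      have mU : measurable (\bigcup_k F k) by exact: bigcupT_measurable.
      have mr : measurable_fun [set: T] r.
        by have /measurable_EFinP := measurable_int _ ri.
      have mrB B : measurable B -> measurable_fun [set: T] (fun x => ((r \_ B) x)%:E).
        move=> mB; apply/measurable_EFinP; apply/(measurable_restrictT _ mB).
        exact: measurable_funTS.
      have lim : {ae mu, forall x, [set: T] x ->
          (((r \_ (F k)) x)%:E @[k --> \oo] --> ((r \_ (\bigcup_k F k)) x)%:E)}.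
        apply: aeW => x _; rewrite [in X in _ --> X]patchE; case: ifPn => [/set_mem[N _ FN]|xF].
          apply: cvg_near_cst; exists N => // k /= Nk; rewrite patchE mem_set//.
          by move: FN; exact/subsetPset/ndF.
        apply: cvg_near_cst; apply: nearW => k; rewrite patchE memNset// => Fk.
        by move/negP: xF; apply; apply/mem_set; exists k.
      have dom : {ae mu, forall x k, [set: T] x ->
          (`|((r \_ (F k)) x)%:E| <= `|(r x)%:E|)%E}.
        by apply: aeW => x k _; rewrite patchE; case: ifPn => // _; rewrite abse0.
      have [_ _] := dominated_convergence measurableT (fun k => mrB _ (mF k)) (mrB _ mU)
        lim (integrable_abse ri) dom.
      rewrite (_ : (fun k => _) = fun=> 0%E); last first.
        apply/funext => k; have [_] := HF k; rewrite Rintegral_mkcond => rk.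
        rewrite -[LHS]fineK; first by congr EFin; exact: rk.
        have := integrable_fin_num (mF k) (rA _ (mF k)).
        by rewrite integral_mkcond; under eq_integral do rewrite restrict_EFin.
      by move=> /cvg_lim <- //; rewrite lim_cst.
have : ae_eq mu setT (EFin \o r) (cst 0%E).
  apply: (integral_ae_eq measurableT ri (measurable_cst _)) => E _ mE.
  rewrite integral0 -[LHS]fineK; first by congr EFin; exact: main.
  by apply: integrable_fin_num => //; exact: rA.
by apply: filterS => x /(_ Logic.I) [].
Qed.

End boxes_determine.

Lemma normc_cvg_unique (R : realType) (u : nat -> R[i]) (z w : R[i]) :
  normc (u k - z) @[k --> \oo] --> (0 : R) ->
  normc (u k - w) @[k --> \oo] --> (0 : R) -> z = w.
Proof.
move=> uz uw; apply/eqP; rewrite -subr_eq0; apply/eqP/eq0_normc/eqP.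
rewrite eq_le normc_ge0 andbT; apply/ler_addgt0Pr => e e0; rewrite add0r.
have e2 : 0 < e / 2 by rewrite divr_gt0.
have [k [kz kw]] : exists k, normc (u k - z) <= e / 2 /\ normc (u k - w) <= e / 2.
  near \oo => k; exists k; split; near: k; [exact: (cvgr_le _ uz)|exact: (cvgr_le _ uw)].
rewrite (_ : z - w = (z - u k) + (u k - w)); last by rewrite subrKA.
by apply: le_trans (le_normcD _ _) _; rewrite (normcB z) (splitr e) lerD.
Unshelve. all: by end_near. Qed.

Lemma cvg_prod_ord (R : realType) (n : nat) (h : nat -> 'I_n -> R) (l : 'I_n -> R) :
  (forall i, h k i @[k --> \oo] --> l i) ->
  \prod_(i < n) h k i @[k --> \oo] --> \prod_(i < n) l i.
Proof.
elim: n h l => [|n IH] h l hl.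
  by under eq_fun do rewrite big_ord0; rewrite big_ord0; exact: cvg_cst.
under eq_fun do rewrite big_ord_recl; rewrite big_ord_recl.
by apply: cvgM => //; apply: (IH (fun k i => h k (lift ord0 i))) => i.
Qed.

Lemma normc_scale_cvg (R : realType) (p : nat -> R) (c : R) (z : R[i]) :
  p k @[k --> \oo] --> c ->
  normc ((p k)%:C * z - c%:C * z) @[k --> \oo] --> (0 : R).
Proof.
move=> pc; under eq_fun do rewrite -mulrBl normcM -rmorphB normc_real.
have h : `|p k - c| @[k --> \oo] --> (0 : R).
  rewrite -(normr0 R) -(subrr c); apply: cvg_norm; apply: cvgB => //; exact: cvg_cst.
suff : `|p k - c| * normc z @[k --> \oo] --> 0 * normc z by rewrite mul0r.
by apply: cvgM; [exact: h|exact: cvg_cst].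
Qed.

Lemma measurable_poisson_itv (R : realType) (e a b : R) :
  measurable_fun [set: R] (poisson_itv e a b).
Proof.
apply: continuous_measurable_fun => x.
have atan_cont (c : R) : atan ((c - y) / e) @[y --> x] --> atan ((c - x) / e).
  have h : (c - y) / e @[y --> x] --> (c - x) / e.
    by apply: cvgM; [apply: cvgB => //; exact: cvg_cst|exact: cvg_cst].
  exact: (cvg_comp _ atan h (@continuous_atan R _)).
by apply: cvgM; [exact: cvg_cst|apply: cvgB; exact: atan_cont].
Qed.

(** * Fourier inversion tested on boxes *)

Section fourier_inversion.
Context (R : realType) (n : nat).
Local Notation T := (n.-tuple (measurableTypeR R)).
Local Notation mu := (lebesgueRn R n).
Local Notation sq2 := (sq2 mu).
Local Notation L2 := (L2 mu).
Local Notation cint := (cint mu).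
Implicit Types (x y xi : T) (s e r : R) (f g u v : T -> R[i]) (a b : 'I_n -> R).

Let C : R := (2 * pi) ^+ n.

Let C_gt0 : 0 < C.
Proof. by rewrite exprn_gt0// mulr_gt0// pi_gt0. Qed.

Definition indc (D : set T) : T -> R[i] := fun x => (\1_D x : R)%:C.

Lemma restrE D f x : restr D f x = f x * indc D x.
Proof. by rewrite mulrC. Qed.

Lemma box_lty a b : (mu (box a b) < +oo)%E.
Proof.
rewrite (@lebesgueRn_box R n (fun i => `]a i, b i]%classic)); last first.
  by move=> i; exact: measurable_itv.
under eq_bigr do rewrite lebesgue_measure_itv /=.
rewrite -ge0_fin_numE; first by apply: prode_fin_num => i _; case: ifP.
by apply: prode_ge0 => i _; case: ifPn => //; rewrite lte_fin -EFinB lee_fin subr_ge0 => /ltW.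
Qed.

Lemma L2_indc_box a b : L2 (indc (box a b)).
Proof. by apply: L2_indic; [exact: measurable_box|exact: box_lty]. Qed.

Lemma cintegrable_indc_box a b : cintegrable mu (indc (box a b)).
Proof.
have [mi _] := L2_indc_box a b; split => //.
rewrite (eq_integral (fun x => (\1_(box a b) x)%:E)).
  by rewrite integral_indic// ?setIT ?box_lty//; exact: measurable_box.
by move=> x _; rewrite /indc normc_real ger0_norm.
Qed.

(* Off the faces of the box. *)
Lemma kernel_box_cvg a b : (forall i, a i < b i) ->
  {ae mu, forall x, \prod_(i < n) poisson_itv k.+1%:R^-1 (a i) (b i) (tnth x i)
    @[k --> \oo] --> C * \1_(box a b) x}.
Proof.
move=> ab.
have m1 (c : R) : measurable ([set c] : set (measurableTypeR R)).
  by rewrite -set_itv1; exact: measurable_itv.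
have face i (c : R) : {ae mu, forall x, (tnth x i : R) != c}.
  exists ((fun x : T => (tnth x i : R)) @^-1` [set c]); split.
  - rewrite -[_ @^-1` _]setTI; exact: (measurable_tnthR i) (m1 c).
  - pose A j : set (measurableTypeR R) := if j == i then [set c] else setT.
    have mA j : measurable (A j).
      by rewrite /A; case: ifP => _; [exact: m1|].
    rewrite (_ : _ @^-1` _ = [set x : T | forall j, A j (tnth x j)]).
      by rewrite lebesgueRn_box// (bigD1 i)//= /A eqxx lebesgue_measure_set1 mul0e.
    apply/seteqP; split => x /=.
      by move=> xi j; rewrite /A; case: eqP => [->|].
    by move=> /(_ i); rewrite /A eqxx.
  - by move=> x /= /negP; rewrite negbK => /eqP.
have faces : {ae mu, forall x, forall i, (tnth x i : R) != a i /\ (tnth x i : R) != b i}.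
  by apply: filter_forall => i; apply: filterS2 (face i (a i)) (face i (b i)) => x.
apply: filterS faces => x xab.
rewrite indic_box /C -[n in _ ^+ n]card_ord -prodr_const -big_split /=.
by apply: cvg_prod_ord => i; have [xa xb] := xab i; exact: poisson_itv_cvg.
Qed.

(** With the weight inserted on the left, the multiplication formula gives the integral of [f]
    against the kernel mass of the box, a product of [poisson_itv]. Both sides pass to the limit by
    dominated convergence: the left because both transforms are in L^2 by [plancherel_le], the right
    because the kernel mass is at most [C]. *)
Lemma parseval_box f a b : cintegrable mu f -> L2 f -> (forall i, a i < b i) ->
  cint (fun xi => FT (-1) f xi * FT 1 (indc (box a b)) xi) =
  C%:C * cint (restr (box a b) f).
Proof.
move=> fi fL ab.
have s2 : (-1 : R) ^+ 2 = 1 by rewrite sqrrN expr1n.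
have s1 : (1 : R) ^+ 2 = 1 by rewrite expr1n.
have bi := cintegrable_indc_box a b; have bL := L2_indc_box a b.
have [mf foo] := fi.
have FfL : L2 (FT (-1) f) by exact: L2_FT.
have FbL : L2 (FT 1 (indc (box a b))) by exact: L2_FT.
have FFi := L2_cintegrable_mul FfL FbL.
pose e k : R := k.+1%:R^-1.
have e0 k : 0 < e k by rewrite /e invr_gt0 ltr0n.
pose v xi := FT (-1) f xi * FT 1 (indc (box a b)) xi.
pose P k x : R := \prod_(i < n) poisson_itv (e k) (a i) (b i) (tnth x i).
have P0 k x : 0 <= P k x by apply: prodr_ge0 => i _; apply: poisson_itv_ge0 => //; exact: ltW.
have PC k x : P k x <= C.
  rewrite /C -[n in leRHS]card_ord -prodr_const; apply: ler_prod => i _.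
  by rewrite poisson_itv_le andbT poisson_itv_ge0// ltW.
have wE k : cint (fun xi => (weight (e k) xi)%:C * v xi) =
    cint (fun x => (P k x)%:C * f x).
  transitivity (cint (fun xi => ((weight (e k) xi)%:C * FT 1 (indc (box a b)) xi) *
      FT (-1) f xi)).
    by apply: eq_cint => xi; rewrite /v; ring.
  rewrite FT_mul//; last first.
    have := cintegrableM_FT 1 bi (@cintegrable_weight R n (e k) (e0 k)).
    by congr cintegrable; apply/funext => xi; rewrite mulrC.
  apply: eq_cint => x; congr (_ * _).
  have := FT_weight_FT x s2 (e0 k) bi; rewrite opprK => ->.
  rewrite (eq_cint _ (g := fun y => (kernel (e k) x y * \1_(box a b) y)%:C)); last first.
    by move=> y; rewrite rmorphM.
  by rewrite cint_real /Rintegral integral_kernel_box.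
have lim1 : normc (cint (fun xi => (weight (e k) xi)%:C * v xi) - cint v)
    @[k --> \oo] --> (0 : R).
  apply: (cint_dominated_cvg (g := fun xi => normc (v xi))).
  - move=> k; apply: cmeasurableM; last by case: FFi.
    by apply: cmeasurable_real; exact: measurable_weight.
  - by case: FFi.
  - apply: aeW => xi; have := normc_scale_cvg (v xi) (weight_cvg1 xi).
    by rewrite (mul1r (v xi)).
  - exact: cintegrable_normc.
  - move=> k xi; rewrite normcM normc_real ger0_norm ?weight_ge0//.
    by rewrite ler_piMl ?normc_ge0// weight_le1.
  - by [].
have lim2 : normc (cint (fun x => (P k x)%:C * f x) -
    cint (fun x => C%:C * restr (box a b) f x)) @[k --> \oo] --> (0 : R).
  apply: (cint_dominated_cvg (g := fun x => C * normc (f x))).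
  - move=> k; apply: cmeasurableM => //; apply: cmeasurable_real.
    by apply: (@measurable_prod_tnth R n (fun i => poisson_itv (e k) (a i) (b i))) => i;
      exact: measurable_poisson_itv.
  - apply: cmeasurableM; first exact: cmeasurable_cst.
    by apply: cmeasurable_restr => //; exact: measurable_box.
  - apply: filterS (kernel_box_cvg ab) => x Px.
    have := normc_scale_cvg (f x) Px.
    by under eq_fun do rewrite rmorphM -[(_%:C * _) * f x]mulrA.
  - exact: (integrableZl measurableT C (cintegrable_normc fi)).
  - move=> k x; rewrite normcM normc_real ger0_norm//.
    by rewrite ler_wpM2r ?normc_ge0.
  - move=> x; rewrite normcM normc_real ger0_norm ?(ltW C_gt0)// ler_pM2l//.
    exact: normc_restr_le.
have {}lim1 : normc (cint (fun x => (P k x)%:C * f x) - cint v) @[k --> \oo] --> (0 : R).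
  apply: cvg_trans lim1; apply: near_eq_cvg; apply: nearW => k.
  by rewrite wE.
rewrite (normc_cvg_unique lim1 lim2) cintZ//.
by apply: cintegrable_restr => //; [exact: measurable_box|exact: box_lty].
Qed.

End fourier_inversion.

Section inversion_theorem.
Context (R : realType) (n : nat).
Local Notation T := (n.-tuple (measurableTypeR R)).
Local Notation mu := (lebesgueRn R n).
Local Notation sq2 := (sq2 mu).
Local Notation L2 := (L2 mu).
Local Notation cint := (cint mu).
Implicit Types (x y xi : T) (s e r : R) (f g u v : T -> R[i]) (a b : 'I_n -> R).

Let C : R := (2 * pi) ^+ n.

Let C_gt0 : 0 < C.
Proof. by rewrite exprn_gt0// mulr_gt0// pi_gt0. Qed.

Lemma sq2_restr_ball_cvg f : L2 f ->
  sq2 (fun x => restr (ballRn k%:R) f x - f x) @[k --> \oo] --> 0%E.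
Proof.
move=> fL; apply: le_cvge0 => [k|e e0]; first exact: sq2_ge0.
have [r0 r0P] := sq2_tail fL e0; have [N rN] := exists_nat_ge r0.
exists N => // k /= Nk.
have /r0P : r0 <= k%:R by rewrite (le_trans rN)// ler_nat.
apply: le_trans; rewrite le_eqVlt; apply/orP; left; apply/eqP.
apply: eq_integral => x _; congr ((_ ^+ 2)%:E).
rewrite normc_restr /restr -[X in _ - X]mul1r -mulrBl normcM; congr (_ * _).
rewrite -(rmorph1 (real_complex R)) -rmorphB normc_real !indicE in_setC.
by case: (_ \in _); rewrite ?subrr ?normr0// sub0r normrN normr1.
Qed.

Lemma cvg_of_radius (w : R -> T -> R[i]) g :
  (forall e, 0 < e -> exists r0, forall r, r0 <= r ->
    (sq2 (fun x => w r x - g x)%R <= e%:E)%E) ->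
  sq2 (fun x => w k%:R x - g x) @[k --> \oo] --> 0%E.
Proof.
move=> wg; apply: le_cvge0 => [k|e e0]; first exact: sq2_ge0.
have [r0 r0P] := wg _ e0; have [N rN] := exists_nat_ge r0.
by exists N => // k /= Nk; apply: r0P; rewrite (le_trans rN)// ler_nat.
Qed.

Lemma normc_cvgZ (c : R[i]) (z_ : nat -> R[i]) z :
  normc (z_ k - z) @[k --> \oo] --> (0 : R) ->
  normc (c * z_ k - c * z) @[k --> \oo] --> (0 : R).
Proof.
move=> zz; suff : normc c * normc (z_ k - z) @[k --> \oo] --> normc c * 0.
  by rewrite mulr0; under eq_fun do rewrite -normcM mulrBr.
by apply: cvgM; [exact: cvg_cst|exact: zz].
Qed.

(** [parseval_box] for the truncations of [f] to balls; both sides are pairings with fixed L^2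
    functions and hence continuous in L^2. *)
Lemma fourier_box f a b : L2 f -> (forall i, a i < b i) ->
  cint (fun xi => fourier f xi * FT 1 (indc (box a b)) xi) =
  C%:C * cint (restr (box a b) f).
Proof.
move=> fL ab; have s2 : (-1 : R) ^+ 2 = 1 by rewrite sqrrN expr1n.
have [FL FP] := fourierP fL.
have bi := cintegrable_indc_box a b; have bL := L2_indc_box a b.
have FbL : L2 (FT 1 (indc (box a b))) by apply: L2_FT => //; rewrite expr1n.
have rL k : L2 (restr (ballRn k%:R) f) by apply: L2_restr => //; exact: measurable_ballRn.
have ri k : cintegrable mu (restr (ballRn k%:R) f) by exact: cintegrable_restr_ball.
have lim1 := cvg_L2_cint_mul (fun k => L2_FT s2 (ri k) (rL k)) FL FbL (cvg_of_radius FP).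
have lim2 := normc_cvgZ C%:C (cvg_L2_cint_mul rL fL bL (sq2_restr_ball_cvg fL)).
apply: (normc_cvg_unique lim1).
apply: cvg_trans lim2; apply: near_eq_cvg; apply: nearW => k.
rewrite (parseval_box (ri k) (rL k) ab); congr (normc (_ - C%:C * _)).
  by congr (_ * _); apply: eq_cint => x; rewrite [RHS]restrE.
by apply: eq_cint => x; rewrite restrE.
Qed.

(** On truncations of [fourier f] the multiplication formula moves the inverse transform onto the
    indicator of the box. In the limit [fourier_box] produces the factor [C], which cancels the
    normalization. *)
Lemma inv_fourier_box f a b : L2 f -> (forall i, a i < b i) ->
  cint (restr (box a b) (inv_fourier (fourier f))) = cint (restr (box a b) f).
Proof.
move=> fL ab; have s2 : (1 : R) ^+ 2 = 1 by rewrite expr1n.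
have [FL _] := fourierP fL; have [gL gP] := inv_fourierP FL.
have bi := cintegrable_indc_box a b; have bL := L2_indc_box a b.
have FbL : L2 (FT 1 (indc (box a b))) by exact: L2_FT.
have rL k : L2 (restr (ballRn k%:R) (fourier f)).
  by apply: L2_restr => //; exact: measurable_ballRn.
have ri k : cintegrable mu (restr (ballRn k%:R) (fourier f)).
  exact: cintegrable_restr_ball.
have lim1 := cvg_L2_cint_mul (fun k => L2Z C^-1%:C (L2_FT s2 (ri k) (rL k))) gL bL
  (cvg_of_radius gP).
have lim2 := normc_cvgZ C^-1%:C (cvg_L2_cint_mul rL FL FbL (sq2_restr_ball_cvg FL)).
rewrite (eq_cint _ (g := fun x => inv_fourier (fourier f) x * indc (box a b) x)); last first.
  by move=> x; rewrite restrE.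
apply: (normc_cvg_unique lim1).
apply: cvg_trans lim2; apply: near_eq_cvg; apply: nearW => k.
rewrite fourier_box// mulrA -rmorphM mulVf ?gt_eqF// rmorph1 mul1r.
congr (normc (_ - _)); rewrite FT_mul// -cintZ; last exact: cintegrableM_FT.
by apply: eq_cint => x; rewrite mulrA.
Qed.

(** The difference of the two sides has integral 0 over every box. As it is only locally integrable,
    [boxes_ae_eq0] is applied inside each of countably many boxes exhausting the space. *)
Lemma fourier_inversion f : L2 f ->
  {ae mu, forall x, inv_fourier (fourier f) x = f x}.
Proof.
move=> fL; have [FL _] := fourierP fL; have [gL _] := inv_fourierP FL.
pose h x := inv_fourier (fourier f) x - f x.
have hL : L2 h by exact: L2B.
have hi a b : cintegrable mu (restr (box a b) h).
  by apply: cintegrable_restr => //; [exact: measurable_box|exact: box_lty].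
have h0 a b : cint (restr (box a b) h) = 0.
  have [ab|/existsNP[i /negP]] := pselect (forall i, a i < b i).
    rewrite (eq_cint _ (g := fun x => restr (box a b) (inv_fourier (fourier f)) x -
       restr (box a b) f x)); last by move=> x; rewrite /restr mulrBr.
    rewrite cintB ?inv_fourier_box ?subrr//.
      by apply: cintegrable_restr => //; [exact: measurable_box|exact: box_lty].
    by apply: cintegrable_restr => //; [exact: measurable_box|exact: box_lty].
  rewrite -leNgt => ba.
  have box0 : box a b = set0.
    apply/seteqP; split => // x /(_ i); rewrite /= in_itv/= => /andP[ax xb].
    by have := lt_le_trans ax (le_trans xb ba); rewrite ltxx.
  rewrite (eq_cint _ (g := fun=> 0)).
    by rewrite /cint /Rintegral /= !integral0.
  by move=> x; rewrite /restr box0 indic0 mul0r.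
(* [P] is the real or imaginary part. A test box meets the large box in a box again, so [P0] covers
   the integrals over test boxes. *)
have main (P : R[i] -> R) :
    (forall D, measurable D -> (mu D < +oo)%E ->
      mu.-integrable setT (EFin \o (fun x => P (restr D h x)))) ->
    (forall a b, \int[mu]_x P (restr (box a b) h x) = 0) -> P 0 = 0 ->
    forall N : nat, {ae mu, forall x, P (restr (box (fun=> - N%:R) (fun=> N%:R)) h x) = 0}.
  move=> Pi P0 P00 N; set BN := box _ _.
  apply: (boxes_ae_eq0 (r := fun x => P (restr BN h x))).
  - by apply: Pi; [exact: measurable_box|exact: box_lty].
  - move=> a b _.
    have [c [d cd]] : boxes (box a b `&` BN).
      by apply: setI_closed_boxes; do 2 eexists.
    rewrite Rintegral_mkcond -[RHS](P0 c d) -cd; apply: eq_Rintegral => x _.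
    rewrite patchE /restr indicI /=; case: ifPn => xab.
      by rewrite [\1_(box a b) x]indicE xab mul1r.
    by rewrite [\1_(box a b) x]indicE (negbTE xab) mul0r mul0r P00.
  - exact: P0.
have mainR := main (@complex.Re R) _ _ _; have mainI := main (@complex.Im R) _ _ _.
have aR N : {ae mu, forall x, complex.Re (restr (box (fun=> - N%:R) (fun=> N%:R)) h x) = 0}.
  apply: mainR => //.
    by move=> D mD Doo; apply: cintegrable_Re; exact: cintegrable_restr.
  by move=> a b; have := h0 a b => /(congr1 (@complex.Re R)).
have aI N : {ae mu, forall x, complex.Im (restr (box (fun=> - N%:R) (fun=> N%:R)) h x) = 0}.
  apply: mainI => //.
    by move=> D mD Doo; apply: cintegrable_Im; exact: cintegrable_restr.
  by move=> a b; have := h0 a b => /(congr1 (@complex.Im R)).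
have /ae_foralln aR' := aR; have /ae_foralln aI' := aI.
apply: filterS2 aR' aI' => x xR xI; apply/eqP; rewrite -subr_eq0 -/(h x).
have [N HN] : exists N : nat, \sum_(j < n) `|tnth x j : R| < N%:R.
  exists (Num.truncn (\sum_(j < n) `|tnth x j : R|)).+1.
  by rewrite Num.Theory.truncnS_gt.
have xN : restr (box (fun=> - N%:R) (fun=> N%:R)) h x = h x.
  rewrite /restr indicE mem_set ?mul1r// => j; rewrite /= in_itv/=.
  have : `|tnth x j : R| < N%:R.
    apply: le_lt_trans HN; rewrite (bigD1 j)//= lerDl.
    by apply: sumr_ge0.
  by rewrite ltr_norml => /andP[-> /ltW ->].
by rewrite eq_complex -xN xR xI !eqxx.
Qed.

End inversion_theorem.

(** * The maximal estimate along the sequence *)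

(** One induction step of the weighted Cauchy-Schwarz inequality: the squared sum of the [d i] is at
    most the sum of the [del i] times the sum of the [d i ^+ 2 / del i]. The case [S = 0] is the
    empty sum. *)
Lemma cauchy_step (R : realFieldType) (x S Q del d : R) :
  0 <= S -> 0 < del -> 0 <= Q -> x ^+ 2 <= S * Q ->
  (x + d) ^+ 2 <= (S + del) * (Q + del^-1 * d ^+ 2).
Proof.
move=> S0 del0 Q0 xSQ; have [S_eq0|S_neq0] := eqVneq S 0.
  have x0 : x = 0.
    by apply/eqP; rewrite -sqrf_eq0 eq_le sqr_ge0 andbT; rewrite S_eq0 mul0r in xSQ.
  by rewrite x0 S_eq0 !add0r mulrDr mulrA divff ?gt_eqF// mul1r lerDr mulr_ge0// ltW.
have {S_neq0}Sp : 0 < S by rewrite lt0r S_neq0.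
have QS : S^-1 * x ^+ 2 <= Q by rewrite ler_pdivrMl.
(* This square bounds the cross term [2 x d] by [S d^2 / del + del x^2 / S]. *)
have h : 0 <= (S * del)^-1 * (S * d - del * x) ^+ 2.
  by rewrite mulr_ge0 ?sqr_ge0// invr_ge0 mulr_ge0// ltW.
have hE : (S * del)^-1 * (S * d - del * x) ^+ 2 =
    S * (del^-1 * d ^+ 2) + del * (S^-1 * x ^+ 2) - 2 * x * d.
  by field; rewrite !gt_eqF.
have dE : del * (del^-1 * d ^+ 2) = d ^+ 2 by rewrite mulrA divff ?gt_eqF// mul1r.
have h2 : del * (S^-1 * x ^+ 2) <= del * Q by rewrite ler_pM2l.
rewrite mulrDl !mulrDr dE sqrrD mulr2n; rewrite hE in h; lra.
Qed.

Section interval_maximal.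
Context d (T : measurableType d) (R : realType).
Variable mu : {measure set T -> \bar R}.
Variables (t : nat -> R) (v : nat -> T -> R[i]) (A B r : R) (I : interval R).
Hypothesis t_dec : forall k, t k.+1 < t k.
Hypothesis mv : forall k, cmeasurable (v k).
Hypothesis vA : forall k, (sq2 mu (v k) <= A%:E)%E.
Hypothesis vB : forall k,
  (sq2 mu (fun x => v k.+1 x - v k x)%R <= (((t k - t k.+1) * B) ^+ 2)%:E)%E.
Hypothesis Ir : lebesgue_measure [set` I] = r%:E.

Let K k := t k \in I.
Let J k := K k && K k.+1.
Let del k := t k - t k.+1.

Let del_gt0 k : 0 < del k. Proof. by rewrite subr_gt0. Qed.

Let t_le i j : (i <= j)%N -> t j <= t i.
Proof.
move=> /subnKC <-; elim: (j - i)%N => [|m IH]; first by rewrite addn0.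
by rewrite addnS (le_trans _ IH)// ltW.
Qed.

Let r_ge0 : 0 <= r.
Proof. by rewrite -lee_fin -Ir. Qed.

Let diam x y : x \in I -> y \in I -> x - y <= r.
Proof.
move=> xI yI; have [xy|yx] := leP x y; first by rewrite (le_trans _ r_ge0)// subr_le0.
rewrite -lee_fin -Ir.
have <- : lebesgue_measure `[y, x]%classic = (x - y)%:E.
  by rewrite lebesgue_measure_itv/= lte_fin yx -EFinB.
apply: le_measure; rewrite ?inE; [exact: measurable_itv|exact: measurable_itv|].
move=> z /=; rewrite in_itv/= => /andP[yz zx].
apply: (@interval_is_interval R I y x) => //.
by rewrite yz zx.
Qed.

Let K_between i j k : (i <= j <= k)%N -> K i -> K k -> K j.
Proof.
move=> /andP[ij jk] Ki Kk; apply: (@interval_is_interval R I (t k) (t i)) => //.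
by rewrite !t_le.
Qed.

(** The counted gaps are disjoint and lie between two points of [I]. The induction carries the two
    points [t p] and [t q]; [q <= m] and monotonicity allow the next gap to be appended. *)
Let del_sum m : \sum_(0 <= i < m | J i) del i <= r.
Proof.
suff : \sum_(0 <= i < m | J i) del i = 0 \/ exists p q, [/\ K p, K q, (q <= m)%N &
    \sum_(0 <= i < m | J i) del i <= t p - t q].
  move=> [-> //|[p [q [Kp Kq _ /le_trans]]]]; apply; exact: diam.
elim: m => [|m IH]; first by left; rewrite big_geq.
rewrite big_mkcond big_nat_recr//= -big_mkcond /=.
case: ifPn => [/andP[Km Km1]|_]; last first.
  rewrite addr0; case: IH => [->|[p [q [Kp Kq qm H]]]]; [by left|right].
  by exists p, q; split => //; exact: leqW.
right; case: IH => [->|[p [q [Kp Kq qm H]]]].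
  by exists m, m.+1; split => //; rewrite add0r.
exists p, m.+1; split => //.
apply: (le_trans (lerD H (lexx _))); rewrite /del.
by have := t_le qm; lra.
Qed.

(** Cauchy-Schwarz for the telescoping sum, with the time gaps as weights: their sum is
    [t p - t k]. *)
Let chain x p k : (p <= k)%N ->
  normc (v k x - v p x) ^+ 2 <=
  (t p - t k) * \sum_(p <= i < k) (del i)^-1 * normc (v i.+1 x - v i x) ^+ 2.
Proof.
move=> /subnKC <-; elim: (k - p)%N => [|m IH].
  by rewrite addn0 !subrr normc0 mul0r expr0n.
rewrite addnS big_nat_recr ?leq_addr//=.
rewrite (_ : v (p + m).+1 x - v p x =
  (v (p + m)%N x - v p x) + (v (p + m).+1 x - v (p + m)%N x)); last first.
  by rewrite [RHS]addrC subrKA.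
rewrite (_ : t p - t (p + m).+1 = (t p - t (p + m)%N) + del (p + m)%N); last first.
  by rewrite /del subrKA.
apply: (@le_trans _ _ ((normc (v (p + m)%N x - v p x) +
    normc (v (p + m).+1 x - v (p + m)%N x)) ^+ 2)).
  by rewrite ler_pXn2r ?nnegrE ?addr_ge0 ?normc_ge0// le_normcD.
apply: cauchy_step => //.
- by rewrite subr_ge0 t_le// leq_addr.
- by apply: sumr_ge0 => i _; rewrite mulr_ge0 ?sqr_ge0// invr_ge0 ltW.
Qed.

(* Within an interval the sequence is controlled by one of its terms and
   by its total variation there, which is summable because [t] is monotone. *)
Lemma interval_maximal : exists W : T -> \bar R,
  [/\ measurable_fun [set: T] W, forall x, (0 <= W x)%E,
      forall k x, t k \in I -> ((normc (v k x) ^+ 2)%:E <= W x)%E &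
      (\int[mu]_x W x <= (2 * A + 2 * (r * B) ^+ 2)%:E)%E].
Proof.
have A0 : 0 <= A by rewrite -lee_fin (le_trans _ (vA 0))// sq2_ge0.
have [[k0 Kk0]|nK] := pselect (exists k, K k); last first.
  exists (fun=> 0%E); split => //.
  - by move=> k x tk; exfalso; apply: nK; exists k.
  - by rewrite integral0 lee_fin; apply: addr_ge0; apply: mulr_ge0 => //; exact: sqr_ge0.
(* The first term in [I] serves as base point: every other term in [I] is reached from it through
   later indices only. *)
have [p Kp p_min] := ex_minnP (ex_intro K k0 Kk0).
pose q i x := if J i then (del i)^-1 * normc (v i.+1 x - v i x) ^+ 2 else 0.
have q0 i x : 0 <= q i x.
  by rewrite /q; case: ifP => // _; rewrite mulr_ge0 ?sqr_ge0// invr_ge0 ltW.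
have mq i : measurable_fun [set: T] (fun x => (q i x)%:E).
  apply/measurable_EFinP; rewrite /q; case: (J i); last exact: measurable_cst.
  apply: measurable_funM; first exact: measurable_cst.
  apply: measurable_funX.
  by apply: measurable_normc; exact: cmeasurableB.
have r20 : 0 <= 2 * r by rewrite mulr_ge0.
(* The factors 2 come from [sqr_normcD] applied to [v p + (v k - v p)], and [r] bounds the factor
   [t p - t k] of [chain]. *)
pose W1 x := (2%:E * (normc (v p x) ^+ 2)%:E)%E.
pose W2 x := ((2 * r)%:E * \sum_(0 <= i <oo) (q i x)%:E)%E.
have mW1 : measurable_fun [set: T] W1.
  by apply: measurable_funeM; exact: emeasurable_sqr_normc.
have ms : measurable_fun [set: T] (fun x => \sum_(0 <= i <oo) (q i x)%:E)%E.
  by apply: ge0_emeasurable_sum => // i x _ _; rewrite lee_fin.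
have mW2 : measurable_fun [set: T] W2 by exact: measurable_funeM.
have s0 x : (0 <= \sum_(0 <= i <oo) (q i x)%:E)%E.
  by apply: nneseries_ge0 => i _ _; rewrite lee_fin.
have W10 x : (0 <= W1 x)%E by rewrite mule_ge0// lee_fin sqr_ge0.
have W20 x : (0 <= W2 x)%E by rewrite mule_ge0.
exists (fun x => W1 x + W2 x)%E; split.
- exact: emeasurable_funD.
- by move=> x; rewrite adde_ge0.
- move=> k x tk; have pk : (p <= k)%N by exact: p_min.
  have := sqr_normcD (v p x) (v k x - v p x); rewrite addrC subrK.
  rewrite -lee_fin => /le_trans; apply.
  rewrite EFinD; apply: leeD; first by rewrite /W1 -EFinM.
  apply: (@le_trans _ _ ((2 * r)%:E * (\sum_(0 <= i < k) q i x)%:E)%E); last first.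
    apply: lee_wpmul2l; first by rewrite lee_fin.
    by rewrite -sumEFin; apply: nneseries_lim_ge => i _; rewrite lee_fin.
  rewrite -EFinM lee_fin -mulrA ler_pM2l//.
  apply: (le_trans (chain x pk)).
  apply: ler_pM.
  + by rewrite subr_ge0 t_le.
  + by apply: sumr_ge0 => i _; rewrite mulr_ge0 ?sqr_ge0// invr_ge0 ltW.
  + exact: diam.
  + have -> : \sum_(0 <= i < k) q i x = \sum_(p <= i < k) q i x + \sum_(0 <= i < p) q i x.
      by rewrite addrC -big_cat_nat.
    rewrite -[leLHS]addr0 lerD//; last by apply: sumr_ge0.
    (* By convexity of [I], all gaps between the indices [p] and [k] are counted by [J]. *)
    rewrite big_nat_cond [leRHS]big_nat_cond; apply: ler_sum => i /andP[/andP[pi ik] _].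
    rewrite /q /J (K_between (i := p) (k := k))//; last by rewrite pi ltnW.
    by rewrite (K_between (i := p) (k := k))// (leq_trans pi).
- rewrite ge0_integralD// [leRHS]EFinD; apply: leeD.
    rewrite /W1 ge0_integralZl_EFin//; last 2 first.
    + by move=> x _; rewrite lee_fin sqr_ge0.
    + exact: emeasurable_sqr_normc.
    by rewrite EFinM; apply: lee_wpmul2l => //; exact: vA.
  rewrite /W2 ge0_integralZl_EFin// integral_nneseries//; last by move=> i x _; rewrite lee_fin.
  rewrite (_ : 2 * (r * B) ^+ 2 = 2 * r * (r * B ^+ 2)); last by ring.
  rewrite [leRHS]EFinM; apply: lee_wpmul2l; first by rewrite lee_fin.
  apply: lime_le.
    by apply: is_cvg_nneseries => i _ _; apply: integral_ge0 => x _; rewrite lee_fin.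
  apply: nearW => m.
  (* Dividing [(del i * B) ^+ 2] by [del i] leaves one power of the gap, and the gaps sum to at most
     [r]. *)
  apply: (@le_trans _ _ (\sum_(0 <= i < m) (if J i then del i * B ^+ 2 else 0)%:E)%E).
    apply: lee_sum => i _; rewrite /q; case: (J i); last by rewrite integral0.
    under eq_integral do rewrite EFinM.
    rewrite ge0_integralZl_EFin//; last 3 first.
    + by move=> x _; rewrite lee_fin sqr_ge0.
    + by apply: emeasurable_sqr_normc; exact: cmeasurableB.
    + by rewrite invr_ge0 ltW.
    apply: (@le_trans _ _ ((del i)^-1%:E * ((del i * B) ^+ 2)%:E)%E).
      by apply: lee_wpmul2l; [rewrite lee_fin invr_ge0 ltW|exact: vB].
    by rewrite -EFinM lee_fin exprMn expr2 !mulrA mulVf ?gt_eqF// mul1r.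
  rewrite sumEFin lee_fin -big_mkcond /= -mulr_suml ler_wpM2r ?sqr_ge0//.
Qed.

End interval_maximal.

Section covered_maximal.
Context d (T : measurableType d) (R : realType).
Variable mu : {measure set T -> \bar R}.

(** The maximum over the covering intervals is dominated by the sum, which costs the factor [N]. *)
Lemma covered_maximal (t : nat -> R) (v : nat -> T -> R[i]) (A B r : R) (N : nat) :
  (forall k, t k.+1 < t k) -> covered (range t) r N ->
  (forall k, cmeasurable (v k)) -> (forall k, (sq2 mu (v k) <= A%:E)%E) ->
  (forall k, (sq2 mu (fun x => v k.+1 x - v k x)%R <=
     (((t k - t k.+1) * B) ^+ 2)%:E)%E) ->
  exists W : T -> \bar R,
  [/\ measurable_fun [set: T] W, forall x, (0 <= W x)%E,
      forall k x, ((normc (v k x) ^+ 2)%:E <= W x)%E &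
      (\int[mu]_x W x <= (N%:R * (2 * A + 2 * (r * B) ^+ 2))%:E)%E].
Proof.
move=> t_dec [I [Ir tI]] mv vA vB.
have /choice[W WP] l := @interval_maximal _ _ _ mu t v A B r (I l) t_dec mv vA vB (Ir l).
have mW l : measurable_fun [set: T] (W l) by case: (WP l).
have W0 l x : (0 <= W l x)%E by case: (WP l).
exists (fun x => \sum_(l < N) W l x)%E; split.
- exact: emeasurable_sum.
- by move=> x; exact: sume_ge0.
- move=> k x; have [l _ tl] := tI (t k) (ex_intro2 _ _ k Logic.I erefl).
  have [_ _ H _] := WP l; apply: le_trans (H k x tl) _.
  by rewrite (bigD1 l)//= leeDl// sume_ge0.
- rewrite ge0_integral_sum//.
  apply: (@le_trans _ _ (\sum_(l < N) (2 * A + 2 * (r * B) ^+ 2)%:E)%E).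
    by apply: lee_sum => l _; case: (WP l).
  by rewrite sumEFin lee_fin big_const_ord iter_addr_0 -[leLHS]mulr_natl.
Qed.
End covered_maximal.

Lemma normr_sin_le (R : realType) (x : R) : `|sin x| <= `|x|.
Proof.
have pos (y : R) : 0 < y -> `|sin y| <= y.
  move=> y0; have dsin z : z \in `]0, y[ -> is_derive z 1 (@sin R) (cos z).
    by move=> _; exact: is_derive_sin.
  have csin : {within `[0, y], continuous (@sin R)}.
    by apply: continuous_subspaceT => z; exact: continuous_sin.
  have [z _] := MVT y0 dsin csin; rewrite sin0 !subr0 => ->.
  by rewrite normrM (gtr0_norm y0) ler_piMl ?cos_max// ltW.
have [x0|x0|->] := ltgtP x 0; last by rewrite sin0.
- by rewrite (ltr0_norm x0) -normrN -sinN; apply: pos; rewrite oppr_gt0.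
- by rewrite (gtr0_norm x0) pos.
Qed.

(** With [w = x - y], the squared modulus is [2 - 2 cos w = 4 sin(w/2)^2], at most [w^2]. *)
Lemma normc_expiB (R : realType) (x y : R) : normc (expi x - expi y) <= `|x - y|.
Proof.
rewrite -(@ler_pXn2r _ 2)// ?nnegrE ?normc_ge0//.
rewrite (_ : expi x = expi y * expi (x - y)); last by rewrite -expiD addrC subrK.
rewrite -[X in _ - X]mulr1 -mulrBr normcM normc_expi mul1r.
set w := x - y; rewrite sqr_normcE /expi !ReImE /=.
have h1 := cos2Dsin2 w.
have h2 : cos w = 1 - 2 * sin (w / 2) ^+ 2.
  by rewrite {1}(splitr w) cosD -!expr2 cos2sin2; ring.
have h3 : sin (w / 2) ^+ 2 <= (w / 2) ^+ 2.
  rewrite -(real_normK (num_real (sin _))) -(real_normK (num_real (w / 2))).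
  by rewrite ler_pXn2r ?nnegrE// normr_sin_le.
rewrite oppr0 addr0 real_normK ?num_real//.
rewrite exprMn exprVn in h3; lra.
Qed.

Lemma cvg_complex (R : realType) (u : nat -> R[i]) (z : R[i]) :
  (forall e : R, 0 < e -> \forall k \near \oo, normc (u k - z) < e) ->
  (u k : R[i]^o) @[k --> \oo] --> (z : R[i]^o).
Proof.
move=> uz; apply/cvgrPdist_lt => e e0.
(* A positive element of [R[i]] is real. *)
have [r re r0] : exists2 r : R, e = r%:C & 0 < r.
  case: e e0 => p q; rewrite ltcE /= => /andP[/eqP -> p0].
  by exists p.
apply: filterS (uz r r0) => k uk.
rewrite re normc_def ltcR -normcE_Re_Im normcB//.
Qed.

(** * Frequency shells and their energy *)

Section frequency_shells.
Context (R : realType) (n : nat).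
Local Notation T := (n.-tuple (measurableTypeR R)).
Local Notation mu := (lebesgueRn R n).
Local Notation sq2 := (sq2 mu).
Local Notation L2 := (L2 mu).
Implicit Types (x xi : T) (a s e tau : R) (g F : T -> R[i]) (m : nat).

Let C : R := (2 * pi) ^+ n.

Let C_gt0 : 0 < C.
Proof. by rewrite exprn_gt0// mulr_gt0// pi_gt0. Qed.

(* Chosen so that [|xi|^a = 2^m] on the sphere of radius [rad a m]. *)
Definition rad a m : R := 2 `^ (m%:R / a).

Definition shell a m : set T := ballRn (rad a m.+1) `\` ballRn (rad a m).

Definition modulate a tau F : T -> R[i] :=
  fun xi => expi (tau * normRn xi `^ a) * F xi.

Definition inv_FT g : T -> R[i] := fun x => C^-1%:C * FT 1 g x.

Lemma rad_powR a m : 0 < a -> rad a m `^ a = 2 ^+ m.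
Proof. by move=> a0; rewrite /rad -powRrM divfK ?gt_eqF// powR_mulrn. Qed.

Lemma le_rad a m k : 0 < a -> (m <= k)%N -> rad a m <= rad a k.
Proof.
move=> a0 mk; rewrite /rad ler_powR ?ler1n// ler_pM2r ?invr_gt0//.
by rewrite ler_nat.
Qed.

Lemma rad_unbounded a (r : R) : 0 < a -> exists N, forall m, (N <= m)%N -> r <= rad a m.
Proof.
move=> a0; have [r0|r0] := leP r 0.
  by exists 0%N => m _; rewrite (le_trans r0)// powR_ge0.
have [N rN] := exists_nat_ge (r `^ a); exists N => m Nm.
rewrite leNgt; apply/negP => mr.
have := gt0_ltr_powR a0; move=> /(_ (rad a m) r); rewrite !nnegrE powR_ge0 (ltW r0).
move=> /(_ isT isT mr); rewrite rad_powR// ltNge => /negP; apply.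
apply: (le_trans rN); apply: (@le_trans _ _ m%:R); first by rewrite ler_nat.
by rewrite -natrX ler_nat ltnW// ltn_expl.
Qed.

Lemma ballRn_powR_le a m xi : 0 < a -> ballRn (rad a m) xi -> normRn xi `^ a <= 2 ^+ m.
Proof.
move=> a0 xim; rewrite -(rad_powR m a0) ge0_ler_powR ?nnegrE ?normRn_ge0 ?powR_ge0//.
exact: ltW.
Qed.

Lemma indic_shell a m xi : 0 < a ->
  \1_(shell a m) xi = \1_(ballRn (rad a m.+1)) xi - \1_(ballRn (rad a m)) xi :> R.
Proof.
move=> a0; rewrite !indicE in_setD.
have [/set_mem xm|_] := boolP (xi \in ballRn (rad a m)); last by rewrite andbT subr0.
rewrite mem_set ?subrr//=; apply: (le_trans xm); exact: le_rad.
Qed.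

Lemma measurable_shell a m : measurable (shell a m).
Proof. by apply: measurableD; exact: measurable_ballRn. Qed.

Lemma shell_lty a m : (mu (shell a m) < +oo)%E.
Proof.
apply: le_lt_trans (ballRn_lty n (rad a m.+1)); apply: le_measure.
- by rewrite inE; exact: measurable_shell.
- by rewrite inE; exact: measurable_ballRn.
- exact: subDsetl.
Qed.

Lemma normc_modulate a tau F xi : normc (modulate a tau F xi) = normc (F xi).
Proof. by rewrite normcM normc_expi mul1r. Qed.

Lemma cmeasurable_modulate a tau F : cmeasurable F -> cmeasurable (modulate a tau F).
Proof.
move=> mF; apply: cmeasurableM => //; apply: cmeasurable_expi.
apply: measurable_funM; first exact: measurable_cst.
exact: (measurableT_comp (measurable_powR a) (@measurable_normRn R n)).
Qed.

Lemma L2_modulate a tau F : L2 F -> L2 (modulate a tau F).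
Proof.
move=> [mF Foo]; apply: (L2_le _ (conj mF Foo)); first exact: cmeasurable_modulate.
by move=> xi; rewrite normc_modulate.
Qed.

Lemma modulate0 a F : modulate a 0 F = F.
Proof. by apply/funext => xi; rewrite /modulate mul0r expi0 mul1r. Qed.

Lemma sq2_inv_FT g : cintegrable mu g -> (sq2 (inv_FT g) <= C^-1%:E * sq2 g)%E.
Proof.
move=> gi; have [mg _] := gi.
rewrite /inv_FT sq2Z; last exact: cmeasurable_FT.
rewrite normc_real ger0_norm ?invr_ge0 ?(ltW C_gt0)//.
apply: (@le_trans _ _ ((C^-1 ^+ 2)%:E * (C%:E * sq2 g))%E).
  apply: lee_wpmul2l; first by rewrite lee_fin sqr_ge0.
  by apply: plancherel_le => //; rewrite expr1n.
by rewrite muleA -EFinM expr2 -mulrA mulVf ?gt_eqF// mulr1.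
Qed.

Lemma inv_FTB g h x : cintegrable mu g -> cintegrable mu h ->
  inv_FT (fun xi => g xi - h xi) x = inv_FT g x - inv_FT h x.
Proof. by move=> gi hi; rewrite /inv_FT FTB// mulrBr. Qed.

Lemma cmeasurable_inv_FT g : cmeasurable g -> cmeasurable (inv_FT g).
Proof.
move=> mg; apply: cmeasurableM; first exact: cmeasurable_cst.
exact: cmeasurable_FT.
Qed.

Lemma sq2_piece a m tau F : L2 F ->
  (sq2 (inv_FT (restr (shell a m) (modulate a tau F))) <=
   C^-1%:E * sq2 (restr (shell a m) F))%E.
Proof.
move=> FL; have GL := L2_modulate a tau FL; have mS := measurable_shell a m.
apply: le_trans (sq2_inv_FT _) _; first exact: cintegrable_restr (shell_lty a m) GL.
rewrite le_eqVlt; apply/orP; left; apply/eqP; congr (_ * _)%E.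
by apply: eq_integral => xi _; rewrite !normc_restr normc_modulate.
Qed.

(** On the shell [|xi|^a <= 2^(m+1)], so by [normc_expiB] the multipliers at two times differ by at
    most [|tau - tau'| 2^(m+1)]. *)
Lemma sq2_pieceB a m tau tau' F : 0 < a -> L2 F ->
  (sq2 (fun x => inv_FT (restr (shell a m) (modulate a tau F)) x -
                 inv_FT (restr (shell a m) (modulate a tau' F)) x)%R <=
   (((tau - tau') * 2 ^+ m.+1) ^+ 2)%:E * (C^-1%:E * sq2 (restr (shell a m) F)))%E.
Proof.
move=> a0 FL; have GL t := L2_modulate a t FL; have mS := measurable_shell a m.
have Gi t := cintegrable_restr mS (shell_lty a m) (GL t).
have [mF _] := FL.
rewrite (_ : (fun x => _) = inv_FT (fun xi => restr (shell a m) (modulate a tau F) xi -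
   restr (shell a m) (modulate a tau' F) xi)); last first.
  by apply/funext => x; rewrite inv_FTB.
apply: le_trans (sq2_inv_FT _) _; first exact: cintegrableB.
rewrite muleCA; apply: lee_wpmul2l; first by rewrite lee_fin invr_ge0 ltW.
set c := (tau - tau') * 2 ^+ m.+1.
have -> : (c ^+ 2 = normc c%:C ^+ 2) by rewrite normc_real real_normK ?num_real.
rewrite -sq2Z; last exact: cmeasurable_restr.
apply: le_sq2.
- by apply: cmeasurableB; [case: (Gi tau)|case: (Gi tau')].
- by apply: cmeasurableM; [exact: cmeasurable_cst|exact: cmeasurable_restr].
move=> xi; rewrite [leRHS]normcM normc_restr (normc_real c) mulrCA.
rewrite /restr -mulrBr normcM (normc_real (\1_(shell a m) xi)) ger0_norm// indicE.
case: (boolP (xi \in shell a m)) => [/set_mem [xm _]|_]; last by rewrite !mul0r.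
rewrite !mul1r /modulate -mulrBl normcM ler_wpM2r ?normc_ge0//.
apply: le_trans (normc_expiB _ _) _; rewrite -mulrBl normrM normrM ler_wpM2l//.
rewrite (ger0_norm (powR_ge0 _ _)) ger0_norm ?exprn_ge0//.
exact: ballRn_powR_le.
Qed.

Lemma sum_indic_shell a M xi : 0 < a ->
  \sum_(0 <= m < M) \1_(shell a m) xi <= 1 :> R.
Proof.
move=> a0; rewrite (eq_bigr (fun m => \1_(ballRn (rad a m.+1)) xi - \1_(ballRn (rad a m)) xi));
  last by move=> m _; exact: indic_shell.
rewrite telescope_sumr// !indicE lerBlDr.
Qed.

(** On the [m]-th shell [|xi| > 2^(m/a)], so [2^(2ms/a)] is at most [(1 + |xi|^2)^s]; the indicators
    of the shells sum to at most 1. *)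
Lemma energy_lty a s F : 0 < a -> 0 < s -> cmeasurable F ->
  (\int[mu]_xi ((1 + normRn xi ^+ 2) `^ s * normc (F xi) ^+ 2)%:E < +oo)%E ->
  (\sum_(0 <= m <oo) (2 `^ (- (2 * m%:R * s / a)))^-1%:E * sq2 (restr (shell a m) F)
    < +oo)%E.
Proof.
move=> a0 s0 mF; apply: le_lt_trans.
pose H xi := (1 + normRn xi ^+ 2) `^ s * normc (F xi) ^+ 2.
have mN := @measurable_normRn R n.
have mH : measurable_fun [set: T] H.
  apply: measurable_funM; last by apply: measurable_funX; exact: measurable_normc.
  have m1 : measurable_fun [set: T] (fun xi : T => 1 + normRn xi ^+ 2 : R).
    by apply: measurable_funD; [exact: measurable_cst|exact: measurable_funX].
  exact: (measurableT_comp (measurable_powR s) m1).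
have H0 xi : 0 <= H xi by rewrite mulr_ge0 ?powR_ge0 ?sqr_ge0.
have mS m : measurable_fun [set: T] (fun xi => \1_(shell a m) xi : R).
  by apply: measurable_indic; exact: measurable_shell.
apply: (@le_trans _ _ (\int[mu]_xi \sum_(0 <= m <oo) (\1_(shell a m) xi * H xi)%:E)%E).
  rewrite integral_nneseries//; last 2 first.
  - by move=> m; apply/measurable_EFinP; exact: measurable_funM.
  - by move=> m xi _; rewrite lee_fin mulr_ge0.
  apply: lee_nneseries => [m _ _|m _].
    by rewrite mule_ge0 ?sq2_ge0// lee_fin invr_ge0 powR_ge0.
  have mrS : cmeasurable (restr (shell a m) F).
    by apply: cmeasurable_restr => //; exact: measurable_shell.
  rewrite /sq2 -ge0_integralZl_EFin//; last 2 first.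
  - by move=> xi _; rewrite lee_fin sqr_ge0.
  - exact: emeasurable_sqr_normc.
  apply: ge0_le_integral => //.
  - by move=> xi _; rewrite mule_ge0// lee_fin ?sqr_ge0// invr_ge0 powR_ge0.
  - by apply: measurable_funeM; exact: emeasurable_sqr_normc.
  - by apply/measurable_EFinP; exact: measurable_funM.
  move=> xi _; rewrite -EFinM lee_fin normc_restr exprMn indicE.
  case: (boolP (xi \in shell a m)) => [/set_mem [_ xm]|_]; last first.
    by rewrite expr0n /= !mul0r mulr0.
  rewrite expr1n !mul1r /H ler_wpM2r ?sqr_ge0//.
  have xm' : rad a m < normRn xi by rewrite ltNge; exact/negP.
  rewrite -powRN opprK (_ : 2 * m%:R * s / a = m%:R / a * 2%:R * s); last by ring.
  rewrite powRrM (powRrM 2 (m%:R / a)) -/(rad a m) powR_mulrn ?powR_ge0//.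
  apply: ge0_ler_powR.
  - exact: ltW.
  - by rewrite nnegrE sqr_ge0.
  - by rewrite nnegrE addr_ge0 ?sqr_ge0.
  - apply: (@le_trans _ _ (normRn xi ^+ 2)); last by rewrite lerDr.
    by rewrite ler_pXn2r ?nnegrE ?normRn_ge0 ?powR_ge0// ltW.
apply: ge0_le_integral => //.
- by move=> xi _; apply: nneseries_ge0 => m _ _; rewrite lee_fin mulr_ge0.
- apply: ge0_emeasurable_sum => [m xi _ _|m _]; first by rewrite lee_fin mulr_ge0.
  by apply/measurable_EFinP; exact: measurable_funM.
- exact/measurable_EFinP.
move=> xi _; apply: lime_le.
  by apply: is_cvg_nneseries => m _ _; rewrite lee_fin mulr_ge0.
apply: nearW => M; rewrite sumEFin lee_fin -mulr_suml -/(H xi) ler_piMl//.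
exact: sum_indic_shell.
Qed.

End frequency_shells.

(** * Almost everywhere convergence *)

Lemma covering_number_attained (R : realType) (E : set R) (r : R) :
  (covering_number E r < +oo)%E ->
  exists2 N, covered E r N & ((N%:R)%:E <= covering_number E r)%E.
Proof.
move=> Eoo.
have [N0 N0c] : exists N, covered E r N.
  apply: contrapT => nN; move: Eoo; rewrite /covering_number.
  rewrite (_ : [set _ | N in _] = set0) ?ereal_inf0 ?ltxx//.
  by apply/seteqP; split => // y [N cN _]; apply: nN; exists N.
have [N /asboolP Nc Nmin] := ex_minnP (ex_intro (fun N => `[< covered E r N >]) N0 (asboolT N0c)).
exists N => //; apply: le_ereal_inf_tmp => _ [M Mc <-].
by rewrite lee_fin ler_nat; apply: Nmin; exact/asboolP.
Qed.

Lemma bounded_series_tail (R : realType) (b : nat -> R) (M : R) :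
  (forall j, 0 <= b j) -> (forall k, \sum_(0 <= j < k) b j <= M) ->
  forall e, 0 < e -> exists J, forall k, (J <= k)%N -> \sum_(J <= j < k) b j <= e.
Proof.
move=> b0 bM e e0.
have ndb : nondecreasing_seq (series b) by apply: nondecreasing_series => *; exact: b0.
have cb : cvgn (series b).
  by apply: (bounded_series_cvg (b := b) (M := M)) => // j; rewrite ger0_norm.
have /cvgrPdist_le /(_ e e0)[J _ HJ] := cb.
exists J => k Jk; have := HJ J (leqnn _).
have := nondecreasing_cvgn_le ndb cb k.
have := nondecreasing_cvgn_le ndb cb J.
rewrite /series /= (big_cat_nat (n := J) (leq0n _) Jk) /= => h1 h2.
rewrite ger0_norm ?subr_ge0//; lra.
Qed.

Lemma normc_triangle (R : rcfType) (y x z : R[i]) :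
  normc (x - z) <= normc (x - y) + normc (y - z).
Proof. by apply: le_trans (le_normcD _ _); rewrite addrA subrK. Qed.

(* Interchange of the limits in [m] and [k] by domination of the increments; the
   limits in [m] are only needed along subsequences. *)
Lemma dominated_interchange (R : realType) (p : nat -> nat -> R[i])
    (p0 u : nat -> R[i]) (z : R[i]) (b : nat -> R) (M : R) :
  (forall m, 0 <= b m) -> (forall k, \sum_(0 <= m < k) b m <= M) ->
  (forall m k, normc (p m.+1 k - p m k) <= b m) ->
  (forall m e, 0 < e -> \forall k \near \oo, normc (p m k - p0 m) < e) ->
  (forall k e N, 0 < e -> exists2 m, (N <= m)%N & normc (p m k - u k) < e) ->
  (forall e N, 0 < e -> exists2 m, (N <= m)%N & normc (p0 m - z) < e) ->
  (u k : R[i]^o) @[k --> \oo] --> (z : R[i]^o).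
Proof.
move=> b0 bM pb pp0 pu p0z; apply: cvg_complex => e e0.
have e8 : 0 < e / 8 by rewrite divr_gt0.
have [J HJ] := bounded_series_tail b0 bM e8.
have tail m k : (J <= m)%N -> normc (p m k - p J k) <= e / 8.
  move=> Jm; apply: le_trans (HJ m Jm).
  rewrite -(subnKC Jm); elim: (m - J)%N => [|d IH].
    by rewrite addn0 subrr normc0 big_geq.
  rewrite addnS big_nat_recr ?leq_addr//= addrC.
  by apply: le_trans (normc_triangle (p (J + d)%N k) _ _) _; exact: lerD.
have [m Jm mz] := p0z _ J e8.
(* Four steps of [e / 8]: from [p0 J] to [p J k], [p m k], [p0 m] and [z], with one [k] suitable for
   both [J] and [m]. *)
have J0z : normc (p0 J - z) < e / 2.
  have [k [h1 h2]] : exists k, normc (p J k - p0 J) < e / 8 /\ normc (p m k - p0 m) < e / 8.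
    have /filter_ex[k [? ?]] : nbhs \oo ([set k | normc (p J k - p0 J) < e / 8] `&`
      [set k | normc (p m k - p0 m) < e / 8]) by apply: filterI; exact: pp0.
    by exists k.
  have := normc_triangle (p J k) (p0 J) z; have := normc_triangle (p m k) (p J k) z.
  have := normc_triangle (p0 m) (p m k) z; have := tail m k Jm.
  rewrite (normcB (p m k) (p J k)) (normcB (p0 J) (p J k)); lra.
(* The index [l] depends on [k], but the bound of [tail] between [J] and [l] does not. *)
apply: filterS (pp0 J _ e8) => k Jk; have [l Jl lu] := pu k _ J e8.
have := normc_triangle (p l k) (u k) z; have := normc_triangle (p J k) (p l k) z.
have := normc_triangle (p0 J) (p J k) z; have := tail l k Jl.
rewrite (normcB (u k) (p l k)); lra.
Qed.

Lemma inv_fourier_radius (R : realType) (n : nat) (a : R)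
    (G : n.-tuple (measurableTypeR R) -> R[i]) :
  0 < a -> L2 (lebesgueRn R n) G ->
  sq2 (lebesgueRn R n) (fun x => inv_FT (restr (ballRn (rad a m)) G) x - inv_fourier G x)
    @[m --> \oo] --> 0%E.
Proof.
move=> a0 GL; have [_ GP] := inv_fourierP GL.
apply: le_cvge0 => [m|e e0]; first exact: sq2_ge0.
have [r0 r0P] := GP e e0; have [N NP] := rad_unbounded r0 a0.
by exists N => // m /= Nm; apply: r0P; exact: NP.
Qed.

(** * Convergence of the propagator along the sequence *)

Section pointwise_convergence.
Context (R : realType) (n : nat) (a s : R) (t : nat -> R).
Context (f : n.-tuple (measurableTypeR R) -> R[i]).
Local Notation T := (n.-tuple (measurableTypeR R)).
Local Notation mu := (lebesgueRn R n).
Hypothesis a0 : 0 < a.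
Hypothesis s0 : 0 < s.
Hypothesis t_dec : forall k : nat, t k.+1 < t k.
Hypothesis t_gt0 : forall k : nat, 0 < t k.
Hypothesis t_cvg0 : t k @[k --> \oo] --> 0.
Hypothesis E_lty : (\sum_(0 <= m <oo)
     covering_number (range t) (2 ^- m) * (2 `^ (- (2 * m%:R * s / a)))%:E
     < +oo)%E.
Hypothesis fH : inH s f.

Let C : R := (2 * pi) ^+ n.

Let C_gt0 : 0 < C.
Proof. by rewrite exprn_gt0// mulr_gt0// pi_gt0. Qed.

Let F := fourier f.

Let fL : L2 mu f. Proof. by have [[m1 m2 oo] _] := fH; split. Qed.

Let FL : L2 mu F. Proof. by have [] := fourierP fL. Qed.

(** An absolutely convergent integral over [|xi|^a <= 2^m], hence meaningful at every point;
    [propagator a tau f] is its limit in L^2. *)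
Let part m tau := inv_FT (restr (ballRn (rad a m)) (modulate a tau F)).

Let piece m tau := inv_FT (restr (shell a m) (modulate a tau F)).

Let pieceE m tau x : part m.+1 tau x - part m tau x = piece m tau x.
Proof.
have GL := L2_modulate a tau FL.
rewrite /part /piece -inv_FTB; [|exact: cintegrable_restr_ball|exact: cintegrable_restr_ball].
congr (inv_FT _ x); apply/funext => xi.
by rewrite /restr -mulrBl -rmorphB -indic_shell.
Qed.

Let mpiece m tau : cmeasurable (piece m tau).
Proof.
apply: cmeasurable_inv_FT; apply: cmeasurable_restr; first exact: measurable_shell.
by apply: cmeasurable_modulate; case: FL.
Qed.

Let mpart m tau : cmeasurable (part m tau).
Proof.
apply: cmeasurable_inv_FT; apply: cmeasurable_restr; first exact: measurable_ballRn.
by apply: cmeasurable_modulate; case: FL.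
Qed.

Let weight0 m : R := 2 `^ (- (2 * m%:R * s / a)).

Let weight0_gt0 m : 0 < weight0 m. Proof. by rewrite powR_gt0. Qed.

(** [ae_weighted_summable] with the weights [c m], summable by the covering hypothesis, and [W m]
    dominating the squares of the pieces at all times [t k]. *)
Let piece_dominated : {ae mu, forall x, exists (b : nat -> R) (M : R),
  [/\ forall m, 0 <= b m, forall k, \sum_(0 <= m < k) b m <= M &
      forall m k, normc (piece m (t k) x) <= b m]}.
Proof.
have cov_ge0 m : (0 <= covering_number (range t) (2 ^- m))%E.
  by apply: le_ereal_inf_tmp => _ [N _ <-]; rewrite lee_fin.
have term_ge0 m : (0 <= covering_number (range t) (2 ^- m) * (weight0 m)%:E)%E.
  by rewrite mule_ge0// lee_fin ltW.
have /choice[N NP] m : exists N, covered (range t) (2 ^- m) N /\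
    ((N%:R)%:E <= covering_number (range t) (2 ^- m))%E.
  have [|N] := @covering_number_attained R (range t) (2 ^- m); last by exists N.
  (* An infinite covering number times a positive weight would make the whole series infinite. *)
  rewrite ltNge leye_eq; apply/negP => /eqP covy.
  have : (covering_number (range t) (2 ^- m) * (weight0 m)%:E <=
     \sum_(0 <= m <oo) covering_number (range t) (2 ^- m) * (weight0 m)%:E)%E.
    apply: le_trans (nneseries_lim_ge m.+1 _); last by [].
    by rewrite big_nat_recr//= leeDr// sume_ge0.
  by rewrite covy gt0_mulye ?lte_fin// leNgt E_lty.
(* The covering is nonempty since it contains [t 0]; this makes [c m] invertible. *)
have N_gt0 m : (0 < N m)%N.
  have [[I [_ tI]] _] := NP m.
  by have [l _ _] := tI (t 0%N) (ex_intro2 _ _ 0%N Logic.I erefl); case: (N m) l => // -[].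
pose c m : R := (N m)%:R * weight0 m.
have c0 m : 0 < c m by rewrite mulr_gt0 ?ltr0n.
have coo : (\sum_(0 <= m <oo) (c m)%:E < +oo)%E.
  apply: le_lt_trans E_lty; apply: lee_nneseries => [m _ _|m _].
    by rewrite lee_fin ltW.
  by rewrite EFinM; apply: lee_wpmul2r; [rewrite lee_fin ltW|case: (NP m)].
have shL m : L2 mu (restr (shell a m) F) by apply: L2_restr => //; exact: measurable_shell.
have /choice[A AP] m : exists A : R, 0 <= A /\ sq2 mu (restr (shell a m) F) = A%:E.
  by have [A A0 AE] := L2_fin (shL m); exists A.
have A0 m : 0 <= A m by case: (AP m).
have CA0 m : 0 <= C^-1 * A m by rewrite mulr_ge0// invr_ge0 ltW.
have vA m k : (sq2 mu (piece m (t k)) <= (C^-1 * A m)%:E)%E.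
  by rewrite EFinM -(proj2 (AP m)); exact: sq2_piece.
have vB m k : (sq2 mu (fun x => piece m (t k.+1) x - piece m (t k) x)%R <=
    (((t k - t k.+1) * (Num.sqrt (C^-1 * A m) * 2 ^+ m.+1)) ^+ 2)%:E)%E.
  apply: le_trans (sq2_pieceB _ _ _ a0 FL) _.
  rewrite (proj2 (AP m)) -!EFinM lee_fin le_eqVlt; apply/orP; left; apply/eqP.
  rewrite -/C !exprMn sqr_sqrtr//; move: (C^-1 * A m) (2 ^+ m.+1) => y z; ring.
have /choice[W WP] m : exists W : T -> \bar R,
  [/\ measurable_fun [set: T] W, forall x, (0 <= W x)%E,
      forall k x, ((normc (piece m (t k) x) ^+ 2)%:E <= W x)%E &
      (\int[mu]_x W x <= ((N m)%:R * (10 * (C^-1 * A m)))%:E)%E].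
  have [W [mW W0 WP Woo]] := @covered_maximal _ _ _ mu t (fun k => piece m (t k))
    (C^-1 * A m) (Num.sqrt (C^-1 * A m) * 2 ^+ m.+1) (2 ^- m) (N m) t_dec (proj1 (NP m))
    (fun k => mpiece m (t k))
    (vA m) (vB m).
  exists W; split => //; apply: (le_trans Woo); rewrite lee_fin ler_wpM2l//.
  (* Interval length times speed is 2 on every shell, so the constant is [2 + 2 * 4 = 10]. *)
  have -> : (2 ^- m * (Num.sqrt (C^-1 * A m) * 2 ^+ m.+1)) ^+ 2 = 4 * (C^-1 * A m).
    rewrite (exprS 2 m) !exprMn sqr_sqrtr// exprVn.
    have : (2 ^+ m : R) != 0 by rewrite gt_eqF ?exprn_gt0.
    by move: (C^-1 * A m) (2 ^+ m) => y z z0; field; rewrite z0.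
  by lra.
(* The factor [N m] in [c m] cancels the one in the bound for [W m], and what remains is the series
   of [energy_lty]. *)
have sumW : (\sum_(0 <= m <oo) (c m)^-1%:E * \int[mu]_x W m x < +oo)%E.
  have mF : cmeasurable F by case: FL.
  have energy := energy_lty a0 s0 mF (proj2 fH).
  have CC : (0 <= (10 * C^-1 : R)%:E)%E by rewrite lee_fin mulr_ge0// invr_ge0 ltW.
  have : ((10 * C^-1)%:E * \sum_(0 <= m <oo)
    (weight0 m)^-1%:E * sq2 mu (restr (shell a m) F) < +oo)%E by rewrite lte_mul_pinfty.
  apply: le_lt_trans; rewrite -nneseriesZl//; last first.
    by move=> m _; rewrite mule_ge0 ?sq2_ge0// lee_fin invr_ge0 ltW.
  apply: lee_nneseries => [m _ _|m _].
    rewrite mule_ge0//; first by rewrite lee_fin invr_ge0 ltW.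
    by apply: integral_ge0 => x _; case: (WP m).
  have [_ _ _ Wm] := WP m; rewrite (proj2 (AP m)).
  apply: (@le_trans _ _ ((c m)^-1%:E * ((N m)%:R * (10 * (C^-1 * A m)))%:E)%E).
    by apply: lee_wpmul2l; [rewrite lee_fin invr_ge0 ltW|].
  rewrite -!EFinM lee_fin /c le_eqVlt; apply/orP; left; apply/eqP.
  by field; rewrite !gt_eqF ?ltr0n.
have := ae_weighted_summable c0 coo (fun m => let: And4 h _ _ _ := WP m in h)
  (fun m => let: And4 _ h _ _ := WP m in h) sumW.
apply: filterS => x [b [M [b0 bM bW]]]; exists b, M; split => // m k.
by apply: bW; case: (WP m).
Qed.

(** On the ball the multiplier at time [tau] differs from 1 by at most [tau 2^J], and [F] is
    integrable there, being in L^2 on a set of finite measure. *)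
Let part_cvg J x e : 0 < e ->
  \forall k \near \oo, normc (part J (t k) x - part J 0 x) < e.
Proof.
move=> e0; pose g tau := restr (ballRn (rad a J)) (modulate a tau F).
have gi tau : cintegrable mu (g tau).
  by apply: cintegrable_restr_ball; exact: L2_modulate.
have F0i : cintegrable mu (restr (ballRn (rad a J)) F).
  exact: cintegrable_restr_ball.
have [K K0 KE] : exists2 K : R, 0 <= K &
    (\int[mu]_xi (normc (restr (ballRn (rad a J)) F xi))%:E = K%:E)%E.
  exists (fine (\int[mu]_xi (normc (restr (ballRn (rad a J)) F xi))%:E)).
    by apply: fine_ge0; apply: integral_ge0 => xi _; rewrite lee_fin normc_ge0.
  rewrite fineK// ge0_fin_numE; first by case: F0i.
  by apply: integral_ge0 => xi _; rewrite lee_fin normc_ge0.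
have [mF _] := FL.
have bound tau : 0 < tau ->
    normc (part J tau x - part J 0 x) <= tau * (C^-1 * (2 ^+ J * K)).
  move=> tau0; rewrite /part -inv_FTB; [|exact: gi|exact: gi].
  rewrite /inv_FT normcM normc_real ger0_norm ?invr_ge0 ?(ltW C_gt0)//.
  rewrite mulrCA ler_wpM2l ?invr_ge0 ?(ltW C_gt0)//.
  rewrite -lee_fin; apply: le_trans (FT_le _ _ _) _; first exact: cintegrableB (gi tau) (gi 0).
  rewrite mulrA EFinM -KE -ge0_integralZl_EFin//; last 3 first.
  - by move=> xi _; rewrite lee_fin normc_ge0.
  - by apply: emeasurable_normc; case: F0i.
  - by rewrite mulr_ge0 ?exprn_ge0// ltW.
  apply: ge0_le_integral => //.
  - by move=> xi _; rewrite lee_fin normc_ge0.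
  - by apply: emeasurable_normc; apply: cmeasurableB; [case: (gi tau)|case: (gi 0)].
  - by apply: measurable_funeM; apply: emeasurable_normc; case: F0i.
  move=> xi _; rewrite -EFinM lee_fin.
  rewrite /restr -mulrBr !normcM (normc_real (\1_(ballRn _) xi)) ger0_norm// indicE.
  case: (boolP (xi \in _)) => [/set_mem xJ|_]; last by rewrite !mul0r mulr0.
  rewrite !mul1r /modulate -mulrBl normcM ler_wpM2r ?normc_ge0//.
  apply: le_trans (normc_expiB _ _) _.
  rewrite mul0r subr0 normrM (gtr0_norm tau0) (ger0_norm (powR_ge0 _ _)).
  by rewrite ler_wpM2l ?(ltW tau0)//; exact: ballRn_powR_le.
have cv : t k * (C^-1 * (2 ^+ J * K)) @[k --> \oo] --> 0 * (C^-1 * (2 ^+ J * K)).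
  exact: cvgMl.
rewrite mul0r in cv.
near=> k; apply: le_lt_trans (bound _ (t_gt0 k)) _.
by near: k; exact: (cvgr_lt _ cv).
Unshelve. all: by end_near.
Qed.

Let part_frequently tau : {ae mu, forall x (e : R) (N : nat), 0 < e ->
  exists2 m, (N <= m)%N & normc (part m tau x - inv_fourier (modulate a tau F) x) < e}.
Proof.
have GL := L2_modulate a tau FL.
apply: sq2_cvg0_frequently (inv_fourier_radius a0 GL) => m.
have [[mG _] _] := inv_fourierP GL; exact: cmeasurableB (mpart m tau) mG.
Qed.

Lemma propagator_cvg_ae : {ae mu, forall x,
  (propagator a (t k) f x : R[i]^o) @[k --> \oo] --> (f x : R[i]^o)}.
Proof.
(* The exceptional set depends on the time; countably many times leave a single null set. *)
have freq : {ae mu, forall x k (e : R) (N : nat), 0 < e ->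
    exists2 m, (N <= m)%N & normc (part m (t k) x - propagator a (t k) f x) < e}.
  by apply: ae_foralln => k; exact: part_frequently.
(* At time 0 the multiplier is 1, so the parts approach [inv_fourier F], which inversion identifies
   with [f]. *)
have freq0 := part_frequently 0; rewrite modulate0 in freq0.
apply: filterS3 piece_dominated freq (filterI freq0 (fourier_inversion fL)).
move=> x [b [M [b0 bM pb]]] pu [p0 fx]; rewrite fx in p0.
apply: (dominated_interchange (p := fun m k => part m (t k) x) b0 bM _ _ pu p0).
- by move=> m k; rewrite pieceE.
- by move=> m e e0; exact: part_cvg.
Qed.

End pointwise_convergence.

Theorem corollary4 (R : realType) (n : nat) (a s : R) (t : nat -> R)
    (f : n.-tuple (measurableTypeR R) -> R[i]) :
  (1 <= n)%N -> 0 < a -> 0 < s ->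
  t 0%N < 1 ->
  (forall k : nat, t k.+1 < t k) ->
  (forall k : nat, 0 < t k) ->
  t k @[k --> \oo] --> 0 ->
  (\sum_(0 <= m <oo)
     covering_number (range t) (2 ^- m) * (2 `^ (- (2 * m%:R * s / a)))%:E
     < +oo)%E ->
  inH s f ->
  {ae lebesgueRn R n, forall x,
    (propagator a (t k) f x : R[i]^o) @[k --> \oo] --> (f x : R[i]^o)}.
Proof.
move=> _ a0 s0 _ t_dec t_gt0 t_cvg0 E_lty fH.
exact: (propagator_cvg_ae a0 s0 t_dec t_gt0 t_cvg0 E_lty fH).
Qed.
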